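(* For $l\in\{\pm1,\ldots,\pm N\}$, $\delta\in\{+,-\}$ and $\sigma\in\{1,-1\}$, we have, as identities of meromorphic functions of $(v,w)\in\mathbb{C}^N\times\mathbb{C}^N$, $$\big(\hat A_{l,\delta}(v)-\hat A_{-l,\delta}(w)\big)\hat{\mathcal{S}}(v,w)^\sigma=0,\qquad \hat{\mathcal{S}}(v,w)=\prod_{j,k=1}^NG(v_j-w_k).$$
   Context: Fix $a_+,a_->0$, $a=(a_++a_-)/2$. For $\delta\in\{+,-\}$, $-\delta$ denotes the opposite sign and $s_\delta(z)=\sinh(\pi z/a_\delta)$. The hyperbolic gamma function $G(z)$ is the meromorphic function on $\mathbb{C}$ given for $|\mathrm{Im}\,z|<a$ by $G(z)=\exp\Big(i\int_0^\infty\frac{dy}{y}\Big(\frac{\sin(2yz)}{2\sinh(a_+y)\sinh(a_-y)}-\frac{z}{a_+a_-y}\Big)\Big)$, extended meromorphically. The operator $\exp(\mp ic\partial_{v_m})$ acts on meromorphic $f$ by $f(v)\mapsto f(v_1,\ldots,v_m\mp ic,\ldots)$. For $k=1,\ldots,N$, $$\hat A_{\pm k,\delta}(v)=(\mp i)^{k(N-k)}\sum_{I\subset\{1,\ldots,N\},|I|=k}\ \prod_{m\in I,n\notin I}\frac{1}{2s_\delta(v_m-v_n)}\prod_{m\in I}\exp(\mp ia_{-\delta}\partial_{v_m}).$$ *)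

(* Defs.v *)
From Stdlib Require Import Reals.
From Coquelicot Require Import Coquelicot.
From mathcomp Require Import ssreflect ssrfun ssrbool eqtype ssrnat seq
  choice fintype finfun bigop finset.

Set Implicit Arguments.
Unset Strict Implicit.
Unset Printing Implicit Defensive.

Open Scope R_scope.

Definition Ci : C := (0%R, 1%R).

Definition Cexp (z : C) : C :=
  (exp (Re z) * cos (Im z), exp (Re z) * sin (Im z)).

Definition Csinh (z : C) : C :=
  Cdiv (Cminus (Cexp z) (Cexp (Copp z))) (RtoC 2).

Definition Csin (z : C) : C :=
  Cdiv (Cminus (Cexp (Cmult Ci z)) (Cexp (Copp (Cmult Ci z))))
       (Cmult (RtoC 2) Ci).

Definition sinhR (x : R) : R := (exp x - exp (- x)) / 2.

Fixpoint Cpown (z : C) (n : nat) : C :=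
  match n with O => RtoC 1 | S n' => Cmult z (Cpown z n') end.

Definition adelta (ap am : R) (d : bool) : R := if d then ap else am.
Definition ahalf (ap am : R) : R := (ap + am) / 2.

Definition sdelta (ap am : R) (d : bool) (z : C) : C :=
  Csinh (Cdiv (Cmult (RtoC PI) z) (RtoC (adelta ap am d))).

(* Integrand of the integral representation of the hyperbolic gamma function:
   (1/y) ( sin(2yz) / (2 sinh(a_+ y) sinh(a_- y)) - z/(a_+ a_- y) ) *)
Definition Gintegrand (ap am : R) (z : C) (y : R) : C :=
  Cdiv (Cminus (Cdiv (Csin (Cmult (RtoC (2 * y)) z))
                     (RtoC (2 * sinhR (ap * y) * sinhR (am * y))))
               (Cdiv z (RtoC (ap * am * y))))
       (RtoC y).

(* G(z) = exp( i \int_0^\infty ... dy ), valid for |Im z| < a *)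
Definition Gstrip (ap am : R) (z : C) : C :=
  Cexp (Cmult Ci (@RInt_gen C_R_CompleteNormedModule (Gintegrand ap am z)
                    (at_right 0) (Rbar_locally p_infty))).

(* Gx is the meromorphic extension of G: Gx agrees with the integral
   representation on the strip |Im z| < a, and Gx is complex differentiable
   off a closed discrete set P (the poles). *)
Definition closed_discrete (P : C -> Prop) : Prop :=
  forall z : C, exists r : R, 0 < r /\
    forall u : C, P u -> Cmod (Cminus u z) < r -> u = z.

Definition hyperbolic_gamma_ext (ap am : R) (Gx : C -> C) (P : C -> Prop)
  : Prop :=
  (forall z : C, Rabs (Im z) < ahalf ap am -> Gx z = Gstrip ap am z) /\
  closed_discrete P /\
  (forall z : C, ~ P z ->
     @ex_derive C_AbsRing C_NormedModule Gx z).

(* \hat A_{sgn k, delta}(v) applied to f, where sgn = true means +k,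
   sgn = false means -k.  The shift exp(-+ i a_{-delta} d/dv_m) maps
   v_m to v_m -+ i a_{-delta}. *)
Definition Ahat (ap am : R) (N : nat) (sgn : bool) (k : nat) (d : bool)
  (f : ('I_N -> C) -> C) (v : 'I_N -> C) : C :=
  Cmult (Cpown (if sgn then Copp Ci else Ci) (k * (N - k)))
   (\big[Cplus/RtoC 0]_(I : {set 'I_N} | #|I| == k)
      Cmult (\big[Cmult/RtoC 1]_(m in I) \big[Cmult/RtoC 1]_(n in ~: I)
               Cinv (Cmult (RtoC 2) (sdelta ap am d (Cminus (v m) (v n)))))
            (f (fun m => if m \in I then
                  (if sgn then Cminus (v m) (Cmult Ci (RtoC (adelta ap am (negb d))))
                          else Cplus (v m) (Cmult Ci (RtoC (adelta ap am (negb d)))))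
                  else v m))).

Definition Shat (N : nat) (Gx : C -> C) (v w : 'I_N -> C) : C :=
  \big[Cmult/RtoC 1]_(j < N) \big[Cmult/RtoC 1]_(k < N) Gx (Cminus (v j) (w k)).

Definition Cpow_sign (sigma : bool) (x : C) : C := if sigma then x else Cinv x.

(* the (common) shift of the differences v_j - w_k: -+ i a_{-delta} *)
Definition diff_shift (ap am : R) (sgn : bool) (d : bool) : C :=
  Cmult Ci (RtoC ((if sgn then 1 else -1) * adelta ap am (negb d))).

(* Main.v *)
(* The key fact is the difference equation
   [G z = 2 cosh (pi (z - i e / 2) / c) G (z - i e)], where [{c, e} = {a_+, a_-}].
   It divides the kernel out of the identity and leaves, in the variables
   [x = exp (2 pi v / c)] and [t = - exp (2 pi w / c)] (up to a phase), a rational identity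
   between a sum over subsets of the [x]'s and one over subsets of the [t]'s.  That identity
   is proved by induction on [N]: both sides are polynomials in one [x_a] of degree
   less than [N], and at [x_a = t_b] both reduce to the identity for [N - 1].

   On the imaginary axis the difference equation amounts to
   [int_0^oo (1/t - cosh (u t) / sinh t) / t dt = ln (2 cos (pi u / 2))].  Both sides satisfy the
   duplication formula [f y = f ((1 - y)/2) + f ((1 + y)/2)], which halves the best constant
   in a bound [|f (u + h) + f (u - h) - 2 f u| <= K h^2] for their difference; such a bound
   holds once the logarithmic singularities at [u = 1] and [u = -1] are cancelled by
   Frullani integrals.
   The equation extends to the rest of the plane by the identity theorem, which is derived
   here from Goursat's lemma since only complex differentiability is assumed. *)

From Stdlib Require Import Reals Lra Lia List Classical ClassicalEpsilon FunctionalExtensionality.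
From Coquelicot Require Import Coquelicot.
Require Import Defs.

(** * Integrals over the boundary of a rectangle *)

(** The hypotheses on [Gx] provide only the strip integral and differentiability off [P], so the
    difference equation can be checked directly only where both of its arguments lie in the strip.
    It is checked on a segment of the imaginary axis because there the integrand is purely
    imaginary: both values of [Gx] are positive reals and their ratio is the exponential of one real
    integral. On [P] the values of [Gx] are unconstrained, so the continuation has to go around [P]
    and its translate.

    In the rational identity the sum over subsets of the [x]'s has apparent poles at [x_a = x_m].
    Instead of first proving it polynomial, both sides are multiplied by the product of the
    [x_a - x_i]; the cleared sides vanish at each [x_m], and these extra roots pay for the increase
    in degree.

    Changing [sgn] and inverting the kernel both reverse the direction of the difference equation,
    so the four cases reduce to two: the factors sit either on the shifted variables or on the
    unshifted ones. Passing to complements of subsets exchanges the two. *)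

Notation CV := C_R_CompleteNormedModule.

(** Phrased with [Cmod], since [C] occurs both as a field, with [Cmod] balls, and as a real plane,
    with product balls; this form converts to both. *)
Definition Ccont (f : C -> C) (z : C) : Prop :=
  forall eps, 0 < eps -> exists d, 0 < d /\
    forall u, Cmod (u - z) < d -> Cmod (f u - f z) < eps.

Definition Cdiff (f : C -> C) (z : C) : Prop :=
  exists l : C, forall eps, 0 < eps -> exists d, 0 < d /\
    forall u, Cmod (u - z) < d ->
      Cmod (f u - f z - (u - z) * l) <= eps * Cmod (u - z).

Lemma ex_derive_Cdiff (f : C -> C) (z : C) :
  @ex_derive C_AbsRing C_NormedModule f z -> Cdiff f z.
Proof.
  intros [l [_ Hl]]; exists l; intros eps Heps.
  destruct (Hl z (fun P HP => HP) (mkposreal eps Heps)) as [d Hd].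
  exists d; split; [apply cond_pos|]; intros u Hu.
  exact (Hd u Hu).
Qed.

Lemma Cdiff_cont f z : Cdiff f z -> Ccont f z.
Proof.
  intros [l Hl] eps Heps.
  destruct (Hl 1 Rlt_0_1) as [d [Hd Hu]].
  pose proof (Cmod_ge_0 l) as Hl0.
  exists (Rmin d (eps / (Cmod l + 2))); split.
  { apply Rmin_pos; [lra|apply Rdiv_lt_0_compat; lra]. }
  intros u H; assert (Cmod (u - z) < d) as H1 by (eapply Rlt_le_trans; [exact H|apply Rmin_l]).
  assert (Cmod (u - z) < eps / (Cmod l + 2)) as H2 by (eapply Rlt_le_trans; [exact H|apply Rmin_r]).
  replace (f u - f z)%C with ((f u - f z - (u - z) * l) + (u - z) * l)%C by ring.
  eapply Rle_lt_trans; [apply Cmod_triangle|].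
  specialize (Hu u H1); rewrite Cmod_mult.
  apply Rle_lt_trans with (Cmod (u - z) * (Cmod l + 1)).
  { nra. }
  apply Rle_lt_trans with (eps / (Cmod l + 2) * (Cmod l + 1)).
  { apply Rmult_le_compat_r; lra. }
  apply Rmult_lt_reg_r with (Cmod l + 2); [lra|].
  replace (eps / (Cmod l + 2) * (Cmod l + 1) * (Cmod l + 2)) with (eps * (Cmod l + 1)) by (field;
    lra).
  nra.
Qed.

Lemma Cmod_re (z : C) : Rabs (fst z) <= Cmod z.
Proof.
  destruct z as [x y]; simpl; apply (Rle_trans _ (Rmax (Rabs x) (Rabs y))).
  - apply Rmax_l.
  - apply (Rmax_Cmod (x, y)).
Qed.

Lemma Cmod_im (z : C) : Rabs (snd z) <= Cmod z.
Proof.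
  destruct z as [x y]; simpl; apply (Rle_trans _ (Rmax (Rabs x) (Rabs y))).
  - apply Rmax_r.
  - apply (Rmax_Cmod (x, y)).
Qed.

Lemma Cmod_Ci : Cmod Ci = 1.
Proof. unfold Cmod, Ci; simpl; replace (0 * (0 * 1) + 1 * (1 * 1)) with 1 by ring; apply sqrt_1. Qed.

Lemma Cmod_le_sum (z : C) : Cmod z <= Rabs (fst z) + Rabs (snd z).
Proof.
  destruct z as [x y]; replace (x, y) with (RtoC x + Ci * RtoC y)%C.
  2: { unfold Ci, RtoC, Cmult, Cplus; simpl; f_equal; ring. }
  eapply Rle_trans; [apply Cmod_triangle|]; rewrite Cmod_mult, !Cmod_R, Cmod_Ci.
  simpl; rewrite Rmult_1_l; right; f_equal; f_equal; ring.
Qed.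

Lemma Ccont_hor f x y : Ccont f (x, y) ->
  continuous (fun t => f (t, y) : CV) x.
Proof.
  intros Hf; apply filterlim_locally; intros eps.
  destruct (Hf eps (cond_pos eps)) as [d [Hd H]].
  exists (mkposreal d Hd); intros t Ht.
  apply C_NormedModule_mixin_compat1; apply H.
  eapply Rle_lt_trans; [apply Cmod_le_sum|]; simpl.
  rewrite Rplus_opp_r, Rabs_R0, Rplus_0_r; exact Ht.
Qed.

Lemma Ccont_ver f x y : Ccont f (x, y) ->
  continuous (fun t => f (x, t) : CV) y.
Proof.
  intros Hf; apply filterlim_locally; intros eps.
  destruct (Hf eps (cond_pos eps)) as [d [Hd H]].
  exists (mkposreal d Hd); intros t Ht.
  apply C_NormedModule_mixin_compat1; apply H.
  eapply Rle_lt_trans; [apply Cmod_le_sum|]; simpl.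
  rewrite Rplus_opp_r, Rabs_R0, Rplus_0_l; exact Ht.
Qed.

Lemma is_RInt_Cmult (c : C) (f : R -> C) a b (l : C) :
  @is_RInt CV f a b l -> @is_RInt CV (fun t => Cmult c (f t)) a b (Cmult c l).
Proof.
  intros H.
  pose proof (is_RInt_fct_extend_fst (U := R_NormedModule) (V := R_NormedModule) f a b l H) as H1.
  pose proof (is_RInt_fct_extend_snd (U := R_NormedModule) (V := R_NormedModule) f a b l H) as H2.
  apply (is_RInt_fct_extend_pair (U := R_NormedModule) (V := R_NormedModule)).
  - exact (is_RInt_minus _ _ _ _ _ _ (is_RInt_scal _ _ _ (fst c) _ H1) (is_RInt_scal _ _ _ (snd c)
      _ H2)).
  - exact (is_RInt_plus _ _ _ _ _ _ (is_RInt_scal _ _ _ (fst c) _ H2) (is_RInt_scal _ _ _ (snd c) _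
      H1)).
Qed.

Definition seg_h (f : C -> C) (y a b : R) : C := @RInt CV (fun x => f (x, y)) a b.
Definition seg_v (f : C -> C) (x c d : R) : C := @RInt CV (fun y => f (x, y)) c d.
(** The counterclockwise contour integral; [Ci] is the velocity along the vertical sides. *)
Definition rect_int (f : C -> C) a b c d : C :=
  (seg_h f c a b + Ci * seg_v f b c d - seg_h f d a b - Ci * seg_v f a c d)%C.

Definition on_rect (P : C -> Prop) a b c d : Prop :=
  forall x y, a <= x <= b -> c <= y <= d -> P (x, y).
Definition on_border (P : C -> Prop) a b c d : Prop :=
  (forall x, a <= x <= b -> P (x, c) /\ P (x, d)) /\
  (forall y, c <= y <= d -> P (a, y) /\ P (b, y)).

Lemma on_rect_border P a b c d : a <= b -> c <= d ->
  on_rect P a b c d -> on_border P a b c d.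
Proof. intros H1 H2 H; split; intros t Ht; split; apply H; lra. Qed.

Lemma on_border_imp (P Q : C -> Prop) a b c d :
  (forall z, P z -> Q z) -> on_border P a b c d -> on_border Q a b c d.
Proof. intros H [H1 H2]; split; intros t Ht; split; apply H; [apply H1|apply H1|apply H2|apply H2]; exact Ht. Qed.

Lemma is_seg_h (f : C -> C) y a b : a <= b -> (forall x, a <= x <= b -> Ccont f (x, y)) ->
  @is_RInt CV (fun x => f (x, y)) a b (seg_h f y a b).
Proof.
  intros Hab H; apply RInt_correct, (ex_RInt_continuous (V := CV)).
  intros z Hz; rewrite Rmin_left, Rmax_right in Hz by exact Hab; apply Ccont_hor, H, Hz.
Qed.

Lemma is_seg_v (f : C -> C) x c d : c <= d -> (forall y, c <= y <= d -> Ccont f (x, y)) ->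
  @is_RInt CV (fun y => f (x, y)) c d (seg_v f x c d).
Proof.
  intros Hab H; apply RInt_correct, (ex_RInt_continuous (V := CV)).
  intros z Hz; rewrite Rmin_left, Rmax_right in Hz by exact Hab; apply Ccont_ver, H, Hz.
Qed.

Lemma rect_ext (f g : C -> C) a b c d : a <= b -> c <= d ->
  on_border (fun z => f z = g z) a b c d -> rect_int f a b c d = rect_int g a b c d.
Proof.
  intros Hab Hcd [H1 H2].
  assert (forall y, (forall x, a <= x <= b -> f (x, y) = g (x,
    y)) -> seg_h f y a b = seg_h g y a b) as Hh.
  { intros y H; apply (RInt_ext (V := CV)); intros t Ht.
    rewrite Rmin_left, Rmax_right in Ht by exact Hab; apply H; lra. }
  assert (forall x, (forall y, c <= y <= d -> f (x, y) = g (x,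
    y)) -> seg_v f x c d = seg_v g x c d) as Hv.
  { intros x H; apply (RInt_ext (V := CV)); intros t Ht.
    rewrite Rmin_left, Rmax_right in Ht by exact Hcd; apply H; lra. }
  unfold rect_int; rewrite (Hh c), (Hh d), (Hv a), (Hv b); try reflexivity;
    intros; solve [apply H1; assumption|apply H2; assumption].
Qed.

Lemma rect_lin (k : C) (f g : C -> C) a b c d : a <= b -> c <= d ->
  on_border (Ccont f) a b c d -> on_border (Ccont g) a b c d ->
  rect_int (fun z => f z + k * g z)%C a b c d = (rect_int f a b c d + k * rect_int g a b c d)%C.
Proof.
  intros Hab Hcd [F1 F2] [G1 G2].
  assert (forall y, (forall x, a <= x <= b -> Ccont f (x, y)) -> (forall x,
    a <= x <= b -> Ccont g (x, y)) ->
    seg_h (fun z => f z + k * g z)%C y a b = (seg_h f y a b + k * seg_h g y a b)%C) as Hh.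
  { intros y Hf Hg; apply (is_RInt_unique (V := CV)).
    apply (is_RInt_plus (V := CV)); [apply is_seg_h; assumption|].
    apply is_RInt_Cmult, is_seg_h; assumption. }
  assert (forall x, (forall y, c <= y <= d -> Ccont f (x, y)) -> (forall y,
    c <= y <= d -> Ccont g (x, y)) ->
    seg_v (fun z => f z + k * g z)%C x c d = (seg_v f x c d + k * seg_v g x c d)%C) as Hv.
  { intros y Hf Hg; apply (is_RInt_unique (V := CV)).
    apply (is_RInt_plus (V := CV)); [apply is_seg_v; assumption|].
    apply is_RInt_Cmult, is_seg_v; assumption. }
  unfold rect_int; rewrite !Hh, !Hv; try (intros; solve [apply F1; assumption|apply F2;
    assumption|apply G1; assumption|apply G2; assumption]).
  ring.
Qed.

Lemma rect_bound (f : C -> C) M a b c d : a <= b -> c <= d ->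
  on_border (Ccont f) a b c d -> on_border (fun z => Cmod (f z) <= M) a b c d ->
  Cmod (rect_int f a b c d) <= 2 * ((b - a) + (d - c)) * M.
Proof.
  intros Hab Hcd [F1 F2] [M1 M2].
  assert (forall y, (forall x, a <= x <= b -> Ccont f (x, y)) -> (forall x,
    a <= x <= b -> Cmod (f (x, y)) <= M) ->
    Cmod (seg_h f y a b) <= (b - a) * M) as Hh.
  { intros y Hf HM; rewrite Cmod_norm.
    apply (norm_RInt_le_const (V := C_R_NormedModule) (fun x => f (x, y)) a b);
      [exact Hab| |apply is_seg_h; assumption].
    intros x Hx; rewrite <- Cmod_norm; apply HM, Hx. }
  assert (forall x, (forall y, c <= y <= d -> Ccont f (x, y)) -> (forall y,
    c <= y <= d -> Cmod (f (x, y)) <= M) ->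
    Cmod (seg_v f x c d) <= (d - c) * M) as Hv.
  { intros x Hf HM; rewrite Cmod_norm.
    apply (norm_RInt_le_const (V := C_R_NormedModule) (fun y => f (x, y)) c d);
      [exact Hcd| |apply is_seg_v; assumption].
    intros y Hx; rewrite <- Cmod_norm; apply HM, Hx. }
  unfold rect_int, Cminus.
  eapply Rle_trans; [apply Cmod_triangle|]; rewrite Cmod_opp, Cmod_mult, Cmod_Ci.
  pose proof (Cmod_triangle (seg_h f c a b + Ci * seg_v f b c d) (- seg_h f d a b)) as T1.
  pose proof (Cmod_triangle (seg_h f c a b) (Ci * seg_v f b c d)) as T2.
  rewrite Cmod_opp in T1; rewrite Cmod_mult, Cmod_Ci in T2.
  assert (Cmod (seg_h f c a b) <= (b - a) * M) by (apply Hh; intros; [apply F1|apply M1];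
    assumption).
  assert (Cmod (seg_h f d a b) <= (b - a) * M) by (apply Hh; intros; [apply F1|apply M1];
    assumption).
  assert (Cmod (seg_v f a c d) <= (d - c) * M) by (apply Hv; intros; [apply F2|apply M2];
    assumption).
  assert (Cmod (seg_v f b c d) <= (d - c) * M) by (apply Hv; intros; [apply F2|apply M2];
    assumption).
  lra.
Qed.

Lemma rect_split_h (f : C -> C) a m b c d : a <= m <= b ->
  (forall x, a <= x <= b -> Ccont f (x, c) /\ Ccont f (x, d)) ->
  rect_int f a b c d = (rect_int f a m c d + rect_int f m b c d)%C.
Proof.
  intros Hm Hf.
  assert (forall y, (forall x, a <= x <= b -> Ccont f (x, y)) ->
    seg_h f y a b = (seg_h f y a m + seg_h f y m b)%C) as Hh.
  { intros y Hy; symmetry; apply (RInt_Chasles (V := CV) (fun x => f (x, y))).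
    - eexists; apply is_seg_h; [lra|]; intros; apply Hy; lra.
    - eexists; apply is_seg_h; [lra|]; intros; apply Hy; lra. }
  unfold rect_int; rewrite (Hh c), (Hh d); try (intros; apply Hf; assumption); ring.
Qed.

Lemma rect_split_v (f : C -> C) a b c m d : c <= m <= d ->
  (forall y, c <= y <= d -> Ccont f (a, y) /\ Ccont f (b, y)) ->
  rect_int f a b c d = (rect_int f a b c m + rect_int f a b m d)%C.
Proof.
  intros Hm Hf.
  assert (forall x, (forall y, c <= y <= d -> Ccont f (x, y)) ->
    seg_v f x c d = (seg_v f x c m + seg_v f x m d)%C) as Hh.
  { intros x Hx; symmetry; apply (RInt_Chasles (V := CV) (fun y => f (x, y))).
    - eexists; apply is_seg_v; [lra|]; intros; apply Hx; lra.
    - eexists; apply is_seg_v; [lra|]; intros; apply Hx; lra. }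
  unfold rect_int; rewrite (Hh a), (Hh b); try (intros; apply Hf; assumption); ring.
Qed.

Lemma is_RInt_id a b : is_RInt (fun x => x) a b ((b * b - a * a) / 2).
Proof.
  replace ((b * b - a * a) / 2) with (minus (b * b / 2) (a * a / 2)) by (unfold minus, plus, opp;
    simpl; field).
  apply (is_RInt_derive (fun x => x * x / 2)).
  - intros x _; auto_derive; [trivial|field].
  - intros x _; apply continuous_id.
Qed.

(** Disposes of the first-order expansion at the limit point in Goursat's lemma. *)
Lemma rect_affine (l0 l1 : C) a b c d :
  rect_int (fun z => l0 + z * l1)%C a b c d = 0%C.
Proof.
  assert (forall a b (k : C), @is_RInt CV (fun _ => k) a b (RtoC (b - a) * k)%C) as Hc.
  { intros a' b' k; pose proof (is_RInt_const (V := CV) a' b' k) as H.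
    replace (RtoC (b' - a') * k)%C with (scal (b' - a') k : CV); [exact H|].
    destruct k as [k1 k2]; unfold RtoC, Cmult; simpl.
    unfold scal; simpl; unfold prod_scal, scal; simpl; unfold mult; simpl; f_equal; ring. }
  assert (forall y, seg_h (fun z => l0 + z * l1)%C y a b =
    (RtoC (b - a) * l0 + l1 * ((b * b - a * a) / 2, (b - a) * y)%R)%C) as Hh.
  { intros y; apply (is_RInt_unique (V := CV)), (is_RInt_plus (V := CV)); [apply Hc|].
    apply (is_RInt_ext (V := CV) (fun x => l1 * (x, y))%C); [intros; apply Cmult_comm|].
    apply is_RInt_Cmult, (is_RInt_fct_extend_pair (U := R_NormedModule) (V := R_NormedModule));
      [apply is_RInt_id|exact (is_RInt_const a b y)]. }
  assert (forall x, seg_v (fun z => l0 + z * l1)%C x c d =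
    (RtoC (d - c) * l0 + l1 * ((d - c) * x, (d * d - c * c) / 2)%R)%C) as Hv.
  { intros y; apply (is_RInt_unique (V := CV)), (is_RInt_plus (V := CV)); [apply Hc|].
    apply (is_RInt_ext (V := CV) (fun x => l1 * (y, x))%C); [intros; apply Cmult_comm|].
    apply is_RInt_Cmult, (is_RInt_fct_extend_pair (U := R_NormedModule) (V := R_NormedModule));
      [exact (is_RInt_const c d y)|apply is_RInt_id]. }
  unfold rect_int; rewrite !Hh, !Hv; destruct l0, l1; unfold RtoC, Ci, Cminus, Cmult, Cplus, Copp;
    simpl.
  apply injective_projections; simpl; field.
Qed.

(** * Complex differentiability and the Cauchy-Goursat theorem *)

(** Opens access to the rules for sums, products and compositions, in the structure of [C] as a
    module over itself. *)
Lemma Cdiff_iff (f : C -> C) (z : C) :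
  Cdiff f z <-> @ex_derive C_AbsRing (AbsRing_NormedModule C_AbsRing) f z.
Proof.
  split.
  - intros [l Hl]; exists l; split;
      [apply (is_linear_scal_l (V := AbsRing_NormedModule C_AbsRing))|].
    intros x Hx eps.
    assert (x = z) as ->.
    { symmetry;
        exact (is_filter_lim_locally_unique (K := C_AbsRing) (V := AbsRing_NormedModule C_AbsRing)
        z x Hx). }
    destruct (Hl eps (cond_pos eps)) as [d [Hd Hu]].
    exists (mkposreal _ Hd); intros u Hb; exact (Hu u Hb).
  - intros [l [_ Hl]]; exists l; intros eps Heps.
    destruct (Hl z (fun P HP => HP) (mkposreal eps Heps)) as [d Hd].
    exists d; split; [apply cond_pos|]; intros u Hu; exact (Hd u Hu).
Qed.

Lemma Cdiff_comp f g z : Cdiff f (g z) -> Cdiff g z -> Cdiff (fun u => f (g u)) z.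
Proof. rewrite !Cdiff_iff; intros Hf Hg; exact (@ex_derive_comp C_AbsRing (AbsRing_NormedModule C_AbsRing) f g z Hf Hg). Qed.

Lemma Cdiff_plus f g z : Cdiff f z -> Cdiff g z -> Cdiff (fun u => f u + g u)%C z.
Proof. rewrite !Cdiff_iff; intros Hf Hg; exact (@ex_derive_plus C_AbsRing (AbsRing_NormedModule C_AbsRing) f g z Hf Hg). Qed.

Lemma Cdiff_mult f g z : Cdiff f z -> Cdiff g z -> Cdiff (fun u => f u * g u)%C z.
Proof.
  rewrite !Cdiff_iff; intros [df Hf] [dg Hg]; eexists.
  exact (is_derive_mult (K := C_AbsRing) f g z df dg Hf Hg Cmult_comm).
Qed.

Lemma Cdiff_const (k z : C) : Cdiff (fun _ => k) z.
Proof. rewrite Cdiff_iff; apply ex_derive_const. Qed.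

Lemma Cdiff_id (z : C) : Cdiff (fun u => u) z.
Proof. rewrite Cdiff_iff; apply (ex_derive_id (K := C_AbsRing)). Qed.

Lemma Cdiff_opp f z : Cdiff f z -> Cdiff (fun u => - f u)%C z.
Proof. rewrite !Cdiff_iff; intros Hf; exact (@ex_derive_opp C_AbsRing (AbsRing_NormedModule C_AbsRing) f z Hf). Qed.

Lemma Cdiff_minus f g z : Cdiff f z -> Cdiff g z -> Cdiff (fun u => f u - g u)%C z.
Proof. intros Hf Hg; exact (Cdiff_plus f _ z Hf (Cdiff_opp g z Hg)). Qed.

Lemma Cdiff_inv (z : C) : z <> 0%C -> Cdiff Cinv z.
Proof.
  intros Hz; pose proof (Cmod_gt_0 z) as [Hz0 _]; specialize (Hz0 Hz).
  exists (- / (z * z))%C; intros eps Heps.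
  (* The first bound keeps [Cmod u] above [Cmod z / 2]; the error [(u - z) / (u z^2)] per unit of
     [u - z] is then at most [2 |u - z| / |z|^3], which the second bound makes small. *)
  exists (Rmin (Cmod z / 2) (eps * (Cmod z * Cmod z * Cmod z) / 2)); split.
  { assert (0 < Cmod z * Cmod z * Cmod z) by (repeat apply Rmult_lt_0_compat; assumption).
    apply Rmin_pos; [lra|]; nra. }
  intros u Hu.
  assert (Cmod (u - z) < Cmod z / 2) as H1 by (eapply Rlt_le_trans; [exact Hu|apply Rmin_l]).
  assert (Cmod (u - z) < eps * (Cmod z * Cmod z * Cmod z) / 2) as H2 by (eapply Rlt_le_trans;
    [exact Hu|apply Rmin_r]).
  assert (Cmod z / 2 <= Cmod u) as H3.
  { pose proof (Cmod_triangle u (z - u)) as T; replace (u + (z - u))%C with z in T by ring.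
    replace (Cmod (z - u)) with (Cmod (u - z)) in T; [lra|].
    rewrite <- Cmod_opp; f_equal; ring. }
  assert (u <> 0%C) as Hu0 by (apply Cmod_gt_0; lra).
  replace (/ u - / z - (u - z) * - / (z * z))%C with ((u - z) * ((u - z) / (u * (z * z))))%C
    by (field; split; assumption).
  rewrite Cmod_mult, Rmult_comm; apply Rmult_le_compat_r; [apply Cmod_ge_0|].
  rewrite Cmod_div by (repeat apply Cmult_neq_0; assumption).
  rewrite !Cmod_mult; apply Rle_div_l.
  { repeat apply Rmult_gt_0_compat; lra. }
  apply Rlt_le, (Rlt_le_trans _ _ _ H2).
  replace (eps * (Cmod z * Cmod z * Cmod z) / 2) with (eps * ((Cmod z / 2) * (Cmod z * Cmod z))) by
    field.
  apply Rmult_le_compat_l; [lra|]; apply Rmult_le_compat_r; [nra|lra].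
Qed.

Lemma Cdiff_div (f g : C -> C) (z : C) : g z <> 0%C -> Cdiff f z -> Cdiff g z -> Cdiff (fun u => f u / g u)%C z.
Proof.
  intros H Hf Hg; apply (Cdiff_mult f (fun u => / g u)%C); [exact Hf|].
  apply (Cdiff_comp Cinv g); [apply Cdiff_inv; exact H|exact Hg].
Qed.

Lemma Cpow_diff (q : C) n z : Cdiff (fun u => Cpown (u - q) n) z.
Proof.
  induction n as [|n IH]; simpl; [apply Cdiff_const|].
  apply Cdiff_mult; [|exact IH]; apply Cdiff_minus; [apply Cdiff_id|apply Cdiff_const].
Qed.

Lemma Cpown_neq0 (z : C) n : z <> 0%C -> Cpown z n <> 0%C.
Proof.
  intros Hz; induction n as [|n IH]; simpl; [intros H; injection H; lra|].
  apply Cmult_neq_0; assumption.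
Qed.

Lemma Cmod_Cpown (z : C) n : Cmod (Cpown z n) = Cmod z ^ n.
Proof. induction n as [|n IH]; simpl; [apply Cmod_1|rewrite Cmod_mult, IH; reflexivity]. Qed.

Section Goursat.
Variables (f : C -> C) (a c w h : R).
Hypotheses (Hw : 0 <= w) (Hh : 0 <= h).
Hypothesis Hf : on_rect (Cdiff f) a (a + w) c (c + h).

(** After [n] bisections the sides are known, so a subrectangle is recorded by its lower left corner
    [s] alone. *)
Let R4 (n : nat) (s : R * R) : C :=
  rect_int f (fst s) (fst s + w / 2 ^ n) (snd s) (snd s + h / 2 ^ n).
Let inside (n : nat) (s : R * R) : Prop :=
  a <= fst s /\ fst s + w / 2 ^ n <= a + w /\ c <= snd s /\ snd s + h / 2 ^ n <= c + h.

Let half_pos (k : R) n : 0 <= k -> 0 <= k / 2 ^ n.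
Proof. intros Hk; apply Rdiv_le_0_compat; [exact Hk|apply pow_lt; lra]. Qed.

Let half_S (k : R) n : k / 2 ^ n = 2 * (k / 2 ^ S n).
Proof. simpl; field; apply pow_nonzero; lra. Qed.

(** The quarter at [s'] carries at least a quarter of the modulus of the integral over its
    parent. *)
Let next (n : nat) (s s' : R * R) : Prop :=
  (fst s' = fst s \/ fst s' = fst s + w / 2 ^ S n) /\
  (snd s' = snd s \/ snd s' = snd s + h / 2 ^ S n) /\
  Cmod (R4 n s) <= 4 * Cmod (R4 (S n) s').

Let quarter n s : inside n s -> exists s', next n s s'.
Proof.
  intros [I1 [I2 [I3 I4]]].
  pose proof (half_pos w (S n) Hw) as Pw; pose proof (half_pos h (S n) Hh) as Ph.
  pose proof (half_S w n) as Sw; pose proof (half_S h n) as Sh.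
  destruct s as [x y]; simpl fst in *; simpl snd in *.
  set (wn := w / 2 ^ S n) in *; set (hn := h / 2 ^ S n) in *.
  assert (forall u v, a <= u <= a + w -> c <= v <= c + h -> Ccont f (u, v)) as Hc.
  { intros u v Hu Hv; apply Cdiff_cont, Hf; assumption. }
  assert (R4 n (x, y) = (R4 (S n) (x, y) + R4 (S n) (x + wn, y)%R + (R4 (S n) (x,
    y + hn)%R + R4 (S n) (x + wn, y + hn)%R))%C) as E.
  { unfold R4; simpl fst; simpl snd; fold wn hn; rewrite Sw, Sh.
    rewrite (rect_split_v f x _ y (y + hn)); [|lra|intros; split; apply Hc; lra].
    rewrite (rect_split_h f x (x + wn) _ y (y + hn)); [|lra|intros; split; apply Hc; lra].
    rewrite (rect_split_h f x (x + wn) _ (y + hn)); [|lra|intros; split; apply Hc; lra].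
    replace (x + 2 * wn) with (x + wn + wn) by ring.
    replace (y + 2 * hn) with (y + hn + hn) by ring. reflexivity. }
  apply NNPP; intros Hno.
  assert (forall s', (fst s' = x \/ fst s' = x + wn) -> (snd s' = y \/ snd s' = y + hn) ->
    4 * Cmod (R4 (S n) s') < Cmod (R4 n (x, y))) as Hlt.
  { intros s' A B; apply Rnot_le_lt; intros L; apply Hno; exists s'; split; [exact A|split;
      [exact B|exact L]]. }
  assert (H1 := Hlt (x, y)); assert (H2 := Hlt (x + wn, y)); assert (H3 := Hlt (x, y + hn));
    assert (H4 := Hlt (x + wn, y + hn)).
  simpl fst in *; simpl snd in *.
  specialize (H1 (or_introl eq_refl) (or_introl eq_refl)).
  specialize (H2 (or_intror eq_refl) (or_introl eq_refl)).
  specialize (H3 (or_introl eq_refl) (or_intror eq_refl)).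
  specialize (H4 (or_intror eq_refl) (or_intror eq_refl)).
  assert (T := Cmod_triangle (R4 (S n) (x, y) + R4 (S n) (x + wn, y)%R) (R4 (S n) (x,
    y + hn)%R + R4 (S n) (x + wn, y + hn)%R)).
  assert (T1 := Cmod_triangle (R4 (S n) (x, y)) (R4 (S n) (x + wn, y)%R)).
  assert (T2 := Cmod_triangle (R4 (S n) (x, y + hn)%R) (R4 (S n) (x + wn, y + hn)%R)).
  rewrite <- E in T; lra.
Qed.

Let inside_next n s s' : inside n s -> next n s s' -> inside (S n) s'.
Proof.
  intros [I1 [I2 [I3 I4]]] [A [B _]].
  pose proof (half_pos w (S n) Hw) as Pw; pose proof (half_pos h (S n) Hh) as Ph.
  rewrite (half_S w n) in I2; rewrite (half_S h n) in I4.
  unfold inside; destruct A as [-> | ->], B as [-> | ->]; lra.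
Qed.

(** The choice is meaningful only when the current rectangle lies in the original one; hence
    [corner_spec] proves containment and the choice property together. *)
Fixpoint corner (n : nat) : R * R :=
  match n with
  | O => (a, c)
  | S n => epsilon (inhabits (a, c)) (next n (corner n))
  end.

Let corner_spec n : inside n (corner n) /\ next n (corner n) (corner (S n)).
Proof.
  assert (forall n, inside n (corner n) -> next n (corner n) (corner (S n))) as Hn.
  { intros m Hm; exact (epsilon_spec (inhabits (a, c)) (next m (corner m)) (quarter m _ Hm)). }
  assert (inside n (corner n)) as Hi.
  { induction n as [|n IH]; [unfold inside; simpl; lra|].
    exact (inside_next n _ _ IH (Hn n IH)). }
  split; [exact Hi|apply Hn, Hi].
Qed.

Let corner_nest n m :
  (fst (corner n) <= fst (corner (n + m)) /\
   fst (corner (n + m)) + w / 2 ^ (n + m) <= fst (corner n) + w / 2 ^ n) /\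
  (snd (corner n) <= snd (corner (n + m)) /\
   snd (corner (n + m)) + h / 2 ^ (n + m) <= snd (corner n) + h / 2 ^ n).
Proof.
  induction m as [|m IH]; [rewrite Nat.add_0_r; lra|].
  rewrite Nat.add_succ_r; destruct (corner_spec (n + m)) as [_ [A [B _]]].
  pose proof (half_pos w (S (n + m)) Hw) as Pw; pose proof (half_pos h (S (n + m)) Hh) as Ph.
  rewrite (half_S w (n + m)), (half_S h (n + m)) in IH.
  destruct A as [-> | ->], B as [-> | ->]; lra.
Qed.

(** Any left or lower end lies below any right or upper end, for arbitrary [n] and [m]; the supremum
    of the former then lies in every rectangle. *)
Let corner_le n m :
  fst (corner n) <= fst (corner m) + w / 2 ^ m /\ snd (corner n) <= snd (corner m) + h / 2 ^ m.
Proof.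
  destruct (Nat.le_ge_cases n m) as [L|L]; apply Nat.le_exists_sub in L; destruct L as [k [-> _]];
    rewrite Nat.add_comm.
  - destruct (corner_nest n k) as [A B].
    pose proof (half_pos w (n + k) Hw); pose proof (half_pos h (n + k) Hh); lra.
  - destruct (corner_nest m k) as [A B].
    pose proof (half_pos w (m + k) Hw); pose proof (half_pos h (m + k) Hh); lra.
Qed.

Let corner_limit : exists x y, forall n,
  fst (corner n) <= x <= fst (corner n) + w / 2 ^ n /\
  snd (corner n) <= y <= snd (corner n) + h / 2 ^ n.
Proof.
  assert (forall g : nat -> R, forall k, (forall n m, g n <= g m + k / 2 ^ m) ->
    exists x, forall n, g n <= x <= g n + k / 2 ^ n) as H.
  { intros g k Hg.
    destruct (completeness (fun x => exists n, x = g n)) as [x [U L]].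
    - exists (g 0%nat + k / 2 ^ 0); intros y [n ->]; apply Hg.
    - exists (g 0%nat), 0%nat; reflexivity.
    - exists x; intros n; split; [apply U; exists n; reflexivity|].
      apply L; intros y [m ->]; apply Hg. }
  destruct (H (fun n => fst (corner n)) w) as [x Hx]; [intros; apply corner_le|].
  destruct (H (fun n => snd (corner n)) h) as [y Hy]; [intros; apply corner_le|].
  exists x, y; intros n; split; [apply Hx|apply Hy].
Qed.

Theorem goursat_sides : rect_int f a (a + w) c (c + h) = 0%C.
Proof.
  assert (forall n, Cmod (rect_int f a (a + w) c (c + h)) <= 4 ^ n * Cmod (R4 n (corner n))) as Hn.
  { induction n as [|n IH].
    - unfold R4; simpl; rewrite !Rdiv_1_r; lra.
    - apply (Rle_trans _ _ _ IH); simpl; rewrite (Rmult_comm 4), Rmult_assoc.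
      apply Rmult_le_compat_l; [apply pow_le; lra|]; apply corner_spec. }
  destruct corner_limit as [x [y Hxy]].
  assert (Cdiff f (x, y)) as [l Hl].
  { apply Hf; [generalize (proj1 (Hxy 0%nat))|generalize (proj2 (Hxy 0%nat))]; simpl;
      rewrite Rdiv_1_r; lra. }
  apply Cmod_eq_0, Rle_antisym; [|apply Cmod_ge_0].
  apply Rnot_lt_le; intros Hpos; set (A := Cmod (rect_int f a (a + w) c (c + h))) in *.
  (* With derivative error [A / (2 K)], the squared size of the small rectangle cancels [4 ^ n] and
     leaves [A <= A (w + h)^2 / K]. This is absurd once [K] exceeds [(w + h)^2]; the summand 1 keeps
     [K] positive for a degenerate rectangle. *)
  set (K := 2 * ((w + h) * (w + h)) + 1).
  assert (0 < K) as HK by (unfold K; nra).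
  destruct (Hl (A / (2 * K))) as [d [Hd Hu]]; [apply Rdiv_lt_0_compat; lra|].
  destruct (pow_lt_1_zero (/ 2)) with (y := d / (w + h + 1)) as [n Hn2];
    [rewrite Rabs_pos_eq; lra|apply Rdiv_lt_0_compat; lra|].
  specialize (Hn2 n (Nat.le_refl n)); specialize (Hn n); destruct (Hxy n) as [Hx Hy].
  destruct (corner_spec n) as [[I1 [I2 [I3 I4]]] _].
  pose proof (half_pos w n Hw) as Pw; pose proof (half_pos h n Hh) as Ph.
  assert (0 < 2 ^ n) as P2 by (apply pow_lt; lra).
  rewrite Rabs_pos_eq in Hn2 by (apply pow_le; lra).
  rewrite pow_inv in Hn2.
  assert (w / 2 ^ n + h / 2 ^ n < d) as Hsmall.
  { apply Rlt_le_trans with ((w + h + 1) / 2 ^ n).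
    - rewrite <- Rdiv_plus_distr; apply Rmult_lt_compat_r; [apply Rinv_0_lt_compat, P2|lra].
    - apply Rlt_le; replace d with ((w + h + 1) * (d / (w + h + 1))) by (field; lra).
      apply Rmult_lt_compat_l; lra. }
  unfold R4 in Hn; set (x0 := fst (corner n)) in *; set (y0 := snd (corner n)) in *.
  set (wn := w / 2 ^ n) in *; set (hn := h / 2 ^ n) in *.
  assert (forall u v, x0 <= u <= x0 + wn -> y0 <= v <= y0 + hn -> Cmod ((u, v) - (x,
    y))%C <= wn + hn) as Hdist.
  { intros u v Hu' Hv; eapply Rle_trans; [apply Cmod_le_sum|]; simpl.
    apply Rplus_le_compat; apply Rabs_le; lra. }
  assert (Cmod (rect_int f x0 (x0 + wn) y0 (y0 + hn)) <= 2 * (wn + hn) * (A / (2 * K) * (wn + hn)))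
    as Hb.
  (* Subtracting the tangent at the limit point does not change the integral, and leaves an
     integrand of size [A / (2 K)] times the distance. *)
  { set (aff := fun z : C => (f (x, y) - (x, y) * l + z * l)%C).
    assert (forall z, Cdiff aff z) as Haff.
    { intros z; apply Cdiff_plus; [apply Cdiff_const|apply Cdiff_mult;
        [apply Cdiff_id|apply Cdiff_const]]. }
    assert (on_rect (Cdiff f) x0 (x0 + wn) y0 (y0 + hn)) as Hsub.
    { intros u v Hu' Hv; apply Hf; lra. }
    pose proof (rect_lin (- (1))%C f aff x0 (x0 + wn) y0 (y0 + hn)) as E.
    assert (rect_int aff x0 (x0 + wn) y0 (y0 + hn) = 0%C) as Ea by apply rect_affine;
      rewrite Ea in E.
    rewrite Cmult_0_r, Cplus_0_r in E; rewrite <- E; try lra.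
    - replace (2 * (wn + hn)) with (2 * ((x0 + wn - x0) + (y0 + hn - y0))) by ring.
      apply rect_bound; try lra; apply on_rect_border; try lra; intros u v Hu' Hv.
      + apply Cdiff_cont, Cdiff_plus; [apply Hsub; assumption|].
        apply Cdiff_mult; [apply Cdiff_const|apply Haff].
      + unfold aff; replace (f (u, v) + - (1) * (f (x, y) - (x, y) * l + (u, v) * l))%C
          with (f (u, v) - f (x, y) - ((u, v) - (x, y)) * l)%C by ring.
        assert (D := Hdist u v Hu' Hv).
        eapply Rle_trans; [apply Hu; lra|].
        apply Rmult_le_compat_l; [|exact D].
        apply Rlt_le, Rdiv_lt_0_compat; lra.
    - apply on_rect_border; try lra; intros u v Hu' Hv; apply Cdiff_cont, Hsub; assumption.
    - apply on_rect_border; try lra; intros u v Hu' Hv; apply Cdiff_cont, Haff. }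
  assert (4 ^ n = 2 ^ n * 2 ^ n) as E4 by (rewrite <- Rpow_mult_distr; f_equal; lra).
  assert (2 ^ n * (wn + hn) = w + h) as Ew by (unfold wn, hn; field; lra).
  assert (A <= 2 * (A / (2 * K)) * ((w + h) * (w + h))) as Fin.
  { apply (Rle_trans _ _ _ Hn); rewrite E4, <- Ew.
    replace (2 * (A / (2 * K)) * (2 ^ n * (wn + hn) * (2 ^ n * (wn + hn))))
      with (2 ^ n * 2 ^ n * (2 * (wn + hn) * (A / (2 * K) * (wn + hn)))) by ring.
    apply Rmult_le_compat_l; [nra|exact Hb]. }
  replace (2 * (A / (2 * K)) * ((w + h) * (w + h))) with (A * (((w + h) * (w + h)) / K)) in Fin by
    (field; lra).
  assert ((w + h) * (w + h) / K < 1) as L1.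
  { apply Rlt_div_l; [exact HK|]; unfold K; nra. }
  nra.
Qed.
End Goursat.

Theorem goursat f a b c d : a <= b -> c <= d ->
  on_rect (Cdiff f) a b c d -> rect_int f a b c d = 0%C.
Proof.
  intros Hab Hcd Hf; replace b with (a + (b - a)) by ring; replace d with (c + (d - c)) by ring.
  apply goursat_sides; try lra; intros u v Hu Hv; apply Hf; lra.
Qed.

(** * The Cauchy formula and accumulation of zeros *)

Lemma Csub_neq0 (z p : C) : z <> p -> (z - p)%C <> 0%C.
Proof. intros H E; apply H; replace z with (z - p + p)%C by ring; rewrite E; ring. Qed.

Lemma Cneq_coord (x y : R) (p : C) : x <> fst p \/ y <> snd p -> (x, y) <> p.
Proof. intros H E; subst p; simpl in H; tauto. Qed.

Section Cauchy.
Variables (f : C -> C) (a b c d : R) (p : C).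
Hypotheses (Hp1 : a < fst p < b) (Hp2 : c < snd p < d).
Hypothesis Hf : on_rect (Cdiff f) a b c d.

Let q (z : C) : C := ((f z - f p) / (z - p))%C.

Let q_diff x y : a <= x <= b -> c <= y <= d -> (x, y) <> p -> Cdiff q (x, y).
Proof.
  intros Hx Hy Hne; apply Cdiff_div; [apply Csub_neq0, Hne| |].
  - apply Cdiff_minus; [apply Hf; assumption|apply Cdiff_const].
  - apply Cdiff_minus; [apply Cdiff_id|apply Cdiff_const].
Qed.

Let rect_shrink e : 0 < e -> a < fst p - e -> fst p + e < b -> c < snd p - e -> snd p + e < d ->
  rect_int q a b c d = rect_int q (fst p - e) (fst p + e) (snd p - e) (snd p + e).
Proof.
  intros He H1 H2 H3 H4; set (p1 := fst p) in *; set (p2 := snd p) in *.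
  assert (forall x y, a <= x <= b -> c <= y <= d -> x <> p1 \/ y <> p2 -> Ccont q (x, y)) as Hc.
  { intros x y Hx Hy Hn; apply Cdiff_cont, q_diff; [exact Hx|exact Hy|apply Cneq_coord, Hn]. }
  rewrite (rect_split_h q a (p1 - e) b); [|lra|intros; split; apply Hc; lra].
  rewrite (rect_split_h q (p1 - e) (p1 + e) b); [|lra|intros; split; apply Hc; lra].
  rewrite (rect_split_v q (p1 - e) (p1 + e) c (p2 - e) d); [|lra|intros; split; apply Hc; lra].
  rewrite (rect_split_v q (p1 - e) (p1 + e) (p2 - e) (p2 + e) d); [|lra|intros; split; apply Hc;
    lra].
  rewrite (goursat q a (p1 - e)), (goursat q (p1 + e) b), (goursat q (p1 - e) (p1 + e) c (p2 - e)),
    (goursat q (p1 - e) (p1 + e) (p2 + e) d);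
    try lra; try ring;
    intros x y Hx Hy; (apply q_diff; [lra|lra|apply Cneq_coord; fold p1 p2; lra]).
Qed.

(** The quotient is differentiable away from [p], so the contour can be shrunk to a small square
    around [p]; it is bounded near [p], so the integral tends to 0 with the perimeter. Its value at
    [p] itself never enters. *)
Let rect_quotient : rect_int q a b c d = 0%C.
Proof.
  assert (Cdiff f p) as [l Hl] by (rewrite (surjective_pairing p); apply Hf; lra).
  destruct (Hl 1 Rlt_0_1) as [r [Hr Hb]].
  pose proof (Cmod_ge_0 l) as Hl0.
  apply Cmod_eq_0, Rle_antisym; [|apply Cmod_ge_0].
  apply le_epsilon; intros eps Heps; rewrite Rplus_0_l.
  set (m := Rmin (Rmin (fst p - a) (b - fst p)) (Rmin (snd p - c) (d - snd p))).
  assert (0 < m) as Hm by (unfold m; repeat apply Rmin_pos; lra).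
  assert (m <= fst p - a /\ m <= b - fst p /\ m <= snd p - c /\ m <= d - snd p) as Hm4.
  { unfold m; pose proof (Rmin_l (Rmin (fst p - a) (b - fst p)) (Rmin (snd p - c) (d - snd p))).
    pose proof (Rmin_r (Rmin (fst p - a) (b - fst p)) (Rmin (snd p - c) (d - snd p))).
    pose proof (Rmin_l (fst p - a) (b - fst p)). pose proof (Rmin_r (fst p - a) (b - fst p)).
    pose proof (Rmin_l (snd p - c) (d - snd p)). pose proof (Rmin_r (snd p - c) (d - snd p)). lra. }
  (* The square of half side [e] has perimeter [8 e] and [q] is bounded by [Cmod l + 1] on it;
     [m / 2] keeps it inside the rectangle and [r / 4] inside the disc where the derivative estimate
     holds. *)
  set (e := Rmin (Rmin (m / 2) (r / 4)) (eps / (8 * (Cmod l + 1)))).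
  assert (0 < e) as He by (unfold e; repeat apply Rmin_pos; try apply Rdiv_lt_0_compat; lra).
  assert (e <= m / 2 /\ e <= r / 4 /\ e <= eps / (8 * (Cmod l + 1))) as [E1 [E2 E3]].
  { unfold e; pose proof (Rmin_l (Rmin (m / 2) (r / 4)) (eps / (8 * (Cmod l + 1)))).
    pose proof (Rmin_r (Rmin (m / 2) (r / 4)) (eps / (8 * (Cmod l + 1)))).
    pose proof (Rmin_l (m / 2) (r / 4)). pose proof (Rmin_r (m / 2) (r / 4)). lra. }
  rewrite (rect_shrink e) by lra.
  apply Rle_trans with (2 * (4 * e) * (Cmod l + 1)).
  2: { apply Rle_trans with (8 * (Cmod l + 1) * e); [right; ring|].
       replace eps with (8 * (Cmod l + 1) * (eps / (8 * (Cmod l + 1)))) by (field; lra).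
       apply Rmult_le_compat_l; lra. }
  replace (4 * e) with ((fst p + e - (fst p - e)) + (snd p + e - (snd p - e))) by ring.
  assert (forall x y, fst p - e <= x <= fst p + e -> snd p - e <= y <= snd p + e ->
     (x, y) <> p -> Cmod (q (x, y)) <= Cmod l + 1) as Hq.
  { intros x y Hx Hy Hne.
    assert (Cmod ((x, y) - p)%C < r) as Hd.
    { eapply Rle_lt_trans; [apply Cmod_le_sum|]; simpl.
      apply Rle_lt_trans with (e + e); [|lra]; apply Rplus_le_compat; apply Rabs_le; lra. }
    specialize (Hb _ Hd); rewrite Rmult_1_l in Hb.
    pose proof (Csub_neq0 _ _ Hne) as Hn0; pose proof (proj1 (Cmod_gt_0 _) Hn0) as Hpos.
    unfold q; rewrite Cmod_div by exact Hn0; apply Rle_div_l; [exact Hpos|].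
    replace (f (x, y) - f p)%C with ((f (x, y) - f p - ((x, y) - p) * l) + ((x,
      y) - p) * l)%C by ring.
    eapply Rle_trans; [apply Cmod_triangle|]; rewrite Cmod_mult; lra. }
  apply rect_bound; try lra.
  - split; intros t Ht; split; apply Cdiff_cont, q_diff; try lra; apply Cneq_coord; lra.
  - split; intros t Ht; split; apply Hq; try lra; apply Cneq_coord; lra.
Qed.

(** The winding integral stays on the right, because only its nonvanishing is needed and not its
    value. *)
Theorem cauchy_formula :
  rect_int (fun z => f z / (z - p))%C a b c d = (f p * rect_int (fun z => / (z - p))%C a b c d)%C.
Proof.
  assert (forall x y, x <> fst p \/ y <> snd p -> Cdiff (fun z => / (z - p))%C (x, y)) as Hi.
  { intros x y H; apply (Cdiff_comp Cinv (fun z => z - p)%C).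
    - apply Cdiff_inv, Csub_neq0, Cneq_coord, H.
    - apply Cdiff_minus; [apply Cdiff_id|apply Cdiff_const]. }
  rewrite <- (Cplus_0_l (f p * _)%C), <- rect_quotient, <- rect_lin; try lra.
  - apply rect_ext; try lra; split; intros t Ht; split; cbv beta; unfold q; field; apply Csub_neq0,
      Cneq_coord; lra.
  - split; intros t Ht; split; apply Cdiff_cont, q_diff; try lra; apply Cneq_coord; lra.
  - split; intros t Ht; split; apply Cdiff_cont, Hi; lra.
Qed.
End Cauchy.

(** With [z = x + i y], the imaginary part of [1 / (z - p)] has the sign of [snd p - y] and its real
    part that of [x - fst p]. With the orientation, all four sides contribute positively to the
    imaginary part of the integral. *)
Lemma winding_neq0 a b c d (p : C) : a < fst p < b -> c < snd p < d ->
  rect_int (fun z => / (z - p))%C a b c d <> 0%C.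
Proof.
  intros Hp1 Hp2 E; set (g := fun z : C => (/ (z - p))%C) in *.
  assert (forall x y, x <> fst p \/ y <> snd p -> Ccont g (x, y)) as Hi.
  { intros x y H; apply Cdiff_cont, (Cdiff_comp Cinv (fun z => z - p)%C).
    - apply Cdiff_inv, Csub_neq0, Cneq_coord, H.
    - apply Cdiff_minus; [apply Cdiff_id|apply Cdiff_const]. }
  assert (forall x y, x <> fst p \/ y <> snd p ->
     0 < (x - fst p) ^ 2 + (y - snd p) ^ 2) as Hpos.
  { intros x y [H|H].
    - assert (0 < (x - fst p) ^ 2) by (apply pow2_gt_0; intros E';
        exact (H (Rminus_diag_uniq _ _ E'))).
      pose proof (pow2_ge_0 (x - fst p)); pose proof (pow2_ge_0 (y - snd p)); lra.
    - assert (0 < (y - snd p) ^ 2) by (apply pow2_gt_0; intros E';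
        exact (H (Rminus_diag_uniq _ _ E'))).
      pose proof (pow2_ge_0 (x - fst p)); pose proof (pow2_ge_0 (y - snd p)); lra. }
  assert (forall y, (y <> snd p) -> snd (seg_h g y a b) * (y - snd p) < 0) as Hh.
  { intros y Hy.
    pose proof (is_seg_h g y a b ltac:(lra) (fun x _ => Hi x y (or_intror Hy))) as I.
    pose proof (is_RInt_fct_extend_snd (U := R_NormedModule) (V := R_NormedModule) _ _ _ _ I) as I2.
    apply (is_RInt_scal _ _ _ (- (y - snd p))) in I2.
    assert (0 < - (y - snd p) * snd (seg_h g y a b)); [|lra].
    replace (- (y - snd p) * snd (seg_h g y a b)) with (RInt (fun t => scal (- (y - snd p)) (snd (g
      (t, y)))) a b)
      by (apply (is_RInt_unique (V := R_CompleteNormedModule)), I2).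
    apply RInt_gt_0; [lra| |].
    - intros x Hx; unfold scal; simpl; unfold mult; simpl.
      specialize (Hpos x y (or_intror Hy)); simpl in Hpos.
      replace (- (y - snd p) * (- (y + - snd p) / _)) with
        ((y - snd p) ^ 2 / ((x - fst p) ^ 2 + (y - snd p) ^ 2)) by (simpl; field; lra).
      apply Rdiv_lt_0_compat; [apply pow2_gt_0; intros E';
        exact (Hy (Rminus_diag_uniq _ _ E'))|simpl; lra].
    - intros x Hx; apply (continuous_scal_r (K := R_AbsRing) (V := R_NormedModule)).
      apply (continuous_comp (fun t => g (t, y)) snd); [apply Ccont_hor, Hi;
        tauto|apply continuous_snd]. }
  assert (forall x, (x <> fst p) -> 0 < fst (seg_v g x c d) * (x - fst p)) as Hv.
  { intros x Hx.
    pose proof (is_seg_v g x c d ltac:(lra) (fun y _ => Hi x y (or_introl Hx))) as I.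
    pose proof (is_RInt_fct_extend_fst (U := R_NormedModule) (V := R_NormedModule) _ _ _ _ I) as I2.
    apply (is_RInt_scal _ _ _ (x - fst p)) in I2.
    rewrite Rmult_comm.
    replace ((x - fst p) * fst (seg_v g x c d)) with (RInt (fun t => scal (x - fst p) (fst (g (x,
      t)))) c d)
      by (apply (is_RInt_unique (V := R_CompleteNormedModule)), I2).
    apply RInt_gt_0; [lra| |].
    - intros y Hy; unfold scal; simpl; unfold mult; simpl.
      specialize (Hpos x y (or_introl Hx)); simpl in Hpos.
      replace ((x - fst p) * ((x + - fst p) / _)) with
        ((x - fst p) ^ 2 / ((x - fst p) ^ 2 + (y - snd p) ^ 2)) by (simpl; field; lra).
      apply Rdiv_lt_0_compat; [apply pow2_gt_0; intros E';
        exact (Hx (Rminus_diag_uniq _ _ E'))|simpl; lra].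
    - intros y Hy; apply (continuous_scal_r (K := R_AbsRing) (V := R_NormedModule)).
      apply (continuous_comp (fun t => g (x, t)) fst); [apply Ccont_ver, Hi;
        tauto|apply continuous_fst]. }
  pose proof (Hh c ltac:(lra)) as A1; pose proof (Hh d ltac:(lra)) as A2.
  pose proof (Hv a ltac:(lra)) as A3; pose proof (Hv b ltac:(lra)) as A4.
  unfold rect_int in E; revert E A1 A2 A3 A4.
  generalize (seg_h g c a b) (seg_h g d a b) (seg_v g a c d) (seg_v g b c d);
    intros s1 s2 s3 s4 E A1 A2 A3 A4.
  apply (f_equal snd) in E; unfold Ci, Cminus, Cmult, Cplus, Copp, RtoC in E; simpl in E.
  assert (0 < snd s1) by nra; assert (snd s2 < 0) by nra.
  assert (fst s3 < 0) by nra; assert (0 < fst s4) by nra.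
  lra.
Qed.

Lemma Ccont_bounded (f : C -> C) q : Ccont f q ->
  exists r, 0 < r /\ forall u, Cmod (u - q) < r -> Cmod (f u) <= Cmod (f q) + 1.
Proof.
  intros H; destruct (H 1 Rlt_0_1) as [r [Hr Hb]]; exists r; split; [exact Hr|]; intros u Hu.
  specialize (Hb u Hu); pose proof (Cmod_triangle (f u - f q) (f q)) as T.
  replace (f u - f q + f q)%C with (f u) in T by ring; lra.
Qed.

Lemma Cpown_S (z : C) m : Cpown z (S m) = (z * Cpown z m)%C.
Proof. reflexivity. Qed.

(* In the proof, [f p * W p = (p - q)^m * E m p] with [W p] the winding number, and [E m q] is
   up to the factor [W] the Taylor coefficient of order [m]; zeros tending to [q] kill it,
   which gives the same identity for [m + 1]. *)
Theorem vanishing_of_zeros_tending (f : C -> C) (q : C) (rho : R) : 0 < rho ->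
  (forall u, Cmod (u - q) < rho -> Cdiff f u) ->
  (forall e, 0 < e -> exists p, p <> q /\ Cmod (p - q) < e /\ f p = 0%C) ->
  exists e, 0 < e /\ forall p, Cmod (p - q) < e -> f p = 0%C.
Proof.
  intros Hrho Hf Hz.
  destruct (Ccont_bounded f q) as [r0 [Hr0 HM]].
  { apply Cdiff_cont, Hf; replace (q - q)%C with (RtoC 0) by ring; rewrite Cmod_0; exact Hrho. }
  set (M := Cmod (f q) + 1) in *.
  assert (0 < M) as HM0 by (unfold M; pose proof (Cmod_ge_0 (f q)); lra).
  set (r := Rmin rho r0 / 4).
  assert (0 < r) as Hr by (unfold r; pose proof (Rmin_pos _ _ Hrho Hr0); lra).
  assert (4 * r <= rho /\ 4 * r <= r0) as [Hr1 Hr2].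
  { unfold r; pose proof (Rmin_l rho r0); pose proof (Rmin_r rho r0); lra. }
  set (a := fst q - r); set (b := fst q + r); set (c := snd q - r); set (d := snd q + r).
  assert (a <= b) as Hab by (unfold a, b; lra); assert (c <= d) as Hcd by (unfold c, d; lra).
  assert (forall x y, a <= x <= b -> c <= y <= d -> Cmod ((x, y) - q)%C <= 2 * r) as Hin.
  { intros x y Hx Hy; eapply Rle_trans; [apply Cmod_le_sum|]; simpl; unfold a, b, c, d in *.
    replace (2 * r) with (r + r) by ring; apply Rplus_le_compat; apply Rabs_le; lra. }
  assert (on_rect (Cdiff f) a b c d) as Hfr.
  { intros x y Hx Hy; apply Hf; specialize (Hin x y Hx Hy); lra. }
  assert (on_border (fun z => Cmod (f z) <= M /\ r <= Cmod (z - q) /\ Cdiff f z) a b c d) as Hbd.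
  { split; intros t Ht; (split; (split; [|split]); try (apply Hfr; lra);
      try (apply HM; eapply Rle_lt_trans; [apply Hin; lra|lra])).
    1, 2: eapply Rle_trans; [|apply Cmod_im]; simpl; unfold c, d.
    3, 4: eapply Rle_trans; [|apply Cmod_re]; simpl; unfold a, b.
    1, 3: rewrite Rabs_left; lra.
    1, 2: rewrite Rabs_pos_eq; lra. }
  set (E := fun m p => rect_int (fun z => f z / (Cpown (z - q) m * (z - p)))%C a b c d).
  assert (forall p z, Cmod (p - q) < r / 2 -> r <= Cmod (z - q) -> r / 2 <= Cmod (z - p)) as Hfar.
  { intros p z Hp Hz'; pose proof (Cmod_triangle (z - p) (p - q)) as T.
    replace (z - p + (p - q))%C with (z - q)%C in T by ring; lra. }
  assert (forall z : C, 0 < Cmod z -> z <> 0%C) as Hnz by (intros z; apply Cmod_gt_0).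
  assert (forall m p, Cmod (p - q) < r / 2 ->
     on_border (Cdiff (fun z => f z / (Cpown (z - q) m * (z - p)))%C) a b c d) as HEd.
  { intros m p Hp; revert Hbd; apply on_border_imp; intros z [_ [Hz1 Hz2]].
    apply Cdiff_div; [|exact Hz2|].
    - apply Cmult_neq_0; [apply Cpown_neq0|]; apply Hnz; [lra|specialize (Hfar p z Hp Hz1); lra].
    - apply Cdiff_mult; [apply Cpow_diff|apply Cdiff_minus; [apply Cdiff_id|apply Cdiff_const]]. }
  assert (forall m p,
    Cmod (p - q) < r / 2 -> Cmod (E m p) <= 8 * r * (M / (r ^ m * (r / 2)))) as HEb.
  { intros m p Hp; unfold E.
    replace (8 * r) with (2 * ((b - a) + (d - c))) by (unfold a, b, c, d; ring).
    apply rect_bound; [exact Hab|exact Hcd| |].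
    - generalize (HEd m p Hp); apply on_border_imp; intros z; apply Cdiff_cont.
    - revert Hbd; apply on_border_imp; intros z [Hz1 [Hz2 _]].
      specialize (Hfar p z Hp Hz2).
      assert (0 < r ^ m) by (apply pow_lt; lra).
      rewrite Cmod_div, Cmod_mult, Cmod_Cpown.
      2: { apply Cmult_neq_0; [apply Cpown_neq0|]; apply Hnz; lra. }
      assert (r ^ m <= Cmod (z - q) ^ m) by (apply pow_incr; lra).
      apply Rmult_le_compat; [apply Cmod_ge_0| |exact Hz1|].
      + apply Rlt_le, Rinv_0_lt_compat, Rmult_lt_0_compat; lra.
      + apply Rinv_le_contravar; [apply Rmult_lt_0_compat; lra|apply Rmult_le_compat; lra]. }
  (* One step of the geometric series: [1 / (z - p) = 1 / (z - q) + (p - q) / ((z - q) (z - p))]. *)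
  assert (forall m p, Cmod (p - q) < r / 2 -> E m p = (E m q + (p - q) * E (S m) p)%C) as HEr.
  { intros m p Hp.
    assert (Cmod (q - q) < r / 2) as Hq by (replace (q - q)%C with (RtoC 0) by ring;
      rewrite Cmod_0; lra).
    unfold E; rewrite <- rect_lin; [|exact Hab|exact Hcd| |].
    - apply rect_ext; [exact Hab|exact Hcd|].
      revert Hbd; apply on_border_imp; intros z [Hz1 [Hz2 _]].
      assert (z - q <> 0)%C by (apply Hnz; lra).
      assert (z - p <> 0)%C by (apply Hnz; specialize (Hfar p z Hp Hz2); lra).
      pose proof (Cpown_neq0 (z - q) m ltac:(assumption)).
      rewrite Cpown_S; field; repeat split; assumption.
    - generalize (HEd m q Hq); apply on_border_imp; intros z; apply Cdiff_cont.
    - generalize (HEd (S m) p Hp); apply on_border_imp; intros z; apply Cdiff_cont. }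
  set (W := fun p => rect_int (fun z => / (z - p))%C a b c d).
  assert (forall p, Cmod (p - q) < r / 2 -> a < fst p < b /\ c < snd p < d) as Hins.
  { intros p Hp; pose proof (Cmod_re (p - q)) as H1; pose proof (Cmod_im (p - q)) as H2.
    simpl in H1, H2; unfold a, b, c, d.
    assert (Rabs (fst p + - fst q) < r) as H3 by lra;
      assert (Rabs (snd p + - snd q) < r) as H4 by lra.
    apply Rabs_def2 in H3; apply Rabs_def2 in H4; lra. }
  assert (forall m p, Cmod (p - q) < r / 2 -> (f p * W p = Cpown (p - q) m * E m p)%C) as Hm.
  { induction m as [|m IH]; intros p Hp.
    - simpl; rewrite Cmult_1_l; unfold W; rewrite <- cauchy_formula; try apply Hins; try assumption.
      unfold E; apply rect_ext; [exact Hab|exact Hcd|].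
      revert Hbd; apply on_border_imp; intros z [_ [Hz2 _]]; simpl.
      field; apply Hnz; specialize (Hfar p z Hp Hz2); lra.
    (* At a zero [p'] near [q] the induction hypothesis gives [E m p' = 0], so [E m q] equals
       [- (p' - q) E (m + 1) p'], which is small since [E (m + 1)] is bounded near [q]. *)
    - assert (E m q = 0%C) as HE0.
      { apply Cmod_eq_0, Rle_antisym; [|apply Cmod_ge_0]; apply le_epsilon; intros eps Heps;
          rewrite Rplus_0_l.
        set (K := 8 * r * (M / (r ^ S m * (r / 2)))).
        assert (0 < K) as HK.
        { unfold K; apply Rmult_lt_0_compat; [lra|]; apply Rdiv_lt_0_compat; [lra|].
          apply Rmult_lt_0_compat; [apply pow_lt|]; lra. }
        destruct (Hz (Rmin (r / 2) (eps / K))) as [p' [Hp1 [Hp2 Hp3]]].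
        { apply Rmin_pos; [lra|apply Rdiv_lt_0_compat; lra]. }
        assert (Cmod (p' - q) < r / 2) as Hp4 by (eapply Rlt_le_trans; [exact Hp2|apply Rmin_l]).
        assert (Cmod (p' - q) < eps / K) as Hp5 by (eapply Rlt_le_trans; [exact Hp2|apply Rmin_r]).
        pose proof (IH p' Hp4) as E1; rewrite Hp3, Cmult_0_l in E1.
        pose proof (Cpown_neq0 _ m (Csub_neq0 _ _ Hp1)) as Hn.
        assert (E m p' = 0%C) as E2.
        { apply NNPP; intros H; symmetry in E1; revert E1; apply Cmult_neq_0; assumption. }
        rewrite (HEr m p' Hp4) in E2.
        replace (E m q) with (- ((p' - q) * E (S m) p'))%C.
        2: { replace (E m q) with ((E m q + (p' - q) * E (S m) p') - (p' - q) * E (S m) p')%C by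
          ring.
             rewrite E2; ring. }
        rewrite Cmod_opp, Cmod_mult; apply Rle_trans with (eps / K * K); [|right; field; lra].
        apply Rmult_le_compat; try apply Cmod_ge_0; [lra|exact (HEb (S m) p' Hp4)]. }
      rewrite (IH p Hp), (HEr m p Hp), HE0; simpl; ring. }
  exists (r / 2); split; [lra|]; intros p Hp.
  pose proof (winding_neq0 a b c d p (proj1 (Hins p Hp)) (proj2 (Hins p Hp))) as HW;
    fold (W p) in HW.
  apply NNPP; intros Hfp; apply (Cmult_neq_0 _ _ Hfp HW).
  apply Cmod_eq_0, Rle_antisym; [|apply Cmod_ge_0]; apply le_epsilon; intros eps Heps;
    rewrite Rplus_0_l.
  (* The factor [(p - q)^n] gains [2^(-n)] against the [r^n] in the bound for [E n p]; what remains
     is [8 r M / (r / 2) = 16 M]. *)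
  destruct (pow_lt_1_zero (/ 2)) with (y := eps / (16 * M)) as [n Hn];
    [rewrite Rabs_pos_eq; lra|apply Rdiv_lt_0_compat; lra|].
  specialize (Hn n (Nat.le_refl n)); rewrite Rabs_pos_eq in Hn by (apply pow_le; lra).
  rewrite (Hm n p Hp), Cmod_mult, Cmod_Cpown.
  apply Rle_trans with ((r * / 2) ^ n * (8 * r * (M / (r ^ n * (r / 2))))).
  - apply Rmult_le_compat; [apply pow_le, Cmod_ge_0|apply Cmod_ge_0| |apply HEb, Hp].
    apply pow_incr; split; [apply Cmod_ge_0|unfold Rdiv in Hp; lra].
  - rewrite Rpow_mult_distr.
    replace (r ^ n * (/ 2) ^ n * (8 * r * (M / (r ^ n * (r / 2))))) with ((/ 2) ^ n * (16 * M)).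
    2: { field; split; [lra|apply pow_nonzero; lra]. }
    apply Rle_trans with (eps / (16 * M) * (16 * M)); [|right; field; lra].
    apply Rmult_le_compat_r; lra.
Qed.

(** * The identity theorem off a closed discrete set *)

Definition vanishes_near (f : C -> C) (z : C) : Prop :=
  exists e, 0 < e /\ forall u, Cmod (u - z) < e -> f u = 0%C.

Definition holo_near (f : C -> C) (z : C) : Prop :=
  exists e, 0 < e /\ forall u, Cmod (u - z) < e -> Cdiff f u.

(** Let [tau] be the supremum of the times up to which [f] vanishes locally along the segment. Zeros
    accumulate at time [tau], so [f] vanishes near that point too, which pushes the supremum further
    unless [tau = 1]. Since [v] is nonzero, these zeros differ from the point they approach. *)
Lemma vanishes_segment (f : C -> C) (p v : C) : v <> 0%C ->
  (forall t, 0 <= t <= 1 -> holo_near f (p + RtoC t * v)%C) ->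
  vanishes_near f p -> vanishes_near f (p + v)%C.
Proof.
  intros Hv Hh H0.
  pose proof (proj1 (Cmod_gt_0 v) Hv) as Hv0.
  set (g := fun t => (p + RtoC t * v)%C).
  assert (forall s t, Cmod (g s - g t) = Rabs (s - t) * Cmod v) as Hg.
  { intros s t; unfold g; replace (p + RtoC s * v - (p + RtoC t * v))%C with (RtoC (s - t) * v)%C
      by (rewrite RtoC_minus; ring).
    rewrite Cmod_mult, Cmod_R; reflexivity. }
  set (S := fun t => 0 <= t <= 1 /\ forall s, 0 <= s <= t -> vanishes_near f (g s)).
  assert (g 0 = p) as G0 by (unfold g; ring).
  assert (S 0) as S0.
  { split; [lra|]; intros s Hs; replace s with 0 by lra; rewrite G0; exact H0. }
  destruct (completeness S) as [tau [U L]].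
  { exists 1; intros t [Ht _]; lra. }
  { exists 0; exact S0. }
  assert (0 <= tau) as T0 by (apply U, S0).
  assert (tau <= 1) as T1 by (apply L; intros t [Ht _]; lra).
  assert (forall s, 0 <= s < tau -> vanishes_near f (g s)) as Hbelow.
  { intros s Hs; apply NNPP; intros Hn.
    assert (tau <= s); [|lra].
    apply L; intros t [Ht1 Ht2]; apply Rnot_lt_le; intros Hst; apply Hn, Ht2; lra. }
  assert (vanishes_near f (g tau)) as Htau.
  { destruct (Rle_lt_or_eq_dec 0 tau T0) as [Hpos|E]; [|rewrite <- E, G0; exact H0].
    destruct (Hh tau (conj T0 T1)) as [rho [Hrho Hd]].
    apply (vanishing_of_zeros_tending f (g tau) rho Hrho Hd).
    intros e He; set (s := tau - Rmin tau (e / Cmod v) / 2).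
    assert (0 < Rmin tau (e / Cmod v)) as Hm by (apply Rmin_pos;
      [exact Hpos|apply Rdiv_lt_0_compat; lra]).
    pose proof (Rmin_l tau (e / Cmod v)); pose proof (Rmin_r tau (e / Cmod v)).
    assert (Rabs (s - tau) = Rmin tau (e / Cmod v) / 2) as Habs.
    { unfold s; rewrite Rabs_left; lra. }
    exists (g s); split; [|split].
    - intros E; assert (Cmod (g s - g tau) = 0) as E0.
      { rewrite E; replace (g tau - g tau)%C with (RtoC 0) by ring; apply Cmod_0. }
      rewrite Hg, Habs in E0; nra.
    - rewrite Hg, Habs; apply Rlt_le_trans with (e / Cmod v * Cmod v); [|right; field; lra].
      apply Rmult_lt_compat_r; lra.
    - destruct (Hbelow s) as [e' [He' Hz]]; [unfold s; lra|].
      apply Hz; replace (g s - g s)%C with (RtoC 0) by ring; rewrite Cmod_0; exact He'. }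
  destruct (Rle_lt_or_eq_dec tau 1 T1) as [Hlt|E].
  2: { rewrite E in Htau; unfold g in Htau; rewrite Cmult_1_l in Htau; exact Htau. }
  exfalso; destruct Htau as [e [He Hz]].
  set (t := tau + Rmin (1 - tau) (e / 2 / Cmod v)).
  assert (0 < e / 2 / Cmod v) as He2 by (repeat apply Rdiv_lt_0_compat; lra).
  assert (0 < Rmin (1 - tau) (e / 2 / Cmod v)) as Hm by (apply Rmin_pos; lra).
  pose proof (Rmin_l (1 - tau) (e / 2 / Cmod v)); pose proof (Rmin_r (1 - tau) (e / 2 / Cmod v)).
  assert (S t) as St; [|specialize (U t St); unfold t in U; lra].
  split; [unfold t; lra|]; intros s Hs.
  destruct (Rlt_le_dec s tau) as [Hl|Hl]; [apply Hbelow; lra|].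
  exists (e / 2); split; [lra|]; intros u Hu; apply Hz.
  replace (u - g tau)%C with ((u - g s) + (g s - g tau))%C by ring.
  eapply Rle_lt_trans; [apply Cmod_triangle|]; rewrite Hg.
  assert (Rabs (s - tau) * Cmod v <= e / 2 / Cmod v * Cmod v) as Hb.
  { apply Rmult_le_compat_r; [lra|]; rewrite Rabs_pos_eq by lra; unfold t in Hs; lra. }
  replace (e / 2 / Cmod v * Cmod v) with (e / 2) in Hb by (field; lra).
  lra.
Qed.

Lemma avoid_list (l : list R) : forall a b, a < b -> exists x, a < x < b /\ ~ In x l.
Proof.
  induction l as [|y l IH]; intros a b Hab.
  - exists ((a + b) / 2); split; [lra|intros []].
  - destruct (Rle_lt_dec y ((a + b) / 2)) as [H|H].
    + destruct (IH ((a + b) / 2) b) as [x [Hx Hn]]; [lra|].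
      exists x; split; [lra|]; intros [E|E]; [lra|tauto].
    + destruct (IH a ((a + b) / 2)) as [x [Hx Hn]]; [lra|].
      exists x; split; [lra|]; intros [E|E]; [lra|tauto].
Qed.

(** Each point has a ball containing no point of [Q] except possibly the centre; finitely many such
    balls cover the box, so their centres include every point of [Q] in it. The list may contain
    other points, as only finiteness matters. Radii are halved because the covering controls each
    coordinate separately. *)
Lemma closed_discrete_box (Q : C -> Prop) (M : R) : closed_discrete Q ->
  exists l : list C, forall u, Q u -> Rabs (fst u) <= M -> Rabs (snd u) <= M -> In u l.
Proof.
  intros HQ.
  destruct (ClassicalEpsilon.choice (fun z r => 0 < r /\ forall u : C,
    Q u -> Cmod (u - z) < r -> u = z) HQ)
    as [r Hr].
  assert (forall z, 0 < r z / 2) as Hr2 by (intros z; destruct (Hr z); lra).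
  pose proof (compactness_list 2 (- M, (- M, tt)) (M, (M, tt))
    (fun t => mkposreal _ (Hr2 (fst t, fst (snd t))))) as H.
  apply NNPP in H; destruct H as [l Hl].
  exists (map (fun t => (fst t, fst (snd t)) : C) l); intros u Hu H1 H2.
  destruct (Hl (fst u, (snd u, tt))) as [[t1 [t2 []]] [Ht [_ Hc]]].
  { simpl; apply Rabs_le_between in H1; apply Rabs_le_between in H2; tauto. }
  apply in_map_iff; exists (t1, (t2, tt)); split; [|exact Ht]; simpl.
  simpl in Hc; destruct Hc as [Hc1 [Hc2 _]].
  symmetry; apply (Hr (t1, t2)); [exact Hu|].
  eapply Rle_lt_trans; [apply Cmod_le_sum|]; simpl; unfold Rminus in *; lra.
Qed.

Lemma closed_discrete_complement_open (Q : C -> Prop) z : closed_discrete Q -> ~ Q z ->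
  exists e, 0 < e /\ forall u, Cmod (u - z) < e -> ~ Q u.
Proof.
  intros HQ Hz; destruct (HQ z) as [r [Hr H]]; exists r; split; [exact Hr|].
  intros u Hu HQu; apply Hz; rewrite <- (H u HQu Hu); exact HQu.
Qed.

(** The path runs horizontally from [(0, y1)] to [(x1, y1)] and then vertically to the height of
    [z]; [y1] and [x1] avoid the finitely many coordinates of points of [Q] in a large box. As the
    vertical line through [z] may meet [Q], [x1] is only close to [fst z], and continuity at [z]
    finishes. *)
Theorem identity_off_discrete (f : C -> C) (Q : C -> Prop) (t0 t1 : R) :
  t0 < t1 -> closed_discrete Q -> (forall z, ~ Q z -> Cdiff f z) ->
  (forall t, t0 < t < t1 -> f (0, t) = 0%C) ->
  forall z, ~ Q z -> f z = 0%C.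
Proof.
  intros Ht HQ Hf H0 z Hz.
  assert (forall u, ~ Q u -> holo_near f u) as Hh.
  { intros u Hu; destruct (closed_discrete_complement_open Q u HQ Hu) as [e [He H]].
    exists e; split; [exact He|]; intros w Hw; apply Hf, H, Hw. }
  destruct (closed_discrete_complement_open Q z HQ Hz) as [rho [Hrho Hopen]].
  set (M := Rabs (fst z) + Rabs (snd z) + Rabs t0 + Rabs t1 + 1).
  pose proof (Rabs_pos (fst z)); pose proof (Rabs_pos (snd z)); pose proof (Rabs_pos t0);
    pose proof (Rabs_pos t1).
  destruct (closed_discrete_box Q M HQ) as [l Hl].
  (* The extra entry [snd z], like [0] in the choice of [x1], keeps both segments nondegenerate. *)
  destruct (avoid_list (snd z :: map snd l) t0 t1 Ht) as [y1 [Hy1 Ny1]].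
  assert (Rabs y1 <= M) as My1.
  { unfold M; apply Rabs_le; generalize (Rle_abs t1); generalize (Rle_abs (- t0));
      rewrite Rabs_Ropp; lra. }
  apply Cmod_eq_0, Rle_antisym; [|apply Cmod_ge_0]; apply le_epsilon; intros eps Heps;
    rewrite Rplus_0_l.
  destruct (Cdiff_cont f z (Hf z Hz) eps Heps) as [d [Hd Hc]].
  set (e := Rmin (Rmin rho 1) d).
  assert (0 < e) as He by (unfold e; repeat apply Rmin_pos; lra).
  assert (e <= 1 /\ e <= d) as [He1 Hed].
  { unfold e; pose proof (Rmin_l (Rmin rho 1) d); pose proof (Rmin_r (Rmin rho 1) d);
    pose proof (Rmin_r rho 1); lra. }
  destruct (avoid_list (0 :: map fst l) (fst z) (fst z + e)) as [x1 [Hx1 Nx1]]; [lra|].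
  assert (Rabs x1 <= M) as Mx1.
  { unfold M; apply Rabs_le; generalize (Rle_abs (fst z)); generalize (Rle_abs (- fst z));
      rewrite Rabs_Ropp; lra. }
  assert (forall x, Rabs x <= M -> ~ Q (x, y1)) as Hhor.
  { intros x Mx HQx; apply Ny1; right; apply (in_map snd l (x, y1)), Hl; assumption. }
  assert (forall y, Rabs y <= M -> ~ Q (x1, y)) as Hver.
  { intros y My HQx; apply Nx1; right; apply (in_map fst l (x1, y)), Hl; assumption. }
  assert (forall s A B,
    0 <= s <= 1 -> Rabs A <= M -> Rabs B <= M -> Rabs (A + s * (B - A)) <= M) as Hconv.
  { intros s A B Hs HA HB; apply Rabs_le_between in HA; apply Rabs_le_between in HB; apply Rabs_le;
      nra. }
  assert (Rabs 0 <= M) as M0 by (rewrite Rabs_R0; unfold M; lra).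
  assert (Rabs (snd z) <= M) as Mz by (unfold M; lra).
  assert (vanishes_near f (0, y1)) as V0.
  { destruct (Hh (0, y1) (Hhor 0 M0)) as [r [Hr Hd']].
    apply (vanishing_of_zeros_tending f (0, y1) r Hr Hd'); intros e' He'.
    set (s := Rmin ((t1 - y1) / 2) (e' / 2)).
    assert (0 < s) by (unfold s; apply Rmin_pos; lra).
    pose proof (Rmin_l ((t1 - y1) / 2) (e' / 2)) as S1;
      pose proof (Rmin_r ((t1 - y1) / 2) (e' / 2)) as S2;
    fold s in S1, S2.
    exists (0, y1 + s); split; [intros E; injection E; lra|split].
    - eapply Rle_lt_trans; [apply Cmod_le_sum|]; simpl.
      replace (0 + - 0) with 0 by ring; replace (y1 + s + - y1) with s by ring.
      rewrite Rabs_R0, (Rabs_pos_eq s); lra.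
    - apply H0; lra. }
  assert (vanishes_near f (x1, y1)) as V1.
  { replace (x1, y1) with ((0, y1) + (x1, 0))%C.
    2: { unfold Cplus; simpl; f_equal; ring. }
    apply vanishes_segment; [|intros s Hs|exact V0].
    - intros E; injection E; intros E'; apply Nx1; left; symmetry; exact E'.
    - replace ((0, y1) + RtoC s * (x1, 0))%C with ((0 + s * (x1 - 0), y1) : C).
      2: { unfold Cplus, Cmult, RtoC; simpl; f_equal; ring. }
      apply Hh, Hhor, Hconv; assumption. }
  assert (vanishes_near f (x1, snd z)) as V2.
  { replace (x1, snd z) with ((x1, y1) + (0, snd z - y1)%R)%C.
    2: { unfold Cplus; simpl; f_equal; ring. }
    apply vanishes_segment; [|intros s Hs|exact V1].
    - intros E; injection E; intros E'; apply Ny1; left; lra.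
    - replace ((x1, y1) + RtoC s * (0, snd z - y1)%R)%C with ((x1, y1 + s * (snd z - y1)) : C).
      2: { unfold Cplus, Cmult, RtoC; simpl; f_equal; ring. }
      apply Hh, Hver, Hconv; assumption. }
  destruct V2 as [e' [He' Hz']].
  assert (f (x1, snd z) = 0%C) as E1.
  { apply Hz'; replace ((x1, snd z) - (x1, snd z))%C with (RtoC 0) by ring; rewrite Cmod_0;
      exact He'. }
  apply Rlt_le; replace (Cmod (f z)) with (Cmod (f (x1, snd z) - f z)).
  2: { rewrite E1; rewrite <- (Cmod_opp (f z)); f_equal; ring. }
  apply Hc; eapply Rle_lt_trans; [apply Cmod_le_sum|]; simpl.
  replace (snd z + - snd z) with 0 by ring; rewrite Rabs_R0, Rabs_pos_eq; lra.
Qed.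

(** * Differentiability of the complex exponential *)

Lemma Cexp_plus u v : Cexp (u + v) = (Cexp u * Cexp v)%C.
Proof.
  destruct u as [a b], v as [c d]; unfold Cexp, Cplus, Cmult; simpl.
  rewrite exp_plus, cos_plus, sin_plus; f_equal; ring.
Qed.

Lemma Cexp_diff z : Cdiff Cexp z.
Proof.
  assert (forall g l, derivable_pt_lim g 0 l -> forall e, 0 < e ->
    exists d, 0 < d /\ forall x, Rabs x < d -> Rabs (g x - g 0 - l * x) <= e * Rabs x) as Hlim.
  { intros g l Hg e He; destruct (Hg e He) as [[d Hd] H]; exists d; split; [exact Hd|]; intros x Hx.
    destruct (Req_dec x 0) as [->|Hx0].
    - rewrite Rmult_0_r, Rabs_R0; replace (g 0 - g 0 - 0) with 0 by ring; rewrite Rabs_R0; lra.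
    - specialize (H x Hx0 Hx); rewrite Rplus_0_l in H.
      replace (g x - g 0 - l * x) with (((g x - g 0) / x - l) * x) by (field; exact Hx0).
      rewrite Rabs_mult; apply Rmult_le_compat_r; [apply Rabs_pos|lra]. }
  assert (forall eps, 0 < eps -> exists d, 0 < d /\ forall w, Cmod w < d ->
    Cmod (Cexp w - 1 - w) <= eps * Cmod w) as H0.
  (* The real and imaginary errors add up to at most [e m + 3 e m + 3 e m + 2 e m] with
     [m = Cmod w]; the bound [e <= 1] makes [exp x] at most 3. *)
  { intros eps Heps; set (e := Rmin 1 (eps / 10)).
    assert (0 < e) as He by (unfold e; apply Rmin_pos; lra).
    assert (e <= 1 /\ e <= eps / 10) as [He1 He2].
    { unfold e; pose proof (Rmin_l 1 (eps / 10)); pose proof (Rmin_r 1 (eps / 10)); lra. }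
    destruct (Hlim exp 1) with (e := e) as [d1 [Hd1 E1]]; [apply derivable_pt_lim_exp_0|exact He|].
    destruct (Hlim cos 0) with (e := e) as [d2 [Hd2 E2]];
      [pose proof (derivable_pt_lim_cos 0) as X; rewrite sin_0, Ropp_0 in X; exact X|exact He|].
    destruct (Hlim sin 1) with (e := e) as [d3 [Hd3 E3]];
      [pose proof (derivable_pt_lim_sin 0) as X; rewrite cos_0 in X; exact X|exact He|].
    set (d := Rmin (Rmin d1 d2) (Rmin d3 e)).
    assert (0 < d) as Hd by (unfold d; repeat apply Rmin_pos; lra).
    assert (d <= d1 /\ d <= d2 /\ d <= d3 /\ d <= e) as Hds.
    { unfold d; pose proof (Rmin_l (Rmin d1 d2) (Rmin d3 e));
        pose proof (Rmin_r (Rmin d1 d2) (Rmin d3 e)).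
      pose proof (Rmin_l d1 d2); pose proof (Rmin_r d1 d2); pose proof (Rmin_l d3 e);
        pose proof (Rmin_r d3 e); lra. }
    exists d; split; [exact Hd|]; intros [x y] Hw.
    pose proof (Cmod_re (x, y)) as Hx; pose proof (Cmod_im (x, y)) as Hy; simpl in Hx, Hy.
    set (m := Cmod (x, y)) in *.
    specialize (E1 x ltac:(lra)); specialize (E2 y ltac:(lra)); specialize (E3 y ltac:(lra)).
    rewrite exp_0 in E1; rewrite cos_0 in E2; rewrite sin_0 in E3.
    pose proof (Rabs_pos x) as Px; pose proof (Rabs_pos y) as Py.
    assert (Rabs (exp x - 1) <= 2 * m) as Ex.
    { replace (exp x - 1) with ((exp x - 1 - 1 * x) + x) by ring.
      eapply Rle_trans; [apply Rabs_triang|]; nra. }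
    assert (Rabs (exp x) <= 3) as Ex3.
    { replace (exp x) with ((exp x - 1) + 1) by ring.
      eapply Rle_trans; [apply Rabs_triang|]; rewrite Rabs_R1; lra. }
    eapply Rle_trans; [apply Cmod_le_sum|]; unfold Cexp; simpl.
    replace (exp x * cos y + - (1) + - x) with ((exp x - 1 - 1 * x) + exp x * (cos y - 1 - 0 * y))
      by ring.
    replace (exp x * sin y + - 0 + - y) with (exp x * (sin y - 0 - 1 * y) + (exp x - 1) * y) by
      ring.
    pose proof (Rabs_triang (exp x - 1 - 1 * x) (exp x * (cos y - 1 - 0 * y))) as T1.
    pose proof (Rabs_triang (exp x * (sin y - 0 - 1 * y)) ((exp x - 1) * y)) as T2.
    rewrite Rabs_mult in T1; rewrite !Rabs_mult in T2.
    assert (Rabs (exp x) * Rabs (cos y - 1 - 0 * y) <= 3 * (e * m)).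
    { apply Rmult_le_compat; try apply Rabs_pos; [exact Ex3|nra]. }
    assert (Rabs (exp x) * Rabs (sin y - 0 - 1 * y) <= 3 * (e * m)).
    { apply Rmult_le_compat; try apply Rabs_pos; [exact Ex3|nra]. }
    assert (Rabs (exp x - 1) * Rabs y <= 2 * m * e).
    { apply Rmult_le_compat; try apply Rabs_pos; [exact Ex|lra]. }
    assert (e * Rabs x <= e * m) by (apply Rmult_le_compat_l; lra).
    assert (0 <= m) by lra.
    assert (0 <= e * m) by nra.
    assert (10 * (e * m) <= eps * m) by nra; lra. }
  exists (Cexp z); intros eps Heps.
  pose proof (Cmod_ge_0 (Cexp z)) as Hz.
  destruct (H0 (eps / (Cmod (Cexp z) + 1))) as [d [Hd H]]; [apply Rdiv_lt_0_compat; lra|].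
  exists d; split; [exact Hd|]; intros u Hu; specialize (H (u - z)%C Hu).
  assert (Cexp u - Cexp z - (u - z) * Cexp z = Cexp z * (Cexp (u - z) - 1 - (u - z)))%C as E.
  { replace (Cexp u) with (Cexp (z + (u - z))) by (f_equal; ring); rewrite Cexp_plus; ring. }
  rewrite E, Cmod_mult.
  apply Rle_trans with ((Cmod (Cexp z) + 1) * (eps / (Cmod (Cexp z) + 1) * Cmod (u - z))).
  - apply Rmult_le_compat; [exact Hz|apply Cmod_ge_0|lra|exact H].
  - right; field; lra.
Qed.

(** * Improper integrals over the positive half-line *)

(** Improper at 0 as well, because the integrands of interest divide by their variable. *)
Definition is_RInt_0_oo (f : R -> R) (l : R) : Prop :=
  @is_RInt_gen R_NormedModule f (at_right 0) (Rbar_locally p_infty) l.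

Lemma is_RInt_0_oo_eps (f : R -> R) (l : R) :
  is_RInt_0_oo f l <-> forall eps, 0 < eps -> exists d M, 0 < d /\
    forall a b, 0 < a < d -> M < b -> exists y, is_RInt f a b y /\ Rabs (y - l) < eps.
Proof.
  split.
  - intros H eps Heps.
    destruct (H (fun y => Rabs (y - l) < eps)) as [P Q [d Hd] [M HM] HPQ].
    { exists (mkposreal eps Heps); intros y Hy; exact Hy. }
    exists d, M; split; [apply cond_pos|]; intros a b Ha Hb.
    apply (HPQ a b); [|apply HM, Hb].
    apply Hd; [|apply Ha]; unfold ball; simpl; unfold AbsRing_ball, abs, minus, plus, opp; simpl.
    rewrite Rabs_pos_eq; lra.
  - intros H P [eps HP]; destruct (H eps (cond_pos eps)) as [d [M [Hd HM]]].
    apply (Filter_prod _ _ _ (fun a => 0 < a < d) (fun b => M < b)).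
    + exists (mkposreal d Hd); intros y Hy H0; split; [exact H0|].
      unfold ball in Hy; simpl in Hy; unfold AbsRing_ball, abs, minus, plus, opp in Hy; simpl in Hy.
      rewrite Rabs_pos_eq in Hy; lra.
    + exists M; intros y Hy; exact Hy.
    + intros a b Ha Hb; destruct (HM a b Ha Hb) as [y [Hy1 Hy2]].
      exists y; split; [exact Hy1|]; apply HP; exact Hy2.
Qed.

Lemma is_RInt_0_oo_unique f l l' : is_RInt_0_oo f l -> is_RInt_0_oo f l' -> l = l'.
Proof.
  intros H H'; rewrite <- (is_RInt_gen_unique (V := R_CompleteNormedModule) _ _ H).
  apply (is_RInt_gen_unique (V := R_CompleteNormedModule)); exact H'.
Qed.

Lemma is_RInt_0_oo_ext f g l : (forall x, 0 < x -> f x = g x) -> is_RInt_0_oo f l -> is_RInt_0_oo g l.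
Proof.
  intros E; rewrite !is_RInt_0_oo_eps; intros H eps Heps; destruct (H eps Heps) as [d [M [Hd HM]]].
  exists d, (Rmax M 0); split; [exact Hd|]; intros a b Ha Hb.
  assert (M < b /\ 0 < b) as [Hb1 Hb2].
  { pose proof (Rmax_l M 0); pose proof (Rmax_r M 0); lra. }
  destruct (HM a b Ha Hb1) as [y [Hy1 Hy2]]; exists y; split; [|exact Hy2].
  apply (is_RInt_ext f); [|exact Hy1]; intros x Hx; apply E.
  assert (0 < Rmin a b) by (apply Rmin_pos; lra); lra.
Qed.

Lemma is_RInt_0_oo_plus f g l m : is_RInt_0_oo f l -> is_RInt_0_oo g m -> is_RInt_0_oo (fun x => f x + g x) (l + m).
Proof. intros H1 H2; exact (is_RInt_gen_plus _ _ _ _ H1 H2). Qed.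

Lemma is_RInt_0_oo_scal k f l : is_RInt_0_oo f l -> is_RInt_0_oo (fun x => k * f x) (k * l).
Proof. intros H; exact (is_RInt_gen_scal _ k _ H). Qed.

Lemma is_RInt_0_oo_dilate f l k : 0 < k -> is_RInt_0_oo f l -> is_RInt_0_oo (fun x => k * f (k * x)) l.
Proof.
  intros Hk; rewrite !is_RInt_0_oo_eps; intros H eps Heps; destruct (H eps Heps) as [d [M [Hd HM]]].
  exists (d / k), (M / k); split; [apply Rdiv_lt_0_compat; lra|]; intros a b Ha Hb.
  destruct (HM (k * a) (k * b)) as [y [Hy1 Hy2]].
  - split; [nra|]; replace d with (k * (d / k)) by (field; lra); apply Rmult_lt_compat_l; lra.
  - replace M with (k * (M / k)) by (field; lra); apply Rmult_lt_compat_l; lra.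
  - exists y; split; [|exact Hy2].
    apply (is_RInt_ext (fun x => scal k (f (k * x + 0)))).
    + intros x _; rewrite Rplus_0_r; reflexivity.
    + apply (is_RInt_comp_lin (V := R_NormedModule) f k 0 a b y); rewrite !Rplus_0_r; exact Hy1.
Qed.

Lemma is_RInt_0_oo_norm f g l m : (forall x, 0 < x -> Rabs (f x) <= g x) ->
  is_RInt_0_oo f l -> is_RInt_0_oo g m -> Rabs l <= m.
Proof.
  intros Hfg; rewrite !is_RInt_0_oo_eps; intros Hf Hg; apply le_epsilon; intros eps Heps.
  destruct (Hf (eps / 2)) as [d1 [M1 [Hd1 H1]]]; [lra|].
  destruct (Hg (eps / 2)) as [d2 [M2 [Hd2 H2]]]; [lra|].
  set (a := Rmin d1 d2 / 2); set (b := Rmax (Rmax M1 M2) a + 1).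
  assert (0 < Rmin d1 d2) by (apply Rmin_pos; assumption).
  pose proof (Rmin_l d1 d2); pose proof (Rmin_r d1 d2).
  pose proof (Rmax_l (Rmax M1 M2) a); pose proof (Rmax_r (Rmax M1 M2) a).
  pose proof (Rmax_l M1 M2); pose proof (Rmax_r M1 M2).
  destruct (H1 a b) as [y1 [I1 E1]]; [unfold a; lra|unfold b; lra|].
  destruct (H2 a b) as [y2 [I2 E2]]; [unfold a; lra|unfold b; lra|].
  assert (Rabs y1 <= y2) as Hy.
  { apply (norm_RInt_le (V := R_NormedModule) f g a b); [unfold b; lra| |exact I1|exact I2].
    intros x Hx; apply Hfg; unfold a in Hx; lra. }
  pose proof (Rabs_triang (l - y1) y1) as T; replace (l - y1 + y1) with l in T by ring.
  rewrite Rabs_minus_sym in T; apply Rabs_def2 in E2; lra.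
Qed.

Lemma is_RInt_inv_sqr K a b : 0 < a <= b -> is_RInt (fun x => K / x ^ 2) a b (K * (/ a - / b)).
Proof.
  intros Hab; replace (K * (/ a - / b)) with (minus (- K / b) (- K / a))
    by (unfold minus, plus, opp; simpl; field; lra).
  apply (is_RInt_derive (fun x => - K / x)).
  - intros x Hx; rewrite Rmin_left, Rmax_right in Hx by lra; auto_derive; [lra|field; lra].
  - intros x Hx; rewrite Rmin_left, Rmax_right in Hx by lra.
    apply (ex_derive_continuous (K := R_AbsRing) (V := R_NormedModule)); auto_derive;
      apply Rmult_integral_contrapositive_currified; lra.
Qed.

Lemma is_RInt_0_oo_exists (f : R -> R) (K : R) :
  (forall x, 0 < x -> continuous f x) ->
  (forall x, 0 < x <= 1 -> Rabs (f x) <= K) ->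
  (forall x, 1 <= x -> Rabs (f x) <= K / x ^ 2) ->
  exists l, is_RInt_0_oo f l.
Proof.
  intros Hc H0 H1.
  assert (0 <= K) as HK.
  { specialize (H0 1 ltac:(lra)); pose proof (Rabs_pos (f 1)); lra. }
  assert (forall a b, 0 < a -> 0 < b -> ex_RInt f a b) as Hex.
  { intros a b Ha Hb; apply (ex_RInt_continuous (V := R_CompleteNormedModule)); intros z Hz;
      apply Hc.
    assert (0 < Rmin a b) by (apply Rmin_pos; assumption); lra. }
  assert (forall a b, 0 < a <= b -> b <= 1 -> Rabs (RInt f a b) <= (b - a) * K) as Hsm.
  { intros a b Ha Hb; apply (norm_RInt_le_const (V := R_NormedModule) f a b); [lra| |].
    - intros x Hx; apply H0; lra.
    - apply (RInt_correct (V := R_CompleteNormedModule)), Hex; lra. }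
  assert (forall a b, 1 <= a <= b -> Rabs (RInt f a b) <= K / a) as Hlg.
  { intros a b Hab; apply Rle_trans with (K * (/ a - / b)).
    - apply (norm_RInt_le (V := R_NormedModule) f (fun x => K / x ^ 2) a b);
        [lra| | |apply is_RInt_inv_sqr; lra].
      + intros x Hx; apply H1; lra.
      + apply (RInt_correct (V := R_CompleteNormedModule)), Hex; lra.
    - unfold Rdiv; apply Rmult_le_compat_l; [exact HK|].
      assert (0 < / b) by (apply Rinv_0_lt_compat; lra); lra. }
  assert (forall a b c, 0 < a -> 0 < b -> 0 < c -> RInt f a b + RInt f b c = RInt f a c) as Hch.
  { intros a b c Ha Hb Hc'; apply (RInt_Chasles (V := R_CompleteNormedModule)); apply Hex;
      assumption. }
  assert (ProperFilter (filter_prod (at_right 0) (Rbar_locally p_infty))) as PF by apply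
    filter_prod_proper.
  destruct (proj1 (filterlim_locally_cauchy (U := R_CompleteNormedModule)
    (F := filter_prod (at_right 0) (Rbar_locally p_infty)) (fun ab => RInt f (fst ab) (snd ab))))
      as [l Hl].
  { intros eps; pose proof (cond_pos eps) as Heps.
    (* Cutoffs for the Cauchy criterion: any piece below [d] or beyond [M] has integral at most
       [eps / 4]. *)
    set (d := Rmin 1 (eps / (4 * (K + 1)))); set (M := 4 * (K + 1) / eps + 1).
    assert (0 < d) as Hd by (unfold d; apply Rmin_pos; [lra|apply Rdiv_lt_0_compat; lra]).
    assert (d <= 1 /\ d <= eps / (4 * (K + 1))) as [Hd1 Hd2] by (split;
      [apply Rmin_l|apply Rmin_r]).
    assert (0 < 4 * (K + 1) / eps) as HM by (apply Rdiv_lt_0_compat; lra).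
    assert (d * (K + 1) <= eps / 4) as Hdk.
    { apply Rle_trans with (eps / (4 * (K + 1)) * (K + 1)); [|right; field; lra].
      apply Rmult_le_compat_r; lra. }
    exists (fun ab => 0 < fst ab < d /\ M < snd ab); split.
    - apply (Filter_prod _ _ _ (fun a => 0 < a < d) (fun b => M < b)).
      + exists (mkposreal d Hd); intros y Hy Hpos; split; [exact Hpos|].
        unfold ball in Hy; simpl in Hy; unfold AbsRing_ball, abs, minus, plus, opp in Hy;
          simpl in Hy.
        rewrite Rabs_pos_eq in Hy; lra.
      + exists M; intros y Hy; exact Hy.
      + intros a b Ha Hb; split; assumption.
    - assert (forall a a', 0 < a < d -> 0 < a' < d -> Rabs (RInt f a a') <= eps / 4) as Ba.
      { assert (forall a a',
          0 < a < d -> 0 < a' < d -> a <= a' -> Rabs (RInt f a a') <= eps / 4) as B0.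
        { intros a a' Ha Ha' L; eapply Rle_trans; [apply Hsm; lra|]; nra. }
        intros a a' Ha Ha'; destruct (Rle_lt_dec a a') as [L|L]; [apply B0; assumption|].
        rewrite <- (opp_RInt_swap (V := R_CompleteNormedModule)); [|apply Hex; lra].
        unfold opp; simpl; rewrite Rabs_Ropp; apply B0; lra. }
      assert (forall b b', M < b -> M < b' -> Rabs (RInt f b b') <= eps / 4) as Bb.
      { assert (forall b b', M < b -> M < b' -> b <= b' -> Rabs (RInt f b b') <= eps / 4) as B0.
        { intros b b' Hb Hb' L; unfold M in *; eapply Rle_trans; [apply Hlg; lra|].
          apply Rle_div_l; [lra|].
          apply Rle_trans with (eps / 4 * (4 * (K + 1) / eps)); [|apply Rmult_le_compat_l; lra].
          replace (eps / 4 * (4 * (K + 1) / eps)) with (K + 1) by (field; lra); lra. }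
        intros b b' Hb Hb'; destruct (Rle_lt_dec b b') as [L|L]; [apply B0; assumption|].
        rewrite <- (opp_RInt_swap (V := R_CompleteNormedModule)); [|apply Hex; unfold M in *; lra].
        unfold opp; simpl; rewrite Rabs_Ropp; apply B0; lra. }
      intros [a b] [a' b']; simpl; intros [Ha Hb] [Ha' Hb'].
      unfold ball; simpl; unfold AbsRing_ball, abs, minus, plus, opp; simpl.
      assert (0 < b) by (unfold M in *; lra); assert (0 < b') by (unfold M in *; lra).
      assert (@RInt R_CompleteNormedModule f a' b' + - @RInt R_CompleteNormedModule f a b
        = @RInt R_CompleteNormedModule f a' a + @RInt R_CompleteNormedModule f b b' :> R) as ->.
      { pose proof (Hch a' a b' ltac:(lra) ltac:(lra) ltac:(lra)) as C1.
        pose proof (Hch a b b' ltac:(lra) ltac:(lra) ltac:(lra)) as C2; lra. }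
      eapply Rle_lt_trans; [apply Rabs_triang|].
      specialize (Ba a' a Ha' Ha); specialize (Bb b b' Hb Hb'); lra. }
  exists l; apply is_RInt_0_oo_eps; intros eps Heps.
  destruct (Hl (fun y => Rabs (y - l) < eps)) as [P Q [d Hd] [M HM] HPQ].
  { exists (mkposreal eps Heps); intros y Hy; exact Hy. }
  exists d, (Rmax M 0); split; [apply cond_pos|]; intros a b Ha Hb.
  pose proof (Rmax_l M 0); pose proof (Rmax_r M 0).
  exists (RInt f a b); split.
  - apply (RInt_correct (V := R_CompleteNormedModule)), Hex; lra.
  - apply (HPQ a b); [|apply HM; lra].
    apply Hd; [|apply Ha]; unfold ball; simpl; unfold AbsRing_ball, abs, minus, plus, opp; simpl.
    rewrite Rabs_pos_eq; lra.
Qed.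

Lemma exp_neg_le_inv x : 0 < x -> exp (- x) <= / x.
Proof.
  intros Hx; rewrite exp_Ropp; apply Rinv_le_contravar; [exact Hx|].
  pose proof (exp_ineq1_le x); lra.
Qed.

Lemma exp_neg_le_inv_sqr x : 0 < x -> exp (- x) <= 4 / x ^ 2.
Proof.
  intros Hx; replace (- x) with (- (x / 2) + - (x / 2)) by field; rewrite exp_plus.
  replace (4 / x ^ 2) with (/ (x / 2) * / (x / 2)) by (field; lra).
  apply Rmult_le_compat; try (apply Rlt_le, exp_pos); apply exp_neg_le_inv; lra.
Qed.

Lemma is_RInt_0_oo_exp : is_RInt_0_oo (fun t => exp (- t)) 1.
Proof.
  apply is_RInt_0_oo_eps; intros eps Heps.
  exists (eps / 2), (2 / eps); split; [lra|]; intros a b Ha Hb.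
  assert (0 < 2 / eps) by (apply Rdiv_lt_0_compat; lra).
  exists (exp (- a) - exp (- b)); split.
  - replace (exp (- a) - exp (- b)) with (minus (- exp (- b)) (- exp (- a))) by (unfold minus,
      plus, opp; simpl; ring).
    apply (is_RInt_derive (fun x => - exp (- x))).
    + intros x _; auto_derive; [trivial|ring].
    + intros x _; apply (ex_derive_continuous (K := R_AbsRing) (V := R_NormedModule)); auto_derive;
        trivial.
  - assert (exp (- b) < eps / 2) as Hb'.
    { eapply Rle_lt_trans; [apply exp_neg_le_inv; lra|].
      replace (eps / 2) with (/ (2 / eps)) by (field; lra).
      apply Rinv_lt_contravar; [|exact Hb]; apply Rmult_lt_0_compat; lra. }
    pose proof (exp_pos (- b)); pose proof (exp_ineq1_le (- a)).
    assert (exp (- a) <= 1) by (rewrite <- exp_0; apply Rlt_le, exp_increasing; lra).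
    apply Rabs_def1; lra.
Qed.

(** With [G] an antiderivative of [exp (- s) / s], the integral over [[x, y]] is [(G (b x) - G (a
    x)) - (G (b y) - G (a y))]. Near 0 the function [G - ln] has bounded derivative, so the first
    bracket tends to [ln (b / a)]; the second tends to 0. [G] is based at 1 because [exp (- s) / s]
    is not integrable at 0. *)
Lemma frullani a b : 0 < a -> 0 < b ->
  is_RInt_0_oo (fun t => (exp (- (a * t)) - exp (- (b * t))) / t) (ln (b / a)).
Proof.
  intros Ha Hb; set (e := fun s => exp (- s) / s).
  assert (forall x, 0 < x -> continuous e x) as Hc.
  { intros x Hx; apply (ex_derive_continuous (K := R_AbsRing) (V := R_NormedModule)); unfold e;
      auto_derive; lra. }
  set (G := fun x : R => RInt e 1 x : R).
  assert (forall x y, 0 < x -> 0 < y -> ex_RInt e x y) as Hex.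
  { intros x y Hx Hy; apply (ex_RInt_continuous (V := R_CompleteNormedModule)); intros z Hz;
      apply Hc.
    assert (0 < Rmin x y) by (apply Rmin_pos; assumption); lra. }
  assert (forall x y, 0 < x -> 0 < y -> is_RInt e x y (G y - G x)) as HG.
  { intros x y Hx Hy; unfold G.
    replace (RInt e 1 y - RInt e 1 x) with (RInt e x y).
    - apply (RInt_correct (V := R_CompleteNormedModule)), Hex; assumption.
    - assert (@RInt R_CompleteNormedModule e 1 x + @RInt R_CompleteNormedModule e x y
        = @RInt R_CompleteNormedModule e 1 y :> R) as Ch; [|lra].
      apply (RInt_Chasles (V := R_CompleteNormedModule)); apply Hex; lra. }
  assert (forall x, 0 < x -> is_derive G x (e x)) as HdG.
  { intros x Hx; apply (is_derive_RInt (V := R_NormedModule) e G 1 x); [|apply Hc, Hx].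
    exists (mkposreal x Hx); intros y Hy; unfold G.
    apply (RInt_correct (V := R_CompleteNormedModule)), Hex; [lra|].
    unfold ball in Hy; simpl in Hy; unfold AbsRing_ball, abs, minus, plus, opp in Hy; simpl in Hy.
    apply Rabs_def2 in Hy; lra. }
  assert (forall x, 0 < x -> is_derive (fun s => G s - ln s) x (e x - / x)) as HdH.
  { intros x Hx; apply (is_derive_minus (V := R_NormedModule) G ln); [apply HdG,
      Hx|apply is_derive_ln, Hx]. }
  assert (forall c x y, 0 < c -> 0 < x -> 0 < y ->
    is_RInt (fun t => exp (- (c * t)) / t) x y (G (c * y) - G (c * x))) as Hsc.
  { intros c x y Hc' Hx Hy.
    apply (is_RInt_ext (fun t => scal c (e (c * t + 0)))).
    - intros t Ht; assert (0 < Rmin x y) by (apply Rmin_pos; assumption).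
      unfold scal; simpl; unfold mult, e; simpl; rewrite Rplus_0_r; field; lra.
    - apply (is_RInt_comp_lin (V := R_NormedModule) e c 0 x y); rewrite !Rplus_0_r; apply HG; nra. }
  set (m := Rmin a b); assert (0 < m) as Hm by (apply Rmin_pos; assumption).
  assert (m <= a /\ m <= b) as [Hma Hmb] by (split; [apply Rmin_l|apply Rmin_r]).
  set (k := Rabs (b - a)); assert (0 <= k) as Hk by apply Rabs_pos.
  assert (forall x, 0 < x -> Rabs (G (b * x) - G (a * x) - ln (b / a)) <= k * x) as Hsmall.
  { intros x Hx.
    destruct (MVT_gen (fun s => G s - ln s) (a * x) (b * x) (fun s => e s - / s)) as [c [Hc1 Hc2]].
    - intros s Hs; assert (0 < Rmin (a * x) (b * x)) by (apply Rmin_pos; apply Rmult_lt_0_compat;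
        assumption).
      apply HdH; lra.
    - intros s Hs; assert (0 < Rmin (a * x) (b * x)) by (apply Rmin_pos; apply Rmult_lt_0_compat;
        assumption).
      apply continuity_pt_filterlim,
        (ex_derive_continuous (K := R_AbsRing) (V := R_NormedModule) (fun s => G s - ln s)).
      exists (e s - / s); apply HdH; lra.
    - assert (0 < Rmin (a * x) (b * x)) by (apply Rmin_pos; apply Rmult_lt_0_compat; assumption).
      assert (0 < c) as Hc0 by lra.
      replace (G (b * x) - G (a * x) - ln (b / a)) with (G (b * x) - ln (b * x) - (G (a * x) - ln
        (a * x))).
      2: { unfold Rdiv; rewrite !ln_mult, ln_Rinv by (try apply Rinv_0_lt_compat; lra); ring. }
      rewrite Hc2; replace (b * x - a * x) with ((b - a) * x) by ring.
      rewrite !Rabs_mult, (Rabs_pos_eq x) by lra; fold k.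
      assert (Rabs (e c - / c) <= 1) as H1.
      { unfold e; replace (exp (- c) / c - / c) with (- ((1 - exp (- c)) / c)) by (field; lra).
        rewrite Rabs_Ropp; pose proof (exp_ineq1_le (- c)).
        assert (exp (- c) <= 1) by (rewrite <- exp_0; apply Rlt_le, exp_increasing; lra).
        rewrite Rabs_pos_eq; [apply Rle_div_l; lra|apply Rdiv_le_0_compat; lra]. }
      assert (0 <= k * x) by nra; nra. }
  assert (forall x, 0 < x -> Rabs (G (b * x) - G (a * x)) <= k / (m ^ 2) / x) as Hlarge.
  { intros x Hx.
    assert (0 < Rmin (a * x) (b * x)) as Hmin by (apply Rmin_pos; apply Rmult_lt_0_compat;
      assumption).
    destruct (MVT_gen G (a * x) (b * x) e) as [c [Hc1 Hc2]].
    - intros s Hs; apply HdG; lra.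
    - intros s Hs; apply continuity_pt_filterlim,
        (ex_derive_continuous (K := R_AbsRing) (V := R_NormedModule) G).
      eexists; apply HdG; lra.
    - rewrite Hc2; replace (b * x - a * x) with ((b - a) * x) by ring.
      rewrite !Rabs_mult, (Rabs_pos_eq x) by lra; fold k.
      assert (m * x <= c) as Hmc.
      { apply Rle_trans with (Rmin (a * x) (b * x)); [|lra]; apply Rmin_glb;
          apply Rmult_le_compat_r; lra. }
      assert (0 < m * x) as Hmx by nra.
      assert (Rabs (e c) <= / (m * x) * / (m * x)) as H1.
      { unfold e; rewrite Rabs_pos_eq; [|apply Rlt_le, Rdiv_lt_0_compat; [apply exp_pos|lra]].
        apply Rmult_le_compat; [apply Rlt_le, exp_pos|apply Rlt_le, Rinv_0_lt_compat;
          lra| |apply Rinv_le_contravar; lra].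
        eapply Rle_trans; [apply exp_neg_le_inv; lra|apply Rinv_le_contravar; lra]. }
      replace (k / m ^ 2 / x) with (/ (m * x) * / (m * x) * (k * x)) by (field; lra).
      apply Rmult_le_compat_r; [nra|exact H1]. }
  apply is_RInt_0_oo_eps; intros eps Heps.
  set (k1 := k + 1); set (k2 := k / m ^ 2).
  assert (0 <= k2) as Hk2 by (unfold k2; apply Rdiv_le_0_compat; [lra|apply pow_lt, Hm]).
  exists (eps / 2 / k1), ((k2 + 1) * 2 / eps); split; [apply Rdiv_lt_0_compat; unfold k1; lra|];
    intros x y Hx Hy.
  assert (0 < (k2 + 1) * 2 / eps) as HM by (apply Rdiv_lt_0_compat; lra).
  exists ((G (a * y) - G (a * x)) - (G (b * y) - G (b * x))); split.
  - apply (is_RInt_ext (fun t => minus (exp (- (a * t)) / t) (exp (- (b * t)) / t))).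
    + intros t Ht; unfold minus, plus, opp; simpl; unfold Rdiv; ring.
    + apply (is_RInt_minus (V := R_NormedModule)); apply Hsc; lra.
  - replace (G (a * y) - G (a * x) - (G (b * y) - G (b * x)) - ln (b / a)) with
      ((G (b * x) - G (a * x) - ln (b / a)) + - (G (b * y) - G (a * y))) by ring.
    eapply Rle_lt_trans; [apply Rabs_triang|]; rewrite Rabs_Ropp.
    specialize (Hsmall x ltac:(lra)); specialize (Hlarge y ltac:(lra)); fold k2 in Hlarge.
    assert (k * x < eps / 2) as A1.
    { apply Rle_lt_trans with (k1 * x); [apply Rmult_le_compat_r; unfold k1; lra|].
      replace (eps / 2) with (k1 * (eps / 2 / k1)) by (field; unfold k1; lra).
      apply Rmult_lt_compat_l; [unfold k1; lra|lra]. }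
    assert (k2 / y < eps / 2) as A2.
    { apply Rlt_div_l; [lra|].
      apply Rlt_le_trans with (eps / 2 * ((k2 + 1) * 2 / eps)); [|apply Rmult_le_compat_l; lra].
      replace (eps / 2 * ((k2 + 1) * 2 / eps)) with (k2 + 1) by (field; lra); lra. }
    lra.
Qed.

(** * Integrability on the imaginary axis *)

Lemma nonneg_of_deriv (f df : R -> R) x : 0 <= x ->
  (forall t, is_derive f t (df t)) -> f 0 = 0 -> (forall t, 0 <= t -> 0 <= df t) -> 0 <= f x.
Proof.
  intros Hx Hd H0 Hp.
  destruct (MVT_gen f 0 x df) as [c [Hc E]].
  - intros t _; apply Hd.
  - intros t _; apply continuity_pt_filterlim,
      (ex_derive_continuous (K := R_AbsRing) (V := R_NormedModule) f).
    eexists; apply Hd.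
  - rewrite Rmin_left, Rmax_right in Hc by exact Hx.
    rewrite H0 in E; replace (f x) with (df c * (x - 0)) by lra.
    apply Rmult_le_pos; [apply Hp|]; lra.
Qed.

Lemma cosh_ge_1 x : 1 <= cosh x.
Proof.
  unfold cosh; pose proof (exp_ineq1_le x); pose proof (exp_ineq1_le (- x)); lra.
Qed.

Lemma sinhR_ge x : 0 <= x -> x <= sinhR x.
Proof.
  intros Hx; assert (0 <= sinhR x - x); [|lra].
  apply (nonneg_of_deriv (fun t => sinhR t - t) (fun t => cosh t - 1)); try assumption.
  - intros t; unfold sinhR, cosh; auto_derive; [trivial|field].
  - unfold sinhR; rewrite Ropp_0; lra.
  - intros t _; pose proof (cosh_ge_1 t); lra.
Qed.

Lemma sinhR_pos x : 0 < x -> 0 < sinhR x.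
Proof. intros H; pose proof (sinhR_ge x); lra. Qed.

Lemma sinhR_opp x : sinhR (- x) = - sinhR x.
Proof. unfold sinhR; rewrite Ropp_involutive; field. Qed.

Lemma sinhR_le_cosh x : 0 <= x -> sinhR x <= x * cosh x.
Proof.
  intros Hx; assert (0 <= x * cosh x - sinhR x); [|lra].
  apply (nonneg_of_deriv (fun t => t * cosh t - sinhR t) (fun t => t * sinhR t)); try assumption.
  - intros t; unfold sinhR, cosh; auto_derive; [trivial|field].
  - unfold sinhR, cosh; rewrite Ropp_0, exp_0; field.
  - intros t Ht; pose proof (sinhR_ge t Ht); nra.
Qed.

Lemma cosh_le_exp x : 0 <= x -> cosh x <= exp x.
Proof.
  intros Hx; unfold cosh; assert (exp (- x) <= exp x); [|lra].
  destruct (Req_dec x 0) as [->|H]; [rewrite Ropp_0; lra|].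
  apply Rlt_le, exp_increasing; lra.
Qed.

Lemma cosh_opp x : cosh (- x) = cosh x.
Proof. unfold cosh; rewrite Ropp_involutive; field. Qed.

Lemma cosh_le_exp_abs x : cosh x <= exp (Rabs x).
Proof.
  destruct (Rle_lt_dec 0 x) as [H|H].
  - rewrite Rabs_pos_eq by exact H; apply cosh_le_exp, H.
  - rewrite Rabs_left, <- cosh_opp by exact H; apply cosh_le_exp; lra.
Qed.

Lemma cosh_half x : cosh x - 1 = 2 * (sinhR (x / 2) * sinhR (x / 2)).
Proof.
  unfold cosh, sinhR; replace x with (x / 2 + x / 2) at 1 2 by field.
  rewrite Ropp_plus_distr, !exp_plus.
  assert (exp (x / 2) * exp (- (x / 2)) = 1) by (rewrite <- exp_plus, Rplus_opp_r; apply exp_0).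
  nra.
Qed.

Lemma cosh_half' x : cosh x + 1 = 2 * (cosh (x / 2) * cosh (x / 2)).
Proof.
  unfold cosh; replace x with (x / 2 + x / 2) at 1 2 by field.
  rewrite Ropp_plus_distr, !exp_plus.
  assert (exp (x / 2) * exp (- (x / 2)) = 1) by (rewrite <- exp_plus, Rplus_opp_r; apply exp_0).
  nra.
Qed.

Lemma cosh_sub_1_le x : cosh x - 1 <= x ^ 2 / 2 * cosh x.
Proof.
  assert (forall y, 0 <= y -> cosh y - 1 <= y ^ 2 / 2 * cosh y) as H.
  { intros y Hy; rewrite cosh_half.
    pose proof (sinhR_le_cosh (y / 2) ltac:(lra)); pose proof (sinhR_ge (y / 2) ltac:(lra)).
    pose proof (cosh_half' y); pose proof (cosh_ge_1 y).
    apply Rle_trans with (2 * (y / 2 * cosh (y / 2) * (y / 2 * cosh (y / 2)))).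
    - apply Rmult_le_compat_l; [lra|]; apply Rmult_le_compat; lra.
    - replace (2 * (y / 2 * cosh (y / 2) * (y / 2 * cosh (y / 2)))) with (y ^ 2 / 4 * (2 * (cosh (y
        / 2) * cosh (y / 2)))) by field.
      rewrite <- H1; pose proof (pow2_ge_0 y); nra. }
  destruct (Rle_lt_dec 0 x) as [Hx|Hx]; [apply H, Hx|].
  rewrite <- cosh_opp; replace (x ^ 2) with ((- x) ^ 2) by ring; apply H; lra.
Qed.

Lemma sinhR_sub_le x : 0 <= x -> 0 <= sinhR x - x <= x ^ 3 * exp x.
Proof.
  intros Hx; split; [pose proof (sinhR_ge x Hx); lra|].
  pose proof (sinhR_le_cosh x Hx); pose proof (cosh_sub_1_le x); pose proof (cosh_le_exp x Hx).
  pose proof (cosh_ge_1 x); pose proof (pow2_ge_0 x).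
  assert (0 <= x ^ 3) by (apply pow_le, Hx).
  apply Rle_trans with (x * (cosh x - 1)); [lra|].
  apply Rle_trans with (x * (x ^ 2 / 2 * cosh x)); [apply Rmult_le_compat_l; assumption|].
  replace (x * (x ^ 2 / 2 * cosh x)) with (x ^ 3 * (cosh x / 2)) by field.
  apply Rmult_le_compat_l; lra.
Qed.

(** [Gintegrand] at [z = i s] is [i] times this real function. *)
Definition strip_int (c e s y : R) : R :=
  (sinhR (2 * s * y) / (2 * sinhR (c * y) * sinhR (e * y)) - s / (c * e * y)) / y.

(** Near 0 the two terms cancel to order [1 / y^2], which leaves a bounded function. At infinity the
    first term decays like [exp (- (c + e - 2 s) y)] and the second like [1 / y^2]. *)
Lemma strip_int_exists_pos c e s : 0 < c -> 0 < e -> 0 <= s -> 2 * s < c + e ->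
  exists l, is_RInt_0_oo (strip_int c e s) l.
Proof.
  intros Hc He Hs Hs2; set (T := fun k => k ^ 3 * exp k).
  assert (forall k, 0 <= k -> 0 <= T k) as HT.
  { intros k Hk; apply Rmult_le_pos; [apply pow_le, Hk|apply Rlt_le, exp_pos]. }
  assert (forall k y, 0 <= k -> 0 <= y <= 1 -> 0 <= sinhR (k * y) - k * y <= T k * y ^ 3) as HS.
  { intros k y Hk Hy; pose proof (sinhR_sub_le (k * y) ltac:(nra)) as [A B]; split; [exact A|].
    apply (Rle_trans _ _ _ B); unfold T; rewrite Rpow_mult_distr.
    replace (k ^ 3 * exp k * y ^ 3) with (k ^ 3 * y ^ 3 * exp k) by ring.
    apply Rmult_le_compat_l.
    - apply Rmult_le_pos; apply pow_le; lra.
    - destruct (Req_dec (k * y) k) as [->|Hn]; [lra|]; apply Rlt_le, exp_increasing; nra. }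
  (* [K1] comes from writing each [sinhR (k y)] as [k y] plus a remainder at most [T k y^3], and
     from [sinhR (k y) >= k y] in the denominator. [K2] uses [sinhR (k y) >= (1 - exp (- 2 k)) exp
     (k y) / 2] for [y >= 1] and [exp (- x) <= 4 / x^2]. *)
  set (K1 := (c * e * T (2 * s) + 2 * s * (c * T e + e * T c + T c * T e)) / (2 * c ^ 2 * e ^ 2)).
  set (K2 := 4 * (4 / ((1 - exp (- (2 * c))) * (1 - exp (- (2 * e))) * (c + e - 2 * s) ^ 2)) + s /
    (c * e)).
  assert (exp (- (2 * c)) < 1) as Ec by (rewrite <- exp_0; apply exp_increasing; lra).
  assert (exp (- (2 * e)) < 1) as Ee by (rewrite <- exp_0; apply exp_increasing; lra).
  assert (0 <= K1) as HK1.
  { unfold K1; apply Rdiv_le_0_compat.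
    - pose proof (HT c ltac:(lra)); pose proof (HT e ltac:(lra));
        pose proof (HT (2 * s) ltac:(lra)).
      assert (0 <= c * e) by nra; assert (0 <= c * e * T (2 * s)) by nra.
      assert (0 <= c * T e) by nra; assert (0 <= e * T c) by nra; assert (0 <= T c * T e) by nra.
      assert (0 <= 2 * s * (c * T e + e * T c + T c * T e)) by (apply Rmult_le_pos; lra); lra.
    - repeat apply Rmult_lt_0_compat; try lra; apply pow_lt; assumption. }
  assert (0 < (1 - exp (- (2 * c))) * (1 - exp (- (2 * e))) * (c + e - 2 * s) ^ 2) as HD.
  { repeat apply Rmult_lt_0_compat; try lra. }
  assert (0 <= K2) as HK2.
  { unfold K2; apply Rplus_le_le_0_compat.
    - apply Rmult_le_pos; [lra|]; apply Rlt_le, Rdiv_lt_0_compat; lra.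
    - apply Rdiv_le_0_compat; [lra|nra]. }
  apply (is_RInt_0_oo_exists _ (K1 + K2)).
  - intros x Hx; pose proof (sinhR_pos (c * x) ltac:(nra));
      pose proof (sinhR_pos (e * x) ltac:(nra)).
    apply (ex_derive_continuous (K := R_AbsRing) (V := R_NormedModule)).
    unfold strip_int, sinhR in *; auto_derive; repeat split; try lra;
      repeat apply Rmult_integral_contrapositive_currified; lra.
  - intros y Hy; apply Rle_trans with K1; [|lra].
    pose proof (HS c y ltac:(lra) ltac:(lra)) as [C1 C2].
    pose proof (HS e y ltac:(lra) ltac:(lra)) as [E1 E2].
    pose proof (HS (2 * s) y ltac:(lra) ltac:(lra)) as [S1 S2].
    pose proof (sinhR_pos (c * y) ltac:(nra)) as PC;
      pose proof (sinhR_pos (e * y) ltac:(nra)) as PE.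
    pose proof (HT c ltac:(lra)) as TC; pose proof (HT e ltac:(lra)) as TE;
      pose proof (HT (2 * s) ltac:(lra)) as TS.
    unfold strip_int; set (A := sinhR (c * y)) in *; set (B := sinhR (e * y)) in *;
      set (D := sinhR (2 * s * y)) in *.
    replace ((D / (2 * A * B) - s / (c * e * y)) / y) with
      ((c * e * y * D - 2 * s * A * B) / (2 * c * e * y ^ 2 * A * B)) by (field; repeat split; lra).
    assert (0 < y ^ 2) as Py2 by (apply pow_lt; lra).
    assert (0 < y ^ 4) as Py4 by (apply pow_lt; lra).
    assert (0 < y ^ 3) as Py3 by (apply pow_lt; lra).
    assert (y ^ 6 <= y ^ 4) as P64.
    { replace (y ^ 6) with (y ^ 4 * (y * y)) by ring; rewrite <- (Rmult_1_r (y ^ 4)) at 2.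
      apply Rmult_le_compat_l; [lra|nra]. }
    assert (0 < c * e) as Pce by nra.
    assert (0 < 2 * c ^ 2 * e ^ 2 * y ^ 4) as Pd.
    { repeat apply Rmult_lt_0_compat; try lra; apply pow_lt; assumption. }
    assert (2 * c ^ 2 * e ^ 2 * y ^ 4 <= 2 * c * e * y ^ 2 * A * B) as Hden.
    { replace (2 * c ^ 2 * e ^ 2 * y ^ 4) with (2 * c * e * y ^ 2 * ((c * y) * (e * y))) by ring.
      replace (2 * c * e * y ^ 2 * A * B) with (2 * c * e * y ^ 2 * (A * B)) by ring.
      apply Rmult_le_compat_l; [|apply Rmult_le_compat; nra].
      repeat apply Rmult_le_pos; lra. }
    assert (Rabs (c * e * y * D - 2 * s * A * B) <=
      (c * e * T (2 * s) + 2 * s * (c * T e + e * T c + T c * T e)) * y ^ 4) as Hnum.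
    { set (a := A - c * y) in *; set (b := B - e * y) in *; set (x := D - 2 * s * y) in *.
      replace (c * e * y * D - 2 * s * A * B) with
        (c * e * y * x - 2 * s * (c * y * b + e * y * a + a * b)) by (unfold a, b, x; ring).
      assert (0 <= c * e * y * x <= c * e * T (2 * s) * y ^ 4) as X1.
      { assert (0 <= c * e * y) by (apply Rmult_le_pos; lra); split; [apply Rmult_le_pos; lra|].
        replace (c * e * T (2 * s) * y ^ 4) with (c * e * y * (T (2 * s) * y ^ 3)) by ring.
        apply Rmult_le_compat_l; assumption. }
      assert (0 <= c * y * b <= c * T e * y ^ 4) as X2.
      { assert (0 <= c * y) by (apply Rmult_le_pos; lra); split; [apply Rmult_le_pos; lra|].
        replace (c * T e * y ^ 4) with (c * y * (T e * y ^ 3)) by ring; apply Rmult_le_compat_l;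
          assumption. }
      assert (0 <= e * y * a <= e * T c * y ^ 4) as X3.
      { assert (0 <= e * y) by (apply Rmult_le_pos; lra); split; [apply Rmult_le_pos; lra|].
        replace (e * T c * y ^ 4) with (e * y * (T c * y ^ 3)) by ring; apply Rmult_le_compat_l;
          assumption. }
      assert (0 <= a * b <= T c * T e * y ^ 4) as X4.
      { split; [apply Rmult_le_pos; lra|].
        apply Rle_trans with ((T c * y ^ 3) * (T e * y ^ 3)); [apply Rmult_le_compat; assumption|].
        replace (T c * y ^ 3 * (T e * y ^ 3)) with (T c * T e * y ^ 6) by ring.
        apply Rmult_le_compat_l; [nra|exact P64]. }
      assert (0 <= 2 * s * (c * y * b + e * y * a + a * b) <= 2 * s * ((c * T e + e * T c + T c * T
        e) * y ^ 4)) as X5.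
      { split; [apply Rmult_le_pos; lra|apply Rmult_le_compat_l; lra]. }
      apply Rabs_le; lra. }
    rewrite Rabs_div by lra; rewrite (Rabs_pos_eq (2 * c * e * y ^ 2 * A * B)) by lra.
    apply Rle_div_l; [lra|].
    apply (Rle_trans _ _ _ Hnum); unfold K1.
    apply Rle_trans with ((c * e * T (2 * s) + 2 * s * (c * T e + e * T c + T c * T e)) / (2 * c ^
      2 * e ^ 2) * (2 * c ^ 2 * e ^ 2 * y ^ 4)).
    + right; field; lra.
    + apply Rmult_le_compat_l; [exact HK1|exact Hden].
  - intros y Hy; apply Rle_trans with (K2 / y ^ 2).
    2: { apply Rmult_le_compat_r; [apply Rlt_le, Rinv_0_lt_compat, pow_lt|]; lra. }
    assert (forall k, 0 < k -> (1 - exp (- (2 * k))) / 2 * exp (k * y) <= sinhR (k * y)) as Hlow.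
    { intros k Hk; unfold sinhR.
      assert (exp (- (k * y)) <= exp (- (2 * k)) * exp (k * y)); [|lra].
      rewrite <- exp_plus; destruct (Req_dec (- (k * y)) (- (2 * k) + k * y)) as [->|Hn]; [lra|].
      apply Rlt_le, exp_increasing; nra. }
    pose proof (Hlow c Hc) as LC; pose proof (Hlow e He) as LE.
    set (A := sinhR (c * y)) in *; set (B := sinhR (e * y)) in *.
    pose proof (exp_pos (c * y)) as PXc; pose proof (exp_pos (e * y)) as PXe.
    set (uc := 1 - exp (- (2 * c))) in *; set (ue := 1 - exp (- (2 * e))) in *.
    assert (0 < uc) as Puc by (unfold uc; lra); assert (0 < ue) as Pue by (unfold ue; lra).
    assert (0 < uc / 2 * exp (c * y)) as Pc' by nra;
      assert (0 < ue / 2 * exp (e * y)) as Pe' by nra.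
    assert (0 < y ^ 2) as Py2 by (apply pow_lt; lra).
    pose proof (sinhR_ge (2 * s * y) ltac:(nra)) as S0.
    assert (sinhR (2 * s * y) <= exp (2 * s * y)) as S1.
    { unfold sinhR; pose proof (exp_pos (2 * s * y)); pose proof (exp_pos (- (2 * s * y))); lra. }
    set (D := sinhR (2 * s * y)) in *.
    assert (0 <= D) as D0 by (unfold D in *; nra).
    unfold strip_int; fold A B D.
    replace ((D / (2 * A * B) - s / (c * e * y)) / y) with (D / (2 * A * B) / y + - (s / (c * e) /
      y ^ 2))
      by (field; repeat split; lra).
    eapply Rle_trans; [apply Rabs_triang|]; rewrite Rabs_Ropp.
    assert (0 <= s / (c * e) / y ^ 2) as Q0.
    { apply Rdiv_le_0_compat; [apply Rdiv_le_0_compat; nra|exact Py2]. }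
    rewrite (Rabs_pos_eq _ Q0).
    assert (0 < A * B) as PAB by nra.
    assert (0 <= D / (2 * A * B) / y) as Q1.
    { apply Rdiv_le_0_compat; [apply Rdiv_le_0_compat; nra|lra]. }
    rewrite (Rabs_pos_eq _ Q1).
    unfold K2; rewrite Rdiv_plus_distr; apply Rplus_le_compat_r.
    set (k := c + e - 2 * s) in *; assert (0 < k) as Pk by (unfold k; lra).
    apply Rle_trans with (exp (2 * s * y) / (2 * (uc / 2 * exp (c * y)) * (ue / 2 * exp (e * y)))).
    + apply Rle_trans with (D / (2 * A * B)).
      * apply Rle_div_l; [lra|]; rewrite <- (Rmult_1_r (D / (2 * A * B))) at 1.
        apply Rmult_le_compat_l; [apply Rdiv_le_0_compat; nra|lra].
      * apply Rmult_le_compat; [exact D0|apply Rlt_le, Rinv_0_lt_compat; nra|exact S1|].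
        apply Rinv_le_contravar; [nra|].
        replace (2 * A * B) with (2 * (A * B)) by ring.
        replace (2 * (uc / 2 * exp (c * y)) * (ue / 2 * exp (e * y)))
          with (2 * ((uc / 2 * exp (c * y)) * (ue / 2 * exp (e * y)))) by ring.
        apply Rmult_le_compat_l; [lra|]; apply Rmult_le_compat; lra.
    + replace (exp (2 * s * y) / (2 * (uc / 2 * exp (c * y)) * (ue / 2 * exp (e * y))))
        with (2 / (uc * ue) * exp (- (k * y))).
      2: { unfold k;
        replace (- ((c + e - 2 * s) * y)) with (2 * s * y + - (c * y) + - (e * y)) by ring.
           rewrite !exp_plus, !exp_Ropp; field; repeat split; lra. }
      pose proof (exp_neg_le_inv_sqr (k * y) ltac:(nra)) as X.
      assert (0 < uc * ue) as Pu by nra.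
      apply Rle_trans with (2 / (uc * ue) * (4 / (k * y) ^ 2)).
      * apply Rmult_le_compat_l; [apply Rlt_le, Rdiv_lt_0_compat; lra|exact X].
      * replace (2 / (uc * ue) * (4 / (k * y) ^ 2)) with (8 / (uc * ue * k ^ 2) / y ^ 2) by (field;
          repeat split; lra).
        apply Rmult_le_compat_r; [apply Rlt_le, Rinv_0_lt_compat; lra|].
        replace (4 * (4 / (uc * ue * k ^ 2))) with (16 / (uc * ue * k ^ 2)) by (field;
          repeat split; lra).
        apply Rmult_le_compat_r; [apply Rlt_le, Rinv_0_lt_compat; exact HD|lra].
Qed.

Lemma strip_int_exists c e s : 0 < c -> 0 < e -> Rabs (2 * s) < c + e ->
  exists l, is_RInt_0_oo (strip_int c e s) l.
Proof.
  intros Hc He Hs; apply Rabs_def2 in Hs; destruct (Rle_lt_dec 0 s) as [H|H].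
  - apply strip_int_exists_pos; lra.
  - destruct (strip_int_exists_pos c e (- s)) as [l Hl]; try lra.
    exists (-1 * l); apply (is_RInt_0_oo_ext (fun y => -1 * strip_int c e (- s) y));
      [|apply is_RInt_0_oo_scal, Hl].
    intros y Hy; unfold strip_int; replace (2 * - s * y) with (- (2 * s * y)) by ring.
    rewrite sinhR_opp; pose proof (sinhR_pos (c * y) ltac:(nra));
      pose proof (sinhR_pos (e * y) ltac:(nra)).
    field; repeat split; lra.
Qed.

(** * Evaluation of the axis integral *)

(** Up to rescaling, the integrand for the logarithm of [G (i t) / G (i (t - e))]. *)
Definition cosh_int (u t : R) : R := (1 / t - cosh (u * t) / sinhR t) / t.

Definition cosh_integral (u : R) : R :=
  @RInt_gen R_CompleteNormedModule (cosh_int u) (at_right 0) (Rbar_locally p_infty).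

(** The sum-to-product formula produces a factor [sinhR (e * y)] that cancels the one in the
    denominator, so [e] disappears from the result. *)
Lemma strip_int_diff c e s y : 0 < c -> 0 < e -> 0 < y ->
  strip_int c e (s - e / 2) y - strip_int c e (s + e / 2) y =
  c * cosh_int (2 * s / c) (c * y).
Proof.
  intros Hc He Hy; pose proof (sinhR_pos (c * y) ltac:(nra)) as P1;
    pose proof (sinhR_pos (e * y) ltac:(nra)) as P2.
  unfold strip_int, cosh_int.
  replace (2 * s / c * (c * y)) with (2 * s * y) by (field; lra).
  assert (sinhR (2 * (s + e / 2) * y) - sinhR (2 * (s - e / 2) * y) = 2 * cosh (2 * s * y) * sinhR
    (e * y)) as E.
  { unfold sinhR, cosh; replace (2 * (s + e / 2) * y) with (2 * s * y + e * y) by field.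
    replace (2 * (s - e / 2) * y) with (2 * s * y + - (e * y)) by field.
    rewrite !Ropp_plus_distr, Ropp_involutive, !exp_plus; field. }
  replace (sinhR (2 * (s + e / 2) * y)) with (sinhR (2 * (s - e / 2) * y) + 2 * cosh (2 * s * y) *
    sinhR (e * y)) by lra.
  field; repeat split; lra.
Qed.

Lemma cosh_integral_correct u : Rabs u < 1 -> is_RInt_0_oo (cosh_int u) (cosh_integral u).
Proof.
  intros Hu; apply Rabs_def2 in Hu.
  (* Convergence is inherited from two strip integrals, with both periods equal to 1 and centre
     [u / 2]. *)
  assert (exists l, is_RInt_0_oo (cosh_int u) l) as [l Hl].
  { destruct (strip_int_exists 1 1 (u / 2 - 1 / 2)) as [l1 H1]; try lra; [apply Rabs_def1; lra|].
    destruct (strip_int_exists 1 1 (u / 2 + 1 / 2)) as [l2 H2]; try lra; [apply Rabs_def1; lra|].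
    exists (l1 + -1 * l2).
    apply (is_RInt_0_oo_ext (fun y => strip_int 1 1 (u / 2 - 1 / 2) y + -1 * strip_int 1 1 (u / 2 +
      1 / 2) y)).
    - intros y Hy; pose proof (strip_int_diff 1 1 (u / 2) y ltac:(lra) ltac:(lra) Hy) as E.
      replace (2 * (u / 2) / 1) with u in E by field; rewrite !Rmult_1_l in E; lra.
    - apply is_RInt_0_oo_plus; [exact H1|apply is_RInt_0_oo_scal, H2]. }
  apply (RInt_gen_correct (V := R_CompleteNormedModule)); exists l; exact Hl.
Qed.

Lemma cosh_integral_even u : cosh_integral (- u) = cosh_integral u.
Proof.
  unfold cosh_integral; f_equal; apply functional_extensionality; intros t; unfold cosh_int.
  rewrite Ropp_mult_distr_l_reverse, cosh_opp; reflexivity.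
Qed.

(** After replacing [t] by [t / 2] on the left, the integrands agree pointwise:
    [sinh t = 2 sinh (t/2) cosh (t/2)], and the two [cosh] on the right add up to
    [2 cosh (t/2) cosh (y t/2)]. *)
Lemma cosh_integral_duplication y : Rabs y < 1 -> cosh_integral y = cosh_integral ((1 - y) / 2) + cosh_integral ((1 + y) / 2).
Proof.
  intros Hy; pose proof (cosh_integral_correct y Hy) as I; apply Rabs_def2 in Hy.
  apply (is_RInt_0_oo_unique (fun t => / 2 * cosh_int y (/ 2 * t))); [apply is_RInt_0_oo_dilate;
    [lra|exact I]|].
  apply (is_RInt_0_oo_ext (fun t => cosh_int ((1 - y) / 2) t + cosh_int ((1 + y) / 2) t)).
  - intros t Ht; unfold cosh_int.
    pose proof (sinhR_pos (/ 2 * t) ltac:(lra)) as P1; pose proof (sinhR_pos t Ht) as P2.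
    pose proof (cosh_ge_1 (/ 2 * t)) as P3.
    assert (sinhR t = 2 * sinhR (/ 2 * t) * cosh (/ 2 * t)) as E1.
    { unfold sinhR, cosh; replace t with (/ 2 * t + / 2 * t) at 1 2 by field.
      rewrite Ropp_plus_distr, !exp_plus; field. }
    assert (cosh ((1 - y) / 2 * t) + cosh ((1 + y) / 2 * t) = 2 * cosh (/ 2 * t) * cosh (y * (/ 2 *
      t))) as E2.
    { unfold cosh; replace ((1 - y) / 2 * t) with (/ 2 * t + - (y * (/ 2 * t))) by field.
      replace ((1 + y) / 2 * t) with (/ 2 * t + y * (/ 2 * t)) by field.
      rewrite !Ropp_plus_distr, Ropp_involutive, !exp_plus; field. }
    replace (cosh ((1 - y) / 2 * t)) with (2 * cosh (/ 2 * t) * cosh (y * (/ 2 * t)) - cosh ((1 +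
      y) / 2 * t)) by lra.
    rewrite E1; field; repeat split; lra.
  - apply is_RInt_0_oo_plus; apply cosh_integral_correct, Rabs_def1; lra.
Qed.

(** * Second differences up to the singular points *)

Definition second_diff (f : R -> R) (u h : R) : R := f (u + h) + f (u - h) - 2 * f u.

Definition log_two_cos (u : R) : R := ln (2 * cos (PI * u / 2)).

Lemma cos_half_pos u : Rabs u < 1 -> 0 < cos (PI * u / 2).
Proof. intros H; apply Rabs_def2 in H; pose proof PI_RGT_0; apply cos_gt_0; nra. Qed.

Lemma log_two_cos_duplication y : Rabs y < 1 -> log_two_cos y = log_two_cos ((1 - y) / 2) + log_two_cos ((1 + y) / 2).
Proof.
  intros Hy; pose proof (Rabs_def2 _ _ Hy) as Hy2; unfold log_two_cos.
  assert (0 < cos (PI * y / 2)) as P0 by apply (cos_half_pos y Hy).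
  assert (0 < cos (PI * ((1 - y) / 2) / 2)) as P1 by (apply cos_half_pos, Rabs_def1; lra).
  assert (0 < cos (PI * ((1 + y) / 2) / 2)) as P2 by (apply cos_half_pos, Rabs_def1; lra).
  rewrite <- ln_mult by lra; f_equal.
  replace (cos (PI * ((1 - y) / 2) / 2)) with (sin (PI * ((1 + y) / 2) / 2)).
  2: { rewrite <- cos_shift; f_equal; field. }
  replace (cos (PI * y / 2)) with (sin (2 * (PI * ((1 + y) / 2) / 2))).
  2: { rewrite <- cos_shift, <- cos_neg; f_equal; field. }
  rewrite sin_2a; ring.
Qed.

(** Comes from [1 / sinh t = 2 exp (- t) + exp (- 2 t) / sinh t]. The first term yields four
    Frullani integrands, which hold the singularities at [u = 1] and [u = -1]; the second gains
    enough decay to be controlled uniformly up to there. *)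
Lemma exp_cosh_split (u h t : R) : 0 < t ->
  2 * cosh (u * t) * (cosh (h * t) - 1) / (t * sinhR t) =
  ((exp (- ((1 - u - h) * t)) - exp (- ((1 - u) * t))) / t +
   (exp (- ((1 - u + h) * t)) - exp (- ((1 - u) * t))) / t +
   ((exp (- ((1 + u - h) * t)) - exp (- ((1 + u) * t))) / t +
   (exp (- ((1 + u + h) * t)) - exp (- ((1 + u) * t))) / t)) +
  2 * cosh (u * t) * (cosh (h * t) - 1) * exp (- (2 * t)) / (t * sinhR t).
Proof.
  intros Ht; pose proof (sinhR_pos t Ht) as P.
  replace (- ((1 - u - h) * t)) with (- t + u * t + h * t) by ring.
  replace (- ((1 - u + h) * t)) with (- t + u * t + - (h * t)) by ring.
  replace (- ((1 - u) * t)) with (- t + u * t) by ring.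
  replace (- ((1 + u - h) * t)) with (- t + - (u * t) + h * t) by ring.
  replace (- ((1 + u + h) * t)) with (- t + - (u * t) + - (h * t)) by ring.
  replace (- ((1 + u) * t)) with (- t + - (u * t)) by ring.
  replace (- (2 * t)) with (- t + - t) by ring.
  rewrite !exp_plus; unfold cosh, sinhR in *.
  assert (exp t = / exp (- t)) as E by (rewrite exp_Ropp, Rinv_inv; reflexivity).
  pose proof (exp_pos (- t)) as P1; rewrite E in *.
  set (T := exp (- t)) in *; set (U := exp (u * t)); set (V := exp (- (u * t))).
  set (X := exp (h * t)); set (Y := exp (- (h * t))).
  assert (1 - T * T <> 0) as Hne.
  { intros Z; assert ((/ T - T) / 2 = (1 - T * T) / (2 * T)) as W by (field; lra); rewrite Z in W;
      unfold Rdiv in W at 2; lra. }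
  field; repeat split; try lra; intros Z; apply Hne; nra.
Qed.

(** The Frullani integrals account exactly for the logarithms. Since [|u| + |h| <= 1],
    [cosh (u t) cosh (h t) <= exp t], and with [cosh x - 1 <= x^2 / 2 * cosh x] the remaining
    integrand is at most [h^2 exp (- t)], whose integral is [h^2]. *)
Lemma cosh_integral_second_diff u h : Rabs (u + h) < 1 -> Rabs (u - h) < 1 ->
  Rabs (second_diff cosh_integral u h - second_diff (fun x => ln (1 - x) + ln (1 + x)) u h) <= h ^
    2.
Proof.
  intros H1 H2.
  assert (Rabs u < 1) as H0.
  { apply Rabs_def2 in H1; apply Rabs_def2 in H2; apply Rabs_def1; lra. }
  pose proof (cosh_integral_correct _ H1) as I1; pose proof (cosh_integral_correct _ H2) as I2;
    pose proof (cosh_integral_correct _ H0) as I0.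
  assert (Rabs u + Rabs h <= 1) as Huh.
  { apply Rabs_def2 in H1; apply Rabs_def2 in H2; unfold Rabs; destruct (Rcase_abs u),
      (Rcase_abs h); lra. }
  apply Rabs_def2 in H1; apply Rabs_def2 in H2; apply Rabs_def2 in H0.
  pose proof (frullani (1 - u - h) (1 - u) ltac:(lra) ltac:(lra)) as F1.
  pose proof (frullani (1 - u + h) (1 - u) ltac:(lra) ltac:(lra)) as F2.
  pose proof (frullani (1 + u - h) (1 + u) ltac:(lra) ltac:(lra)) as F3.
  pose proof (frullani (1 + u + h) (1 + u) ltac:(lra) ltac:(lra)) as F4.
  pose proof (is_RInt_0_oo_plus _ _ _ _ (is_RInt_0_oo_plus _ _ _ _ F1 F2) (is_RInt_0_oo_plus _ _ _
    _ F3 F4)) as FF.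
  pose proof (is_RInt_0_oo_plus _ _ _ _ (is_RInt_0_oo_plus _ _ _ _ I1 I2) (is_RInt_0_oo_scal (-2) _
    _ I0)) as II.
  pose proof (is_RInt_0_oo_plus _ _ _ _ II FF) as R; clear F1 F2 F3 F4 FF II I0 I1 I2.
  pose proof (is_RInt_0_oo_scal (h ^ 2) _ _ is_RInt_0_oo_exp) as G.
  rewrite Rmult_1_r in G.
  assert (forall x y, 0 < x -> 0 < y -> ln (x / y) = ln x - ln y) as Hln.
  { intros x y Hx Hy; unfold Rdiv; rewrite ln_mult, ln_Rinv; try lra; apply Rinv_0_lt_compat, Hy. }
  rewrite !Hln in R by lra.
  match type of R with is_RInt_0_oo ?f ?l => 
    replace (second_diff cosh_integral u h - second_diff (fun x => ln (1 - x) + ln (1 + x)) u h)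
      with l end.
  2: { unfold second_diff.
       replace (1 - (u + h)) with (1 - u - h) by ring;
         replace (1 + (u + h)) with (1 + u + h) by ring.
       replace (1 - (u - h)) with (1 - u + h) by ring;
         replace (1 + (u - h)) with (1 + u - h) by ring. ring. }
  eapply is_RInt_0_oo_norm; [|exact R|exact G]; intros t Ht; cbv beta.
  assert (cosh_int (u + h) t + cosh_int (u - h) t + -2 * cosh_int u t =
    - (2 * cosh (u * t) * (cosh (h * t) - 1) / (t * sinhR t))) as E.
  { unfold cosh_int; pose proof (sinhR_pos t Ht).
    assert (cosh ((u + h) * t) + cosh ((u - h) * t) = 2 * cosh (u * t) * cosh (h * t)) as E.
    { unfold cosh; replace ((u + h) * t) with (u * t + h * t) by ring.
      replace ((u - h) * t) with (u * t + - (h * t)) by ring.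
      rewrite !Ropp_plus_distr, Ropp_involutive, !exp_plus; field. }
    replace (cosh ((u + h) * t)) with (2 * cosh (u * t) * cosh (h * t) - cosh ((u - h) * t)) by lra.
    field; split; lra. }
  rewrite E, (exp_cosh_split u h t Ht).
  match goal with |- Rabs (- (?a + ?b) + ?a') <= _ => replace (- (a + b) + a') with (- b) by ring
    end.
  rewrite Rabs_Ropp.
  pose proof (cosh_ge_1 (u * t)) as C1; pose proof (cosh_ge_1 (h * t)) as C2.
  pose proof (cosh_sub_1_le (h * t)) as C3.
  pose proof (sinhR_ge t ltac:(lra)) as S1; pose proof (exp_pos (- (2 * t))) as E2.
  assert (cosh (u * t) * cosh (h * t) <= exp t) as C4.
  { apply Rle_trans with (exp (Rabs (u * t)) * exp (Rabs (h * t))).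
    - apply Rmult_le_compat; try apply cosh_le_exp_abs; lra.
    - rewrite <- exp_plus, !Rabs_mult, (Rabs_pos_eq t) by lra.
      destruct (Req_dec (Rabs u * t + Rabs h * t) t) as [->|Hn]; [lra|]; apply Rlt_le,
        exp_increasing; nra. }
  assert (0 < t * sinhR t) as P by nra.
  rewrite Rabs_pos_eq.
  2: { apply Rdiv_le_0_compat; [|exact P]; apply Rmult_le_pos; [|lra]; apply Rmult_le_pos; lra. }
  apply Rle_div_l; [exact P|].
  apply Rle_trans with (h ^ 2 * t ^ 2 * (cosh (u * t) * cosh (h * t)) * exp (- (2 * t))).
  - apply Rmult_le_compat_r; [lra|].
    replace (h ^ 2 * t ^ 2 * (cosh (u * t) * cosh (h * t))) with (2 * cosh (u * t) * ((h * t) ^ 2 /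
      2 * cosh (h * t))) by field.
    apply Rmult_le_compat_l; lra.
  - replace (exp (- t)) with (exp t * exp (- (2 * t))) by (rewrite <- exp_plus; f_equal; ring).
    pose proof (pow2_ge_0 h); pose proof (pow2_ge_0 t).
    assert (0 <= h ^ 2 * t ^ 2) by (apply Rmult_le_pos; assumption).
    apply Rle_trans with (h ^ 2 * t ^ 2 * exp t * exp (- (2 * t))).
    + apply Rmult_le_compat_r; [lra|]; apply Rmult_le_compat_l; assumption.
    + replace (h ^ 2 * t ^ 2 * exp t * exp (- (2 * t))) with (h ^ 2 * (exp t * exp (- (2 * t))) *
        (t * t)) by ring.
      apply Rmult_le_compat_l; [|nra].
      apply Rmult_le_pos; [assumption|]; apply Rmult_le_pos; apply Rlt_le, exp_pos.
Qed.

Lemma sin_ge_cubic x : 0 <= x <= PI -> x - x ^ 3 / 6 <= sin x.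
Proof.
  intros Hx; pose proof (SIN x ltac:(lra) ltac:(lra)) as [H _].
  eapply Rle_trans; [|exact H]; unfold sin_lb, sin_approx, sin_term; simpl.
  pose proof PI_4; unfold Rdiv in *.
  replace (/ (1 + 1 + 1 + 1 + 1 + 1)) with (/ 6) by (f_equal; ring).
  assert (0 <= x * x <= 16) by nra.
  (* The last two terms of the Taylor polynomial of degree 7 combine to [x^5 (42 - x^2) / 5040]. *)
  assert (0 <= x * (x * x * (x * x)) * (42 - x * x)).
  { apply Rmult_le_pos; [|lra]; apply Rmult_le_pos; [lra|nra]. }
  simpl; lra.
Qed.

(** The double poles cancel. With [s = sin x], the difference is [(x - s) (x + s) / (x^2 s^2)], and
    [x - s <= x^3 / 6], [x + s <= 2 x], [s >= x / 3] give the constant 3. *)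
Lemma cosec_sqr_bound x : 0 < x <= PI / 2 -> 0 <= 1 / sin x ^ 2 - 1 / x ^ 2 <= 3.
Proof.
  intros Hx; pose proof PI_4; pose proof PI_RGT_0.
  pose proof (sin_ge_cubic x ltac:(lra)) as H1; pose proof (sin_lt_x x ltac:(lra)) as H2.
  assert (x / 3 <= sin x) as H3.
  { assert (x ^ 2 <= 4) by nra.
    replace (x ^ 3 / 6) with (x * (x ^ 2 / 6)) in H1 by field; nra. }
  set (s := sin x) in *.
  assert (0 < s) as Hs by lra.
  replace (1 / s ^ 2 - 1 / x ^ 2) with ((x - s) * (x + s) / (x ^ 2 * s ^ 2)) by (field; lra).
  assert (0 < x ^ 2 * s ^ 2) as P by (apply Rmult_lt_0_compat; apply pow_lt; lra).
  split; [apply Rdiv_le_0_compat; [apply Rmult_le_pos; lra|exact P]|].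
  apply Rle_div_l; [exact P|].
  apply Rle_trans with (x ^ 3 / 6 * (2 * x)); [apply Rmult_le_compat; lra|].
  replace (x ^ 3 / 6 * (2 * x)) with (3 * (x ^ 2 * (x / 3) ^ 2)) by field.
  apply Rmult_le_compat_l; [lra|]; apply Rmult_le_compat_l; [apply pow2_ge_0|].
  apply pow_incr; lra.
Qed.

(** The mean value theorem twice: the second difference is the increment of
    [g (u + s) - g (u + s - h)] between [s = 0] and [s = h], and the derivative of that function is
    itself an increment of [g1] over a step [h]. *)
Lemma second_diff_deriv (g g1 g2 : R -> R) (K u h : R) :
  (forall x, Rabs x < 1 -> is_derive g x (g1 x)) ->
  (forall x, Rabs x < 1 -> is_derive g1 x (g2 x)) ->
  (forall x, Rabs x < 1 -> Rabs (g2 x) <= K) ->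
  Rabs (u + h) < 1 -> Rabs (u - h) < 1 -> Rabs (second_diff g u h) <= K * h ^ 2.
Proof.
  intros D1 D2 HK H1 H2; apply Rabs_def2 in H1; apply Rabs_def2 in H2.
  assert (forall x, Rmin (- Rabs h) 0 <= x <= Rmax 0 (Rabs h) -> Rabs (u + x) < 1) as Hin.
  { intros x Hx; apply Rabs_def1; revert Hx; unfold Rabs, Rmin, Rmax; destruct (Rcase_abs h);
      repeat (match goal with |- context [if ?c then _ else _] => destruct c end); lra. }
  assert (forall x, Rmin 0 h <= x <= Rmax 0 h -> Rabs (u + x) < 1 /\ Rabs (u + x - h) < 1) as Hb.
  { intros x Hx; split; apply Rabs_def1; revert Hx; unfold Rmin, Rmax;
      repeat (match goal with |- context [if ?c then _ else _] => destruct c end); lra. }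
  assert (forall x, Rmin 0 h <= x <= Rmax 0 h ->
     is_derive (fun s => g (u + s) - g (u + s - h)) x (g1 (u + x) - g1 (u + x - h))) as Dk.
  { intros x Hx; destruct (Hb x Hx) as [B1 B2].
    apply (is_derive_minus (V := R_NormedModule) (fun s => g (u + s)) (fun s => g (u + s - h))).
    - rewrite <- (Rmult_1_l (g1 (u + x)));
        apply (is_derive_comp (V := R_NormedModule) g (fun s => u + s)); [apply D1, B1|].
      auto_derive; [trivial|ring].
    - rewrite <- (Rmult_1_l (g1 (u + x - h)));
        apply (is_derive_comp (V := R_NormedModule) g (fun s => u + s - h)); [apply D1, B2|].
      auto_derive; [trivial|ring]. }
  destruct (MVT_gen (fun s => g (u + s) - g (u + s - h)) 0 h (fun s => g1 (u + s) - g1 (u + s -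
    h))) as [x [Hx E1]].
  - intros y Hy; apply Dk; lra.
  - intros y Hy; apply continuity_pt_filterlim,
      (ex_derive_continuous (K := R_AbsRing) (V := R_NormedModule) (fun s => g (u + s) - g (u + s -
        h))).
    eexists; apply Dk, Hy.
  - destruct (Hb x Hx) as [B1 B2].
    assert (forall y,
      Rmin (u + x - h) (u + x) <= y <= Rmax (u + x - h) (u + x) -> Rabs y < 1) as Hy.
    { intros y Hy; apply Rabs_def2 in B1; apply Rabs_def2 in B2; apply Rabs_def1; revert Hy;
        unfold Rmin, Rmax;
      repeat (match goal with |- context [if ?c then _ else _] => destruct c end); lra. }
    destruct (MVT_gen g1 (u + x - h) (u + x) g2) as [y [Hyy E2]].
    + intros y Hyy; apply D2, Hy; lra.
    + intros y Hyy; apply continuity_pt_filterlim,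
        (ex_derive_continuous (K := R_AbsRing) (V := R_NormedModule) g1).
      eexists; apply D2, Hy, Hyy.
    + unfold second_diff.
      replace (g (u + h) + g (u - h) - 2 * g u) with (g2 y * h ^ 2).
      2: { replace (u + h - h) with u in E1 by ring; replace (u + 0 - h) with (u - h) in E1 by ring.
           rewrite Rplus_0_r in E1; rewrite E2 in E1.
           replace (u + x - (u + x - h)) with h in E1 by ring. rewrite Rminus_0_r in E1. simpl;
             lra. }
      rewrite Rabs_mult, (Rabs_pos_eq (h ^ 2)) by apply pow2_ge_0.
      apply Rmult_le_compat_r; [apply pow2_ge_0|apply HK, Hy, Hyy].
Qed.

(** By evenness take [x >= 0]; with [th = PI / 2 * (1 - x)] the pole at [x = 1] cancels by
    [cosec_sqr_bound]. The constant is [13 = 4 * 3 + 1], from [(PI / 2)^2 <= 4] and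
    [1 / (1 + x)^2 <= 1]. *)
Lemma log_two_cos_second_diff u h : Rabs (u + h) < 1 -> Rabs (u - h) < 1 ->
  Rabs (second_diff (fun x => ln (1 - x) + ln (1 + x) - log_two_cos x) u h) <= 13 * h ^ 2.
Proof.
  apply (second_diff_deriv _ (fun x => - / (1 - x) + / (1 + x) + PI / 2 * (sin (PI * x / 2) / cos
    (PI * x / 2)))
    (fun x => - / (1 - x) ^ 2 - / (1 + x) ^ 2 + (PI / 2) ^ 2 / cos (PI * x / 2) ^ 2)).
  - intros x Hx; pose proof (cos_half_pos x Hx) as Hc; apply Rabs_def2 in Hx; unfold log_two_cos.
    auto_derive; [repeat split; lra|]; change (PI * x * / 2) with (PI * x / 2); field;
      repeat split; lra.
  - intros x Hx; pose proof (cos_half_pos x Hx) as Hc; apply Rabs_def2 in Hx.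
    auto_derive; [repeat split; lra|].
    pose proof (sin2_cos2 (PI * x / 2)) as E; unfold Rsqr in E.
    replace (PI * x * / 2) with (PI * x / 2) by reflexivity.
    set (C := cos (PI * x / 2)) in *; set (S := sin (PI * x / 2)) in *.
    replace ((PI / 2) ^ 2 / C ^ 2) with ((PI / 2) ^ 2 * (S * S + C * C) / C ^ 2) by (rewrite E;
      field; lra).
    field; repeat split; lra.
  - assert (forall x,
      0 <= x < 1 -> Rabs (- / (1 - x) ^ 2 - / (1 + x) ^ 2 + (PI / 2) ^ 2 / cos (PI * x / 2) ^ 2) <=
      13) as H.
    { intros x Hx; pose proof PI_RGT_0; pose proof PI_4.
      set (th := PI / 2 * (1 - x)).
      assert (0 < th <= PI / 2) as Hth by (unfold th; split; nra).
      pose proof (cosec_sqr_bound th Hth) as B.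
      replace (cos (PI * x / 2)) with (sin th) by (unfold th; rewrite <- cos_shift; f_equal; field).
      assert (0 < sin th) as Ps by (apply sin_gt_0; lra).
      replace (- / (1 - x) ^ 2 - / (1 + x) ^ 2 + (PI / 2) ^ 2 / sin th ^ 2) with
        ((PI / 2) ^ 2 * (1 / sin th ^ 2 - 1 / th ^ 2) - / (1 + x) ^ 2).
      2: { replace (/ (1 - x) ^ 2) with ((PI / 2) ^ 2 * (1 / th ^ 2)); [field; lra|].
           unfold th; field; lra. }
      assert (0 < / (1 + x) ^ 2 <= 1) as B2.
      { split; [apply Rinv_0_lt_compat, pow_lt; lra|]; rewrite <- Rinv_1; apply Rinv_le_contravar;
          nra. }
      assert (0 <= (PI / 2) ^ 2 <= 4) as B3 by (split; nra).
      apply Rabs_le; split; [nra|].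
      assert ((PI / 2) ^ 2 * (1 / sin th ^ 2 - 1 / th ^ 2) <= 4 * 3) by (apply Rmult_le_compat;
        lra); lra. }
    intros x Hx; apply Rabs_def2 in Hx; destruct (Rle_lt_dec 0 x) as [H0|H0]; [apply H; lra|].
    specialize (H (- x) ltac:(lra)).
    replace (cos (PI * x / 2)) with (cos (PI * - x / 2)) by (rewrite <- cos_neg; f_equal; field).
    replace (- / (1 - x) ^ 2 - / (1 + x) ^ 2) with (- / (1 - - x) ^ 2 - / (1 + - x) ^ 2);
      [exact H|].
    replace (1 - - x) with (1 + x) by ring; replace (1 + - x) with (1 - x) by ring; ring.
Qed.

(* The duplication formula expresses a second difference of step [h] by two of step [h/2],
   so a quadratic bound improves by the factor 2. *)
Lemma duplication_zero (D : R -> R) (K : R) :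
  (forall u, D (- u) = D u) ->
  (forall y, Rabs y < 1 -> D y = D ((1 - y) / 2) + D ((1 + y) / 2)) ->
  (forall u h, Rabs (u + h) < 1 -> Rabs (u - h) < 1 -> Rabs (second_diff D u h) <= K * h ^ 2) ->
  forall u, Rabs u < 1 -> D u = 0.
Proof.
  intros He Hd HK.
  assert (forall n u h, Rabs (u + h) < 1 -> Rabs (u - h) < 1 ->
    Rabs (second_diff D u h) <= K / 2 ^ n * h ^ 2) as Hn.
  { induction n as [|n IH]; intros u h H1 H2.
    - simpl (2 ^ 0); rewrite Rdiv_1_r; apply HK; assumption.
    - apply Rabs_def2 in H1; apply Rabs_def2 in H2.
      replace (second_diff D u h) with (second_diff D ((1 - u) / 2) (h / 2) + second_diff D ((1 +
        u) / 2) (h / 2)).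
      2: { unfold second_diff.
           rewrite (Hd (u + h)), (Hd (u - h)), (Hd u) by (apply Rabs_def1; lra).
           replace ((1 - u) / 2 + h / 2) with ((1 - (u - h)) / 2) by field.
           replace ((1 - u) / 2 - h / 2) with ((1 - (u + h)) / 2) by field.
           replace ((1 + u) / 2 + h / 2) with ((1 + (u + h)) / 2) by field.
           replace ((1 + u) / 2 - h / 2) with ((1 + (u - h)) / 2) by field. ring. }
      eapply Rle_trans; [apply Rabs_triang|].
      pose proof (IH ((1 - u) / 2) (h / 2) ltac:(apply Rabs_def1; lra) ltac:(apply Rabs_def1;
        lra)) as A.
      pose proof (IH ((1 + u) / 2) (h / 2) ltac:(apply Rabs_def1; lra) ltac:(apply Rabs_def1;
        lra)) as B.
      replace (K / 2 ^ S n * h ^ 2) with (K / 2 ^ n * (h / 2) ^ 2 + K / 2 ^ n * (h / 2) ^ 2);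
        [lra|].
      simpl; field; apply pow_nonzero; lra. }
  (* Letting [n] grow, second differences vanish; at 0 evenness turns them into [2 D h - 2 D 0]. *)
  assert (forall h, Rabs h < 1 -> D h = D 0) as Hc.
  { intros h Hh.
    assert (Rabs (second_diff D 0 h) <= 0) as Z.
    { apply le_epsilon; intros eps Heps; rewrite Rplus_0_l.
      destruct (pow_lt_1_zero (/ 2)) with (y := eps / (Rabs K * h ^ 2 + 1)) as [n H2n];
        [rewrite Rabs_pos_eq; lra| |].
      - pose proof (Rabs_pos K); pose proof (pow2_ge_0 h); apply Rdiv_lt_0_compat; nra.
      - specialize (H2n n (Nat.le_refl n)); rewrite Rabs_pos_eq in H2n by (apply pow_le; lra).
        eapply Rle_trans; [apply (Hn n)|].
        + rewrite Rplus_0_l; exact Hh.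
        + unfold Rminus; rewrite Rplus_0_l, Rabs_Ropp; exact Hh.
        + pose proof (Rabs_pos K); pose proof (pow2_ge_0 h); pose proof (Rle_abs K).
          assert (0 <= Rabs K * h ^ 2) by (apply Rmult_le_pos; assumption).
          rewrite pow_inv in H2n; assert (0 < / 2 ^ n) by (apply Rinv_0_lt_compat, pow_lt; lra).
          apply Rle_trans with (/ 2 ^ n * (Rabs K * h ^ 2)).
          * replace (K / 2 ^ n * h ^ 2) with (/ 2 ^ n * (K * h ^ 2)) by (unfold Rdiv; ring).
            apply Rmult_le_compat_l; [lra|]; apply Rmult_le_compat_r; assumption.
          * apply Rle_trans with (eps / (Rabs K * h ^ 2 + 1) * (Rabs K * h ^ 2 + 1)); [|right;
              field; lra].
            apply Rmult_le_compat; lra. }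
    pose proof (Rabs_pos (second_diff D 0 h)) as Z0.
    assert (second_diff D 0 h = 0) as Z1.
    { destruct (Req_dec (second_diff D 0 h) 0) as [E|E]; [exact E|apply Rabs_pos_lt in E; lra]. }
    unfold second_diff in Z1; rewrite Rplus_0_l in Z1; unfold Rminus in Z1; rewrite Rplus_0_l,
      He in Z1; lra. }
  (* For constant [D], duplication reads [D 0 = 2 D 0]. *)
  assert (D 0 = 0) as D0.
  { pose proof (Hd 0 ltac:(rewrite Rabs_R0; lra)) as E.
    rewrite (Hc ((1 - 0) / 2)), (Hc ((1 + 0) / 2)) in E by (apply Rabs_def1; lra); lra. }
  intros u Hu; rewrite (Hc u Hu); exact D0.
Qed.

Theorem cosh_integral_value u : Rabs u < 1 -> cosh_integral u = ln (2 * cos (PI * u / 2)).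
Proof.
  intros Hu; assert (cosh_integral u - log_two_cos u = 0) as E; [|unfold log_two_cos in E; lra];
    revert u Hu.
  (* [14 = 1 + 13], the two second-difference bounds. *)
  apply (duplication_zero (fun u => cosh_integral u - log_two_cos u) 14).
  - intros u; rewrite cosh_integral_even; unfold log_two_cos.
    replace (PI * - u / 2) with (- (PI * u / 2)) by field; rewrite cos_neg; reflexivity.
  - intros y Hy; rewrite cosh_integral_duplication, log_two_cos_duplication by exact Hy; ring.
  - intros u h H1 H2.
    pose proof (cosh_integral_second_diff u h H1 H2) as A;
      pose proof (log_two_cos_second_diff u h H1 H2) as B.
    replace (second_diff (fun u => cosh_integral u - log_two_cos u) u h) with
      ((second_diff cosh_integral u h - second_diff (fun x => ln (1 - x) + ln (1 + x)) u h)
       + second_diff (fun x => ln (1 - x) + ln (1 + x) - log_two_cos x) u h) by (unfold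
           second_diff; ring).
    eapply Rle_trans; [apply Rabs_triang|]; lra.
Qed.

(** * The difference equation of the hyperbolic gamma function *)

Lemma is_RInt_0_oo_imaginary (f : R -> C) (g : R -> R) (l : R) :
  (forall y, 0 < y -> f y = (0, g y)) -> is_RInt_0_oo g l ->
  @RInt_gen CV f (at_right 0) (Rbar_locally p_infty) = (0, l).
Proof.
  intros E H; apply (is_RInt_gen_unique (V := CV)); intros Q [eps HQ].
  destruct (proj1 (is_RInt_0_oo_eps g l) H eps (cond_pos eps)) as [d [M [Hd HM]]].
  apply (Filter_prod _ _ _ (fun a => 0 < a < d) (fun b => Rmax M 0 < b)).
  - exists (mkposreal d Hd); intros y Hy H0; split; [exact H0|].
    unfold ball in Hy; simpl in Hy; unfold AbsRing_ball, abs, minus, plus, opp in Hy; simpl in Hy.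
    rewrite Rabs_pos_eq in Hy; lra.
  - exists (Rmax M 0); intros y Hy; exact Hy.
  - intros a b Ha Hb; pose proof (Rmax_l M 0); pose proof (Rmax_r M 0).
    destruct (HM a b Ha) as [y [Hy1 Hy2]]; [lra|].
    exists (0, y); split.
    + apply (is_RInt_ext (V := CV) (fun t => (0, g t) : CV)).
      * intros t Ht; symmetry; apply E; assert (0 < Rmin a b) by (apply Rmin_pos; simpl in *; lra);
          simpl in *; lra.
      * apply (is_RInt_fct_extend_pair (U := R_NormedModule) (V := R_NormedModule)); simpl;
          [|exact Hy1].
        assert (@is_RInt R_NormedModule (fun _ => 0) a b ((b - a) * 0)) as Z
          by exact (is_RInt_const (V := R_NormedModule) a b 0).
        rewrite Rmult_0_r in Z; exact Z.
    + apply HQ; split; simpl; [apply ball_center|exact Hy2].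
Qed.

Lemma Cexp_imaginary x : Cexp (0, x) = (cos x, sin x).
Proof. unfold Cexp; simpl; rewrite exp_0; f_equal; ring. Qed.

Lemma Gintegrand_axis ap am s y : 0 < ap -> 0 < am -> 0 < y ->
  Gintegrand ap am (0, s) y = (0, strip_int ap am s y).
Proof.
  intros Hap Ham Hy; pose proof (sinhR_pos (ap * y) ltac:(nra)) as P1;
    pose proof (sinhR_pos (am * y) ltac:(nra)) as P2.
  assert (Csin (RtoC (2 * y) * (0, s))%C = (0, sinhR (2 * s * y))) as E.
  { unfold Csin; replace (Ci * (RtoC (2 * y) * (0, s)))%C with (RtoC (- (2 * s * y))).
    2: { unfold Ci, RtoC, Cmult; simpl; f_equal; ring. }
    unfold Cexp, sinhR, RtoC, Ci, Cdiv, Cinv, Cmult, Cminus, Cplus, Copp; simpl.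
    rewrite Ropp_0, cos_0, sin_0, Ropp_involutive; apply injective_projections; simpl; field. }
  unfold Gintegrand; rewrite E; unfold strip_int, Cdiv, Cinv, RtoC, Cmult, Cminus, Cplus, Copp;
    simpl.
  assert (0 < 2 * sinhR (ap * y) * sinhR (am * y)) by nra.
  assert (0 < ap * am * y) by (repeat apply Rmult_lt_0_compat; assumption).
  set (A := 2 * sinhR (ap * y) * sinhR (am * y)) in *; set (B := ap * am * y) in *.
  apply injective_projections; simpl; field; repeat split; lra.
Qed.

Lemma Gstrip_axis ap am s l : 0 < ap -> 0 < am -> is_RInt_0_oo (strip_int ap am s) l ->
  Gstrip ap am (0, s) = RtoC (exp (- l)).
Proof.
  intros Hap Ham H; unfold Gstrip.
  rewrite (is_RInt_0_oo_imaginary (Gintegrand ap am (0, s)) (strip_int ap am s) l);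
    [|intros y Hy; apply Gintegrand_axis; assumption|exact H].
  unfold Cexp, Ci, Cmult, RtoC; simpl.
  replace (0 * 0 - 1 * l) with (- l) by ring; replace (0 * l + 1 * 0) with 0 by ring.
  rewrite cos_0, sin_0; f_equal; ring.
Qed.

Lemma strip_int_sym c e s y : strip_int c e s y = strip_int e c s y.
Proof. unfold strip_int; f_equal; f_equal; f_equal; [|ring]; ring. Qed.

Definition two_cosh (c e : R) (z : C) : C :=
  (Cexp (RtoC PI * (z - Ci * RtoC (e / 2)) / RtoC c) + Cexp (- (RtoC PI * (z - Ci * RtoC (e / 2)) /
    RtoC c)))%C.

Section FunctionalEquation.
Variables (ap am : R) (Gx : C -> C) (P : C -> Prop) (d : bool).
Hypotheses (hap : 0 < ap) (ham : 0 < am) (hG : hyperbolic_gamma_ext ap am Gx P).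
Let c := adelta ap am d.
Let e := adelta ap am (negb d).

Let Hc : 0 < c. Proof. unfold c, adelta; destruct d; assumption. Qed.
Let He : 0 < e. Proof. unfold e, adelta; destruct d; assumption. Qed.
Let Hce : ahalf ap am = (c + e) / 2.
Proof. unfold ahalf, c, e, adelta; destruct d; simpl; lra. Qed.

Let Gx_axis s l : Rabs s < (c + e) / 2 -> is_RInt_0_oo (strip_int c e s) l -> Gx (0, s) = RtoC (exp (- l)).
Proof.
  intros Hs Hl; destruct hG as [Hst _]; rewrite Hst by (rewrite Hce; exact Hs).
  apply Gstrip_axis; [exact hap|exact ham|].
  unfold c, e, adelta in Hl; destruct d; simpl in Hl; [exact Hl|].
  apply (is_RInt_0_oo_ext (strip_int am ap s)); [intros; apply strip_int_sym|exact Hl].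
Qed.

(** On exactly this interval both [t] and [t - e] lie in the strip; its length is at least [c], or
    rather equal to it, so it is never empty. The two points are [s + e / 2] and [s - e / 2]. *)
Let axis_equation t : (e - c) / 2 < t < (e + c) / 2 ->
  Gx (0, t) = (two_cosh c e (0, t) * Gx (0, (t - e)%R))%C.
Proof.
  intros Ht; set (s := t - e / 2).
  destruct (strip_int_exists c e (s - e / 2) Hc He) as [l1 H1].
  { apply Rabs_def1; unfold s; lra. }
  destruct (strip_int_exists c e (s + e / 2) Hc He) as [l2 H2].
  { apply Rabs_def1; unfold s; lra. }
  assert (Rabs (2 * s / c) < 1) as Hs.
  { unfold Rdiv; rewrite Rabs_mult, (Rabs_pos_eq (/ c)) by (apply Rlt_le, Rinv_0_lt_compat, Hc).
    apply Rlt_div_l; [exact Hc|]; apply Rabs_def1; unfold s; lra. }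
  assert (l1 - l2 = cosh_integral (2 * s / c)) as E.
  { apply (is_RInt_0_oo_unique (fun y => c * cosh_int (2 * s / c) (c * y))).
    - apply (is_RInt_0_oo_ext (fun y => strip_int c e (s - e / 2) y + -1 * strip_int c e (s + e /
        2) y)).
      + intros y Hy; rewrite <- (strip_int_diff c e s y Hc He Hy); ring.
      + replace (l1 - l2) with (l1 + -1 * l2) by ring; apply is_RInt_0_oo_plus;
          [exact H1|apply is_RInt_0_oo_scal, H2].
    - apply is_RInt_0_oo_dilate; [exact Hc|apply cosh_integral_correct, Hs]. }
  rewrite (cosh_integral_value _ Hs) in E.
  rewrite (Gx_axis t l2), (Gx_axis (t - e) l1).
  - replace (- l2) with ((l1 - l2) + - l1) by ring; rewrite exp_plus, E, exp_ln.
    2: { apply Rmult_lt_0_compat; [lra|apply cos_half_pos, Hs]. }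
    rewrite RtoC_mult; f_equal; unfold two_cosh.
    replace (RtoC PI * ((0, t) - Ci * RtoC (e / 2)) / RtoC c)%C with ((0, PI * s / c) : C).
    2: { unfold s, Cdiv, Cinv, Ci, RtoC, Cmult, Cminus, Cplus, Copp; simpl.
         apply injective_projections; simpl; field; pose proof Hc; lra. }
    replace (Copp (0, PI * s / c)) with ((0, - (PI * s / c)) : C).
    2: { unfold Copp; simpl; f_equal; ring. }
    rewrite !Cexp_imaginary, cos_neg, sin_neg; unfold RtoC, Cplus; simpl.
    replace (PI * (2 * s / c) / 2) with (PI * s / c) by (field; pose proof Hc; lra).
    f_equal; ring.
  - apply Rabs_def1; pose proof Hc; pose proof He; lra.
  - replace (t - e) with (s - e / 2) by (unfold s; field); exact H1.
  - apply Rabs_def1; pose proof Hc; pose proof He; lra.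
  - replace t with (s + e / 2) by (unfold s; field); exact H2.
Qed.

(** Exceptional set for both sides of the equation at once: [Gx] at [z] and at the shifted point. *)
Let Q (z : C) : Prop := P z \/ P (z - Ci * RtoC e)%C.

Let Q_discrete : closed_discrete Q.
Proof.
  destruct hG as [_ [HP _]]; intros z.
  destruct (HP z) as [r1 [Hr1 H1]]; destruct (HP (z - Ci * RtoC e)%C) as [r2 [Hr2 H2]].
  exists (Rmin r1 r2); split; [apply Rmin_pos; assumption|]; intros u [Hu|Hu] Hd.
  - apply H1; [exact Hu|eapply Rlt_le_trans; [exact Hd|apply Rmin_l]].
  - assert (u - Ci * RtoC e = z - Ci * RtoC e)%C as E.
    { apply H2; [exact Hu|]; replace (u - Ci * RtoC e - (z - Ci * RtoC e))%C with (u - z)%C by ring.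
      eapply Rlt_le_trans; [exact Hd|apply Rmin_r]. }
    replace u with (u - Ci * RtoC e + Ci * RtoC e)%C by ring; rewrite E; ring.
Qed.

Theorem gamma_shift z : ~ P z -> ~ P (z - Ci * RtoC e)%C ->
  Gx z = (two_cosh c e z * Gx (z - Ci * RtoC e))%C.
Proof.
  intros H1 H2.
  destruct hG as [_ [_ Hdiff]].
  assert (Gx z - two_cosh c e z * Gx (z - Ci * RtoC e) = 0)%C as E.
  { apply (identity_off_discrete (fun z => Gx z - two_cosh c e z * Gx (z - Ci * RtoC e))%C Q ((e -
      c) / 2) ((e + c) / 2)).
    - pose proof Hc; lra.
    - exact Q_discrete.
    - intros u Hu; apply not_or_and in Hu; destruct Hu as [Hu1 Hu2].
      apply Cdiff_minus; [apply ex_derive_Cdiff, Hdiff, Hu1|apply Cdiff_mult].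
      + assert (Cdiff (fun z => RtoC PI * (z - Ci * RtoC (e / 2)) / RtoC c)%C u) as Dw.
        { apply Cdiff_mult; [|apply Cdiff_const]; apply Cdiff_mult; [apply Cdiff_const|].
          apply Cdiff_minus; [apply Cdiff_id|apply Cdiff_const]. }
        apply Cdiff_plus; apply (Cdiff_comp Cexp).
        * apply Cexp_diff.
        * exact Dw.
        * apply Cexp_diff.
        * apply Cdiff_opp, Dw.
      + apply (Cdiff_comp Gx (fun z => z - Ci * RtoC e)%C); [apply ex_derive_Cdiff, Hdiff, Hu2|].
        apply Cdiff_minus; [apply Cdiff_id|apply Cdiff_const].
    - intros t Ht; rewrite (axis_equation t Ht).
      replace ((0, t) - Ci * RtoC e)%C with ((0, t - e) : C); [ring|].
      unfold Ci, RtoC, Cmult, Cminus, Cplus, Copp; simpl; f_equal; ring.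
    - intros [H|H]; [apply H1, H|apply H2, H]. }
  replace (Gx z) with ((Gx z - two_cosh c e z * Gx (z - Ci * RtoC e)) + two_cosh c e z * Gx (z - Ci
    * RtoC e))%C by ring.
  rewrite E; ring.
Qed.
End FunctionalEquation.

(** * The difference equation in exponential coordinates *)

Lemma Csinh_two (z : C) : (RtoC 2 * Csinh z)%C = (Cexp z - Cexp (- z))%C.
Proof. unfold Csinh; field; intros E; injection E; lra. Qed.

Lemma Cexp_opp_mult (z : C) : (Cexp z * Cexp (- z))%C = RtoC 1.
Proof.
  rewrite <- Cexp_plus; replace (z + - z)%C with (RtoC 0) by ring.
  unfold Cexp, RtoC; simpl; rewrite exp_0, cos_0, sin_0; f_equal; ring.
Qed.

Lemma Cexp_neq0 (z : C) : Cexp z <> RtoC 0.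
Proof.
  intros E; pose proof (Cexp_opp_mult z) as H; rewrite E, Cmult_0_l in H; injection H; lra.
Qed.

Lemma Cexp_opp (z : C) : Cexp (- z) = (/ Cexp z)%C.
Proof.
  pose proof (Cexp_neq0 z) as H; pose proof (Cexp_opp_mult z) as E.
  replace (Cexp (- z)) with (/ Cexp z * (Cexp z * Cexp (- z)))%C by (field; exact H).
  rewrite E; ring.
Qed.

Lemma Cexp_minus (u v : C) : Cexp (u - v) = (Cexp u / Cexp v)%C.
Proof. unfold Cminus; rewrite Cexp_plus, Cexp_opp; reflexivity. Qed.

Lemma Cexp_diff_quotients (u v : C) :
  (Cexp (u - v) - Cexp (- (u - v)))%C = (Cexp u / Cexp v - Cexp v / Cexp u)%C.
Proof.
  replace (- (u - v))%C with (v - u)%C by ring; rewrite !Cexp_minus; reflexivity.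
Qed.

(** Half of [diff_shift]. Adding it to [w] absorbs the phase in [two_cosh], so that the factor
    becomes [X / Y + Y / X], symmetric under the exchange of the two families. *)
Definition half_shift (e : R) (sgn : bool) : C := (Ci * RtoC ((if sgn then 1 else -1) * e / 2))%C.

Definition expo (c : R) (z : C) : C := Cexp (RtoC PI * z / RtoC c).

(** The common offset [s] cancels; it is 0 for the [v] variables and [half_shift] for the [w]
    variables. *)
Lemma two_sdelta ap am d (x y s : C) :
  0 < adelta ap am d ->
  (RtoC 2 * sdelta ap am d (x - y))%C =
  (expo (adelta ap am d) (x + s) / expo (adelta ap am d) (y + s) -
   expo (adelta ap am d) (y + s) / expo (adelta ap am d) (x + s))%C.
Proof.
  intros Hc; unfold sdelta, expo; rewrite Csinh_two, <- Cexp_diff_quotients.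
  assert (RtoC (adelta ap am d) <> RtoC 0) by (intros E; injection E; lra).
  replace (RtoC PI * (x - y) / RtoC (adelta ap am d))%C with
    (RtoC PI * (x + s) / RtoC (adelta ap am d) - RtoC PI * (y + s) / RtoC (adelta ap am d))%C by
      (field; assumption).
  reflexivity.
Qed.

Lemma two_cosh_expo c e (x y : C) : 0 < c ->
  two_cosh c e (x - y) =
  (expo c x / expo c (y + Ci * RtoC (e / 2)) + expo c (y + Ci * RtoC (e / 2)) / expo c x)%C.
Proof.
  intros Hc; unfold two_cosh, expo.
  assert (RtoC c <> RtoC 0) by (intros E; injection E; lra).
  rewrite <- !Cexp_minus; f_equal; f_equal; field; assumption.
Qed.

Lemma gamma_shift_expo ap am (hap : 0 < ap) (ham : 0 < am) Gx P (hG : hyperbolic_gamma_ext ap am Gx P)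
  (sgn d : bool) (x y : C) :
  ~ P (x - y)%C -> ~ P (x - y - diff_shift ap am sgn d)%C ->
  let c := adelta ap am d in
  let y' := (y + half_shift (adelta ap am (negb d)) sgn)%C in
  let q := (expo c x / expo c y' + expo c y' / expo c x)%C in
  if sgn then Gx (x - y)%C = (q * Gx (x - y - diff_shift ap am sgn d))%C
  else Gx (x - y - diff_shift ap am sgn d)%C = (q * Gx (x - y))%C.
Proof.
  intros H1 H2 c y' q; set (e := adelta ap am (negb d)) in *.
  assert (0 < c) as Hc by (unfold c, adelta; destruct d; assumption).
  assert (0 < e) as He by (unfold e, adelta; destruct d; assumption).
  destruct sgn; unfold diff_shift in *; fold e in H2 |- *.
  - assert (Ci * RtoC (1 * e) = Ci * RtoC e)%C as E by (rewrite Rmult_1_l; reflexivity).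
    rewrite E in *.
    rewrite (gamma_shift ap am Gx P d hap ham hG (x - y)%C H1 H2) at 1; fold c e; f_equal.
    rewrite two_cosh_expo by exact Hc; unfold q, y', half_shift; rewrite Rmult_1_l; reflexivity.
  (* For the other sign the equation is used at the shifted point, one step above [x - y], so the
     two nonpole hypotheses exchange roles. *)
  - assert (x - y - Ci * RtoC (-1 * e) - Ci * RtoC e = x - y)%C as E.
    { rewrite RtoC_mult; replace (RtoC (-1)) with (- RtoC 1)%C by (rewrite <- RtoC_opp;
        reflexivity); ring. }
    rewrite (gamma_shift ap am Gx P d hap ham hG (x - y - Ci * RtoC (-1 * e))%C H2) at 1; fold c e;
      rewrite E; [f_equal|exact H1].
    replace (x - y - Ci * RtoC (-1 * e))%C with (x - (y + Ci * RtoC (-1 * e)))%C by ring.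
    rewrite two_cosh_expo by exact Hc; unfold q, y', half_shift.
    replace (y + Ci * RtoC (-1 * e) + Ci * RtoC (e / 2))%C with (y + Ci * RtoC (-1 * e / 2))%C;
      [reflexivity|].
    replace (-1 * e / 2) with (-1 * e + e / 2) by field; rewrite RtoC_plus; ring.
Qed.

Lemma Ci_neg (e : R) : (Ci * RtoC (-1 * e))%C = (- (Ci * RtoC e))%C.
Proof. replace (-1 * e) with (- e) by ring; rewrite RtoC_opp; ring. Qed.


From HB Require Import structures.
From mathcomp Require Import ssreflect ssrfun ssrbool eqtype ssrnat seq
  choice fintype finfun bigop finset.
From mathcomp Require all_boot all_algebra ring zify.

(** * The rational duality identity *)

Module KernelDuality.
Import all_boot all_algebra ring zify.
Set Implicit Arguments.
Unset Strict Implicit.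
Unset Printing Implicit Defensive.
Import GRing.Theory.
Local Open Scope ring_scope.

Section SubsetSums.
Variable K : fieldType.

(** One side of the identity in the variables [x = X^2], [t = - Y^2], without monomial factors. [A]
    and [B] are subsets so that the induction can remove one element from each. *)
Definition subset_sum (S T : finType) (A : {set S}) (B : {set T})
    (x : S -> K) (t : T -> K) (r : nat) : K :=
  \sum_(J : {set S} | (J \subset A) && (#|J| == r)) \prod_(j in J)
    ((\prod_(l in B) (x j - t l)) * \prod_(i in A :\: J) (x i / (x i - x j))).

Lemma eq_subset_sum (S T : finType) (A : {set S}) (B : {set T}) x x' t t' r :
  {in A, x =1 x'} -> {in B, t =1 t'} ->
  subset_sum A B x t r = subset_sum A B x' t' r.
Proof.
move=> ex et; apply: eq_bigr => J /andP[/subsetP JA _].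
apply: eq_bigr => j jJ; rewrite (ex _ (JA _ jJ)); congr (_ * _).
  by apply: eq_bigr => l lB; rewrite et.
by apply: eq_bigr => i; rewrite inE => /andP[_ iA]; rewrite (ex _ iA).
Qed.

Lemma subset_sum0 (S T : finType) (A : {set S}) (B : {set T}) x t :
  subset_sum A B x t 0 = 1.
Proof.
rewrite /subset_sum (big_pred1 set0) ?big_set0 // => J.
by rewrite cards_eq0 /=; case: eqP => [->|]; rewrite ?sub0set ?andbF.
Qed.

Lemma subset_sum_full (S T : finType) (A : {set S}) (B : {set T}) x t :
  subset_sum A B x t #|A| = \prod_(j in A) \prod_(l in B) (x j - t l).
Proof.
rewrite /subset_sum (big_pred1 A) => [|J] /=.
  by apply: eq_bigr => j _; rewrite setDv big_set0 mulr1.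
by rewrite eqEcard; case: (boolP (J \subset A)) => //= /subset_leq_card; rewrite eqn_leq => ->.
Qed.

Lemma sum_subsets_split (S : finType) (A : {set S}) a r (w : {set S} -> K) :
  a \in A ->
  \sum_(J : {set S} | (J \subset A) && (#|J| == r.+1)) w J =
  \sum_(J : {set S} | (J \subset A :\ a) && (#|J| == r.+1)) w J +
  \sum_(J : {set S} | (J \subset A :\ a) && (#|J| == r)) w (a |: J).
Proof.
move=> aA; rewrite (bigID (fun J : {set S} => a \in J)) /= addrC; congr (_ + _).
  by apply: eq_bigl => J; rewrite subsetD1 andbAC.
rewrite (reindex_onto (fun J => a |: J) (fun J => J :\ a)) /=; last first.
  by move=> J /andP[_ aJ]; rewrite setD1K.
apply: eq_bigl => J; rewrite subsetD1 subUset sub1set aA setU11 andbT /=.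
have [aJ|aJ] := boolP (a \in J); last by rewrite cardsU1 aJ setU1K // eqxx !andbT.
suff -> : ((a |: J) :\ a == J) = false by rewrite !andbF.
by apply/eqP => JE; move: aJ; rewrite -JE !inE eqxx.
Qed.

(** Subsets containing [a] contribute nothing because of the factor [x a - t b]. In the others each
    [j] has the extra factor [(x j - t b) x a / (x a - x j)], which is [- x a]. *)
Lemma subset_sum_reduce (S T : finType) (A : {set S}) (B : {set T}) x t r a b :
  a \in A -> b \in B -> x a = t b -> {in A &, injective x} ->
  subset_sum A B x t r = (- x a) ^+ r * subset_sum (A :\ a) (B :\ b) x t r.
Proof.
move=> aA bB xt injx; rewrite /subset_sum (bigID (fun J : {set S} => a \in J)) /=.
rewrite big1 ?add0r => [|J /andP[_ aJ]]; last first.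
  by rewrite (bigD1 a) //= (bigD1 b) //= xt subrr !mul0r.
rewrite mulr_sumr; apply: eq_big => [J|J]; first by rewrite subsetD1 andbAC.
case/andP=> /andP[JA /eqP <-] aJ; rewrite -prodr_const -big_split /=.
apply: eq_bigr => j jJ; rewrite (bigD1 b) //= (bigD1 a) /=; last by rewrite inE aJ.
have -> : \prod_(l in B | l != b) (x j - t l) = \prod_(l in B :\ b) (x j - t l).
  by apply: eq_bigl => l; rewrite !inE andbC.
have -> : \prod_(i in A :\: J | i != a) (x i / (x i - x j)) =
          \prod_(i in A :\ a :\: J) (x i / (x i - x j)).
  by apply: eq_bigl => i; rewrite !inE; case: (i \in A); case: (i \in J); case: (i != a).
have ne : x a - x j != 0.
  rewrite subr_eq0; apply: contraNneq aJ => /injx -> //; exact: (subsetP JA).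
rewrite -xt; field; exact: ne.
Qed.

Lemma horner_prodXsubC (U : finType) (J : {set U}) (f : U -> K) y :
  (\prod_(i in J) ('X - (f i)%:P)).[y] = \prod_(i in J) (y - f i).
Proof. by rewrite horner_prod; under eq_bigr do rewrite hornerXsubC. Qed.

(** * The subset sum as a polynomial in one variable *)

Section OneVariable.
Variables (S T : finType) (A : {set S}) (B : {set T}) (x : S -> K) (t : T -> K).
Variables (s : nat) (a : S).
Hypotheses (aA : a \in A) (injx : {in A :\ a &, injective x}).

Let A' := A :\ a.
Let c (J : {set S}) := \prod_(j in J) ((\prod_(l in B) (x j - t l)) *
   \prod_(i in A' :\: J) (x i / (x i - x j))).

(** The subset sum in ['X = x a], multiplied by the product of the ['X - x i] over the other [i].
    The first sum collects the subsets without [a], the second those with [a], where [J] is the rest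
    of the subset. *)
Definition cleared : {poly K} :=
  \sum_(J : {set S} | (J \subset A') && (#|J| == s.+1))
    c J *: ('X^(s.+1) * \prod_(i in A' :\: J) ('X - (x i)%:P)) +
  \sum_(J : {set S} | (J \subset A') && (#|J| == s))
    (c J * \prod_(i in A' :\: J) (- x i)) *:
      (\prod_(l in B) ('X - (t l)%:P) * \prod_(j in J) ('X - (x j)%:P)).

Let prod_split (J : {set S}) (f : S -> K) : J \subset A' ->
  \prod_(i in A') f i = \prod_(i in J) f i * \prod_(i in A' :\: J) f i.
Proof. by move=> JA; rewrite (big_setID J) /= (setIidPr JA). Qed.

Lemma cleared_eval y : {in A', forall i, x i != y} ->
  cleared.[y] = (\prod_(i in A') (y - x i)) *
    subset_sum A B (fun i => if i == a then y else x i) t s.+1.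
Proof.
move=> yA; rewrite /subset_sum (sum_subsets_split _ _ aA) -/A' mulrDr hornerD.
rewrite !horner_sum !mulr_sumr.
have nA i : i \in A' -> (i == a) = false by rewrite !inE => /andP[/negbTE].
congr (_ + _); apply: eq_bigr => J /andP[JA /eqP cJ].
- rewrite hornerZ hornerM hornerXn horner_prodXsubC (prod_split _ JA) -cJ -prodr_const.
  have aJ : a \notin J by move: JA; rewrite subsetD1 => /andP[].
  rewrite [RHS]mulrAC  mulrA.
  congr (_ * _); rewrite /c -!big_split /=; apply: eq_bigr => j jJ.
  have jA := subsetP JA _ jJ.
  rewrite nA // [in RHS](bigD1 a) /=; last by rewrite inE aJ.
  rewrite eqxx.
  have -> : \prod_(i in A :\: J | i != a)
      ((if i == a then y else x i) / ((if i == a then y else x i) - x j)) =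
      \prod_(i in A' :\: J) (x i / (x i - x j)).
    apply: eq_big => i; first by rewrite !inE; case: (i \in A); case: (i \in J); case: (i == a).
    by case/andP=> _ /negbTE ->.
  have ne : y - x j != 0 by rewrite subr_eq0 eq_sym yA.
  by field; exact: ne.
- have aJ : a \notin J by move: JA; rewrite subsetD1 => /andP[].
  rewrite hornerZ hornerM !horner_prodXsubC (prod_split _ JA) (big_setU1 _ aJ) /= eqxx.
  have -> : A :\: (a |: J) = A' :\: J by rewrite -setDDl.
  have -> : \prod_(j in J) ((\prod_(l in B) ((if j == a then y else x j) - t l)) *
     \prod_(i in A' :\: J) ((if i == a then y else x i) /
        ((if i == a then y else x i) - (if j == a then y else x j)))) = c J.
    apply: eq_bigr => j jJ; rewrite (nA j) ?(subsetP JA) //; congr (_ * _).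
    by apply: eq_bigr => i; rewrite inE => /andP[_ iA]; rewrite nA.
  have -> : \prod_(i in A' :\: J) ((if i == a then y else x i) /
        ((if i == a then y else x i) - y)) =
      \prod_(i in A' :\: J) (- x i) / \prod_(i in A' :\: J) (y - x i).
    rewrite -prodf_div; apply: eq_bigr => i; rewrite inE => /andP[_ iA].
    by rewrite nA // -[x i - y]opprB invrN mulrN mulNr.
  have ne : \prod_(i in A' :\: J) (y - x i) != 0.
    by apply/prodf_neq0 => i; rewrite inE => /andP[_ iA]; rewrite subr_eq0 eq_sym yA.
  by field; exact: ne.
Qed.

(** The apparent pole at [x a = x m] cancels. In the first sum only subsets containing [m] survive,
    in the second only those avoiding it; the terms of [m |: J] and of [J] are opposite. *)
Lemma cleared_root m : m \in A' -> cleared.[x m] = 0.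
Proof.
move=> mA; rewrite /cleared hornerD !horner_sum (sum_subsets_split _ _ mA).
rewrite big1 ?add0r => [|J /andP[]]; last first.
  rewrite subsetD1 => /andP[JA mJ] _; rewrite hornerZ hornerM horner_prodXsubC.
  have mD : m \in A' :\: J by rewrite inE mJ mA.
  by rewrite (bigD1 m mD) /= subrr mul0r !mulr0.
rewrite [X in _ + X](bigID (fun J : {set S} => m \in J)) /=.
rewrite [X in _ + (X + _)]big1 ?add0r => [|J /andP[_ mJ]]; last first.
  rewrite hornerZ hornerM !horner_prodXsubC.
  by rewrite [\prod_(i in J) (_ - _)](bigD1 m mJ) /= subrr mul0r !mulr0.
have -> : forall w : {set S} -> K,
   \sum_(J : {set S} | (J \subset A') && (#|J| == s) && (m \notin J)) w J =
   \sum_(J : {set S} | (J \subset A' :\ m) && (#|J| == s)) w J.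
  by move=> w; apply: eq_bigl => J; rewrite subsetD1 andbAC.
rewrite -big_split big1 //= => J /andP[]; rewrite subsetD1 => /andP[JA mJ] /eqP cJ.
rewrite !(hornerZ, hornerM) hornerXn !horner_prodXsubC /c (big_setU1 _ mJ) /=.
set q := \prod_(l in B) (x m - t l).
have -> : A' :\: (m |: J) = A' :\ m :\: J by rewrite -setDDl.
have -> : A' :\: J = m |: (A' :\ m :\: J).
  apply/setP => i; rewrite !in_setU1 !in_setD !in_set1.
  by case: (i =P m) => [->|//]; rewrite mJ; move: mA; rewrite !inE.
have mD : m \notin A' :\ m :\: J by rewrite !inE eqxx andbF.
rewrite (big_setU1 _ mD) /=.
rewrite -/q.
have -> : \prod_(j in J) (\prod_(l in B) (x j - t l) *
     \prod_(i in m |: A' :\ m :\: J) (x i / (x i - x j))) =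
   \prod_(j in J) (\prod_(l in B) (x j - t l) *
     \prod_(i in A' :\ m :\: J) (x i / (x i - x j))) *
   (x m ^+ s / \prod_(j in J) (x m - x j)).
  rewrite -cJ -prodr_const -prodf_div -big_split /=; apply: eq_bigr => j _.
  by rewrite (big_setU1 _ mD) /= mulrCA mulrC.
have -> : \prod_(i in A' :\ m :\: J) (x i / (x i - x m)) =
   \prod_(i in A' :\ m :\: J) (- x i) / \prod_(i in A' :\ m :\: J) (x m - x i).
  rewrite -prodf_div; apply: eq_bigr => i _.
  by rewrite -[x i - x m]opprB invrN mulrN mulNr.
have ne1 : \prod_(i in A' :\ m :\: J) (x m - x i) != 0.
  apply/prodf_neq0 => i; rewrite inE => /andP[_]; rewrite in_setD1 => /andP[im iA].
  rewrite subr_eq0; apply: contra im => /eqP xmi; apply/eqP.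
  by apply: injx.
have ne2 : \prod_(j in J) (x m - x j) != 0.
  apply/prodf_neq0 => i iJ.
  rewrite subr_eq0; apply: contra mJ => /eqP xmi.
  by have -> : m = i by apply: injx => //; exact: (subsetP JA).
by rewrite exprS; field; rewrite ?ne1 ?ne2.
Qed.

Lemma size_prod_set_XsubC (U : finType) (J : {set U}) (f : U -> K) :
  size (\prod_(i in J) ('X - (f i)%:P)) = #|J|.+1.
Proof. by rewrite -big_enum /= size_prod_XsubC -cardE. Qed.

Lemma size_cleared : #|A| = #|B| -> (s < #|A|)%N ->
  (size cleared <= #|A| + s.+1)%N.
Proof.
move=> AB sA; have A1 : #|A| = #|A'|.+1 by rewrite (cardsD1 a) aA.
rewrite /cleared (leq_trans (size_polyD _ _)) // geq_max.
apply/andP; split; apply: (leq_trans (size_sum _ _ _));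
  apply/bigmax_leqP => J /andP[JA /eqP cJ]; apply: (leq_trans (size_scale_leq _ _)).
- rewrite mulrC size_mulXn -?size_poly_gt0 ?size_prod_set_XsubC //.
  rewrite cardsD (setIidPr JA) cJ A1.
  by rewrite -[X in (_ <= X)%N]addnC leq_add2l; rewrite ltnS leq_subr.
- rewrite (leq_trans (size_polyMleq _ _)) // !size_prod_set_XsubC cJ AB.
  by rewrite addSn /= addnS.
Qed.
End OneVariable.

Lemma subset_sum_duality (n r : nat) : (r <= n)%N ->
  forall (S T : finType) (A : {set S}) (B : {set T}) (x : S -> K) (t : T -> K),
  #|A| = n -> #|B| = n -> {in A &, injective x} -> {in B &, injective t} ->
  subset_sum A B x t r = (-1) ^+ r * subset_sum B A t x r.
Proof.
elim: n r => [|n IH] r rn S T A B x t cA cB injx injt.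
  by move: rn; rewrite leqn0 => /eqP ->; rewrite !subset_sum0 expr0 mulr1.
move: rn; rewrite leq_eqVlt => /orP[/eqP rE|]; last rewrite ltnS => rn.
  (* For the full subset both sides are the same double product up to sign, and
     [(-1)^(n^2) = (-1)^n]. This case is outside the reach of the induction hypothesis for smaller
     sets. *)
  rewrite rE -{1}cA subset_sum_full -{2}cB subset_sum_full exchange_big /=.
  under eq_bigr => l _ do under eq_bigr => j _ do rewrite -opprB.
  under eq_bigr => l _ do rewrite prodrN.
  rewrite big_split /= prodr_const cA cB -exprM; congr (_ * _).
  by rewrite -[LHS]signr_odd oddM andbb signr_odd.
case: r rn => [|s] rn; first by rewrite !subset_sum0 expr0 mulr1.
(* Stated for arbitrary values, as it serves both an actual coincidence [x a = t b] and the
   evaluation of the polynomials at a point [t l]. *)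
have reduced (x' : S -> K) (t' : T -> K) a b : a \in A -> b \in B -> x' a = t' b ->
    {in A &, injective x'} -> {in B &, injective t'} ->
    subset_sum A B x' t' s.+1 = (-1) ^+ s.+1 * subset_sum B A t' x' s.+1.
  move=> aA bB xt ix it; rewrite (subset_sum_reduce _ aA bB) //.
  rewrite (subset_sum_reduce _ bB aA) // mulrCA xt; congr (_ * _); apply: IH => //.
  - by move: cA; rewrite (cardsD1 a) aA => -[].
  - by move: cB; rewrite (cardsD1 b) bB => -[].
  - by move=> i j; rewrite !inE => /andP[_ iA] /andP[_ jA]; apply: ix.
  - by move=> i j; rewrite !inE => /andP[_ iA] /andP[_ jA]; apply: it.
have [/existsP[a /existsP[b /and3P[aA bB /eqP xt]]]|/existsPn disj] :=
  boolP [exists a, exists b, [&& a \in A, b \in B & x a == t b]].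
  exact: reduced xt _ _.
have {}disj i l : i \in A -> l \in B -> x i != t l.
  by move=> iA lB; move: (disj i) => /existsPn/(_ l); rewrite iA lB.
have /card_gt0P[a aA] : (0 < #|A|)%N by rewrite cA.
have injx' : {in A :\ a &, injective x}.
  by move=> i j; rewrite !inE => /andP[_ iA] /andP[_ jA]; apply: injx.
pose Q := \prod_(i in A :\ a) ('X - (x i)%:P).
pose d (J : {set T}) := \prod_(j in J) ((\prod_(l in A :\ a) (t j - x l)) *
   \prod_(i in B :\: J) (t i / (t i - t j))).
(* The dual sum as a function of [x a]: no denominators involve [x a], and the degree is at most
   [s + 1]. *)
pose RP : {poly K} := \sum_(J : {set T} | (J \subset B) && (#|J| == s.+1))
   d J *: \prod_(j in J) (- ('X - (t j)%:P)).
have RPE y : RP.[y] = subset_sum B A t (fun i => if i == a then y else x i) s.+1.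
  rewrite horner_sum; apply: eq_bigr => J _.
  rewrite hornerZ horner_prod -big_split /=; apply: eq_bigr => j _.
  have -> : \prod_(l in A) (t j - (if l == a then y else x l)) =
            (t j - y) * \prod_(l in A :\ a) (t j - x l).
    rewrite (bigD1 a aA) /= eqxx; congr (_ * _).
    apply: eq_big => i; first by rewrite !inE andbC.
    by case/andP=> _ /negbTE ->.
  by rewrite !hornerE opprB; ring.
(* The difference of the two sides multiplied by [Q]. It suffices that this polynomial is zero,
   since [Q] does not vanish at [x a]. *)
pose Phi := cleared A B x t s a - (-1) ^+ s.+1 *: (Q * RP).
have QE y : Q.[y] = \prod_(i in A :\ a) (y - x i).
  exact: horner_prodXsubC.
have A1 : #|A :\ a| = n by move: cA; rewrite (cardsD1 a) aA => -[].
suff Phi0 : Phi = 0.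
  have ne : Q.[x a] != 0.
    rewrite QE; apply/prodf_neq0 => i; rewrite inE => /andP[ia iA].
    rewrite subr_eq0 eq_sym; apply: contra ia => /eqP/injx -> //; exact: set11.
  have xE : x =1 (fun i => if i == a then x a else x i) by move=> i; case: eqP => [->|].
  have : Phi.[x a] = 0 by rewrite Phi0 horner0.
  rewrite hornerD hornerN hornerZ hornerM RPE QE.
  rewrite (cleared_eval _ _ _ aA) => [|i iA]; last first.
    move: iA; rewrite inE => /andP[ia iA]; apply: contra ia => /eqP/injx -> //; exact: set11.
  rewrite -QE mulrCA -mulrBr => /eqP; rewrite mulf_eq0 (negbTE ne) subr_eq0 => /eqP E.
  rewrite (@eq_subset_sum _ _ A B _ _ t t _ (fun i _ => xE i)) // E; congr (_ * _).
  by apply: eq_subset_sum => // i _; rewrite -xE.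
(* [2 n + 1] roots, while [Phi] has size at most [n + s + 2 <= 2 n + 1] *)
pose rs := [seq t l | l <- enum B] ++ [seq x i | i <- enum (A :\ a)].
apply: (@roots_geq_poly_eq0 _ _ rs).
- rewrite all_cat; apply/andP; split; apply/allP => y /mapP[l]; rewrite mem_enum => lB ->; apply/rootP.
  + rewrite hornerD hornerN hornerZ hornerM RPE QE (cleared_eval _ _ _ aA) => [|i]; last first.
      by rewrite inE => /andP[_ iA]; apply: disj.
    rewrite mulrCA -mulrBr [X in _ * (X - _)](reduced _ _ a l) ?subrr ?mulr0 ?eqxx //.
    move=> i j iA jA; case: (i =P a) => [->|/eqP ia]; case: (j =P a) => [->|/eqP ja] //.
    * by move=> /eqP; rewrite eq_sym (negbTE (disj _ _ jA lB)).
    * by move=> /eqP; rewrite (negbTE (disj _ _ iA lB)).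
    * exact: injx.
  + rewrite hornerD hornerN hornerZ hornerM QE cleared_root // (bigD1 l) //= subrr !mul0r mulr0
      subr0 //.
- rewrite cat_uniq !map_inj_in_uniq ?enum_uniq /= ?andbT; last first.
  + by move=> i j; rewrite !mem_enum; apply: injt.
  + by move=> i j; rewrite !mem_enum; apply: injx'.
  apply/hasPn => y /mapP[i]; rewrite mem_enum inE => /andP[_ iA] ->.
  by apply/mapP => -[l]; rewrite mem_enum => lB; apply/eqP; apply: disj.
- rewrite size_cat !size_map -!cardE cB A1.
  apply: (@leq_trans (n.+1 + s.+1)); last by rewrite leq_add2l.
  rewrite (leq_trans (size_polyD _ _)) // geq_max -{1}cA size_cleared ?cA ?cB //=;
    last by rewrite ltnW.
  rewrite size_polyN (leq_trans (size_scale_leq _ _)) //.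
  rewrite (leq_trans (size_polyMleq _ _)) // size_prod_set_XsubC A1 addSn /= addSnnS leq_add2l.
  apply: (leq_trans (size_sum _ _ _)); apply/bigmax_leqP => J /andP[_ /eqP cJ].
  rewrite (leq_trans (size_scale_leq _ _)) //.
  rewrite prodrN -signr_odd mulr_sign; case: odd; by rewrite ?size_polyN size_prod_set_XsubC cJ.
Qed.
End SubsetSums.

(** * From the rational to the hyperbolic identity *)

Section HyperbolicForm.
Variable K : fieldType.

Lemma sign_mulB (k n : nat) : (k <= n)%N ->
  (-1) ^+ (k * (n - k)) = (-1) ^+ k * (-1) ^+ (k * n) :> K.
Proof.
move=> kn; rewrite -[LHS]signr_odd -exprD -[RHS]signr_odd oddD !oddM oddB //.
by case: (odd k); case: (odd n).
Qed.

Definition pair_weight (S : finType) (X : S -> K) (I : {set S}) : K :=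
  \prod_(m in I) \prod_(n in ~: I) (X m / X n - X n / X m)^-1.

Definition cross (S T : finType) (X : S -> K) (Y : T -> K) (j : S) : K :=
  \prod_(l : T) (X j / Y l + Y l / X j).

(** What remains when a shift multiplies the kernel entries by the hyperbolic factor: the unshifted
    kernel factors out. *)
Definition inner_sum (S T : finType) (X : S -> K) (Y : T -> K) (k : nat) : K :=
  \sum_(I : {set S} | #|I| == k) pair_weight X I * \prod_(j in I) cross X Y j.

(** The opposite direction: the fully shifted kernel factors out, and the variables left in place
    carry the factors. *)
Definition outer_sum (S T : finType) (X : S -> K) (Y : T -> K) (k : nat) : K :=
  \sum_(I : {set S} | #|I| == k) pair_weight X I * \prod_(j in ~: I) cross X Y j.

Lemma ratio_diff (a b : K) : a != 0 -> b != 0 ->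
  a / b - b / a = (a ^+ 2 - b ^+ 2) / (a * b).
Proof. by move=> a0 b0; field; rewrite a0 b0. Qed.

Section Rational.
Variables (S T : finType) (X : S -> K) (Y : T -> K) (k : nat).
Hypotheses (X0 : forall i, X i != 0) (Y0 : forall l, Y l != 0).
Hypothesis (X2 : forall i j, i != j -> X i / X j - X j / X i != 0).
Hypothesis (cST : #|S| = #|T|).

Lemma sqr_inj : injective (fun i => X i ^+ 2).
Proof.
move=> i j /eqP E; apply/eqP; apply: contraTT E => /X2.
by rewrite ratio_diff // mulf_eq0 subr_eq0 => /norP[].
Qed.

(** In squared variables each [j] in [J] leaves a monomial [X j ^ (|~: J| - |T|)] over the product
    of the [Y]'s and of the [X]'s outside [J]. As [#|S| = #|T|], the exponent is [- |J|], and the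
    total is independent of [J]; it is also symmetric in [X] and [Y], so it cancels in the
    duality. *)
Lemma inner_sumE :
  inner_sum X Y k * (\prod_i X i * \prod_l Y l) ^+ k =
  (-1) ^+ (k * (#|S| - k)) *
  subset_sum setT setT (fun i => X i ^+ 2) (fun l => - Y l ^+ 2) k.
Proof.
rewrite /inner_sum /subset_sum mulr_suml mulr_sumr.
apply: eq_big => [J|J /eqP cJ]; first by rewrite subsetT.
have cCJ : (#|S| - k)%N = #|~: J| by rewrite -cJ -(cardsC J) addKn.
have -> : (-1) ^+ (k * (#|S| - k)) = \prod_(j in J) \prod_(i in ~: J) (-1) :> K.
  by rewrite prodr_const prodr_const cJ -cCJ -exprM mulnC.
have -> : (\prod_i X i * \prod_l Y l) ^+ k =
   \prod_(j in J) (X j ^+ #|J| * \prod_(i in ~: J) X i * \prod_l Y l).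
  rewrite [RHS]big_split /= [X in _ = X * _]big_split /= !prodr_const cJ exprMn.
  congr (_ * _); rewrite prodrXl -cJ -exprMn; congr (_ ^+ _).
  rewrite (bigID (mem J)) /=; congr (_ * _).
  by apply: eq_bigl => i; rewrite inE.
rewrite /pair_weight -!big_split /=; apply: eq_bigr => j jJ.
have -> : cross X Y j = 
   \prod_(l in [set: T]) (X j ^+ 2 - - Y l ^+ 2) / (X j ^+ #|T| * \prod_l Y l).
  rewrite /cross (eq_bigl _ _ (in_setT (T:=T))) /= -prodr_const -big_split /= -prodf_div.
  apply: eq_bigr => l _; by field; rewrite X0 Y0.
have -> : \prod_(n in ~: J) (X j / X n - X n / X j)^-1 =
   \prod_(i in ~: J) (-1) * \prod_(i in [set: S] :\: J) (X i ^+ 2 / (X i ^+ 2 - X j ^+ 2)) *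
      (X j ^+ #|~: J| / \prod_(i in ~: J) X i).
  rewrite setTD -prodr_const -prodf_div -!big_split /=; apply: eq_bigr => i.
  rewrite inE => iJ; have ij : i != j by apply: contraNneq iJ => ->.
  have n1 : X i ^+ 2 - X j ^+ 2 != 0.
    by rewrite subr_eq0; apply: contra ij => /eqP/sqr_inj ->.
  have n2 : X j ^+ 2 - X i ^+ 2 != 0 by rewrite -opprB oppr_eq0.
  rewrite ratio_diff //; field; rewrite n1 n2 !X0 //.
rewrite -cST -(cardsC J) exprD.
have nX : \prod_(i in ~: J) X i != 0 by apply/prodf_neq0.
have nY : \prod_l Y l != 0 by apply/prodf_neq0.
field; rewrite nX nY ?X0 ?expf_neq0 //.
Qed.

(** Negating all variables leaves the ratios [x i / (x i - x j)] unchanged and flips each of the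
    [k * #|S|] factors [x j - t l]. *)
Lemma subset_sum_sign :
  subset_sum setT setT (fun i => - X i ^+ 2) (fun l => Y l ^+ 2) k =
  (-1) ^+ (k * #|S|) * subset_sum setT setT (fun i => X i ^+ 2) (fun l => - Y l ^+ 2) k.
Proof.
rewrite /subset_sum mulr_sumr; apply: eq_bigr => J /andP[_ /eqP cJ].
rewrite mulnC exprM -cJ -prodr_const -big_split /=; apply: eq_bigr => j jJ.
rewrite mulrA; congr (_ * _).
  rewrite cST -cardsT -prodrN; apply: eq_bigr => l _; ring.
apply: eq_bigr => i; rewrite !inE andbT => iJ.
have ij : i != j by apply: contraNneq iJ => ->.
have n1 : X i ^+ 2 - X j ^+ 2 != 0.
  by rewrite subr_eq0; apply: contra ij => /eqP/sqr_inj ->.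
have n2 : - X i ^+ 2 - - X j ^+ 2 != 0 by rewrite -opprD oppr_eq0.
by field; rewrite n1 n2.
Qed.

(** Replace each subset by its complement; each of the [k (|S| - k)] antisymmetric pair factors
    changes sign. *)
Lemma outer_sumE : (k <= #|S|)%N ->
  outer_sum X Y k = (-1) ^+ (k * (#|S| - k)) * inner_sum X Y (#|S| - k).
Proof.
move=> kS; rewrite /outer_sum /inner_sum (reindex_inj (inv_inj (@setCK S))) mulr_sumr /=.
have cC (J : {set S}) : (#|~: J| == k) = (#|J| == #|S| - k)%N.
  rewrite -(cardsC J) eqn_leq [RHS]eqn_leq; move: (cardsC J) kS => <-.
  move: #|J| #|~: J| => p q; lia.
apply: eq_big => [J|J cJ]; first exact: cC.
rewrite setCK mulrA; congr (_ * _).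
have -> : (-1) ^+ (k * (#|S| - k)) = \prod_(m in J) \prod_(n in ~: J) (-1) :> K.
  by rewrite prodr_const prodr_const (eqP cJ) -(eqP (etrans (esym (cC J)) cJ)) -exprM.
rewrite /pair_weight exchange_big setCK -big_split /=; apply: eq_bigr => m _.
rewrite -big_split /=; apply: eq_bigr => n _.
by rewrite mulN1r -invrN opprB.
Qed.
End Rational.

Theorem inner_sum_duality (S T : finType) (X : S -> K) (Y : T -> K) (k : nat) :
  (forall i, X i != 0) -> (forall l, Y l != 0) ->
  (forall i j, i != j -> X i / X j - X j / X i != 0) ->
  (forall i j, i != j -> Y i / Y j - Y j / Y i != 0) ->
  #|S| = #|T| -> (k <= #|S|)%N ->
  inner_sum X Y k = (-1) ^+ (k * (#|S| - k)) * inner_sum Y X k.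
Proof.
move=> X0 Y0 X2 Y2 cST kS.
have ne : (\prod_i X i * \prod_l Y l) ^+ k != 0.
  by rewrite expf_neq0 // mulf_neq0 //; apply/prodf_neq0.
apply: (mulIf ne); rewrite inner_sumE // -mulrA [X in _ = _ * (_ * X ^+ _)]mulrC inner_sumE //.
rewrite (@subset_sum_duality _ _ _ kS _ _ setT setT) ?cardsT ?cST //; first last.
- by move=> i j _ _ /oppr_inj; apply: sqr_inj.
- by move=> i j _ _; apply: sqr_inj.
rewrite subset_sum_sign // -cST.
by congr (_ * _); rewrite sign_mulB // -mulrA.
Qed.

Theorem outer_sum_duality (S T : finType) (X : S -> K) (Y : T -> K) (k : nat) :
  (forall i, X i != 0) -> (forall l, Y l != 0) ->
  (forall i j, i != j -> X i / X j - X j / X i != 0) ->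
  (forall i j, i != j -> Y i / Y j - Y j / Y i != 0) ->
  #|S| = #|T| -> (k <= #|S|)%N ->
  outer_sum X Y k = (-1) ^+ (k * (#|S| - k)) * outer_sum Y X k.
Proof.
move=> X0 Y0 X2 Y2 cST kS.
rewrite !outer_sumE -?cST // inner_sum_duality ?leq_subr // subKn //.
by rewrite [((#|S| - k) * k)%N]mulnC.
Qed.
End HyperbolicForm.

Section KernelDuality.
Variables (K : fieldType) (S T : finType) (X : S -> K) (Y : T -> K) (k : nat).
Hypotheses (X0 : forall i, X i != 0) (Y0 : forall l, Y l != 0).
Hypothesis (X2 : forall i j, i != j -> X i / X j - X j / X i != 0).
Hypothesis (Y2 : forall i j, i != j -> Y i / Y j - Y j / Y i != 0).
Hypotheses (cST : #|S| = #|T|) (kS : (k <= #|S|)%N).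

Lemma crossC (U V : finType) (x : U -> K) (y : V -> K) (l : V) :
  cross y x l = \prod_(j : U) (x j / y l + y l / x j).
Proof. by apply: eq_bigr => j _; rewrite addrC. Qed.

Lemma prod_if_in (U : finType) (I : {set U}) (f g h : U -> K) :
  (forall j, f j = h j * g j) ->
  \prod_j (if j \in I then f j else g j) = \prod_j g j * \prod_(j in I) h j.
Proof.
move=> fE; rewrite [X in _ = _ * X]big_mkcond /= -big_split /=; apply: eq_bigr => j _.
by case: ifP => _; rewrite ?mulr1 // fE mulrC.
Qed.

Lemma prod_if_notin (U : finType) (I : {set U}) (f g h : U -> K) :
  (forall j, g j = h j * f j) ->
  \prod_j (if j \in I then f j else g j) = \prod_j f j * \prod_(j in ~: I) h j.
Proof.
move=> gE; rewrite -(prod_if_in _ gE); apply: eq_bigr => j _.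
by rewrite inE; case: (j \in I).
Qed.

(** [a] holds the unshifted and [b] the shifted kernel entries; the same [b] serves rows and
    columns. The flag [s] tells which one is a multiple of the other, hence whether [outer_sum] or
    [inner_sum] arises. *)
Theorem kernel_duality (a b : S -> T -> K) (s : bool) :
  (forall j l, if s then a j l = (X j / Y l + Y l / X j) * b j l
               else b j l = (X j / Y l + Y l / X j) * a j l) ->
  \sum_(I : {set S} | #|I| == k) pair_weight X I *
     \prod_j \prod_l (if j \in I then b j l else a j l) =
  (-1) ^+ (k * (#|S| - k)) *
  \sum_(J : {set T} | #|J| == k) pair_weight Y J *
     \prod_j \prod_l (if l \in J then b j l else a j l).
Proof.
case: s => ab.
- transitivity (outer_sum X Y k * \prod_j \prod_l b j l).
    rewrite mulr_suml; apply: eq_bigr => I _; rewrite -mulrA [X in _ = _ * X]mulrC.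
    rewrite -(@prod_if_notin _ _ _ (fun j => \prod_l a j l) _) => [|j].
      by congr (_ * _); apply: eq_bigr => j _; case: (j \in I).
    by rewrite -big_split; apply: eq_bigr.
  rewrite outer_sum_duality // -mulrA; congr (_ * _).
  rewrite mulr_suml; apply: eq_bigr => J _; rewrite -mulrA; congr (_ * _).
  rewrite [X in _ * X]exchange_big [RHS]exchange_big /= mulrC.
  rewrite -(@prod_if_notin _ _ _ (fun l => \prod_j a j l) _) => [|l].
    by apply: eq_bigr => l _; case: (l \in J).
  by rewrite crossC -big_split; apply: eq_bigr => j _.
- transitivity (inner_sum X Y k * \prod_j \prod_l a j l).
    rewrite mulr_suml; apply: eq_bigr => I _; rewrite -mulrA [X in _ = _ * X]mulrC.
    rewrite -(@prod_if_in _ _ (fun j => \prod_l b j l) _ _) => [|j].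
      by congr (_ * _); apply: eq_bigr => j _; case: (j \in I).
    by rewrite -big_split; apply: eq_bigr.
  rewrite inner_sum_duality // -mulrA; congr (_ * _).
  rewrite mulr_suml; apply: eq_bigr => J _; rewrite -mulrA; congr (_ * _).
  rewrite [X in _ * X]exchange_big [RHS]exchange_big /= mulrC.
  rewrite -(@prod_if_in _ _ (fun l => \prod_j b j l) _ _) => [|l].
    by apply: eq_bigr => l _; case: (l \in J).
  by rewrite crossC -big_split; apply: eq_bigr => j _.
Qed.
End KernelDuality.

End KernelDuality.

(** * The kernel identity *)

Module ComplexField.
Import ssralg GRing.Theory.

(** An alias carrying the field structure. Its operations are by definition those on [C], so the
    duality applies up to conversion. *)
Definition CF : Type := C.

Definition CF_eqb (x y : CF) : bool := if excluded_middle_informative (x = y) then true else false.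

Lemma CF_eqP : Equality.axiom CF_eqb.
Proof.
by move=> x y; rewrite /CF_eqb; case: excluded_middle_informative => E; constructor.
Qed.
HB.instance Definition _ := hasDecEq.Build CF CF_eqP.

Definition CF_find (P : pred CF) (n : nat) : option CF :=
  if excluded_middle_informative (exists x, P x)
  then Some (epsilon (inhabits (RtoC 0)) (fun x => P x)) else None.

Lemma CF_find_correct (P : pred CF) n x : CF_find P n = Some x -> P x.
Proof.
rewrite /CF_find; case: excluded_middle_informative => // H [<-].
exact: (epsilon_spec (inhabits (RtoC 0)) (fun x => P x) H).
Qed.

Lemma CF_find_complete (P : pred CF) : (exists x, P x) -> exists n, CF_find P n.
Proof. by move=> H; exists 0%N; rewrite /CF_find; case: excluded_middle_informative. Qed.

Lemma CF_find_ext (P Q : pred CF) : P =1 Q -> CF_find P =1 CF_find Q.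
Proof.
move=> E n; have -> : P = Q by apply: functional_extensionality.
by [].
Qed.
HB.instance Definition _ := hasChoice.Build CF CF_find_correct CF_find_complete CF_find_ext.

Lemma CF_addA : associative (Cplus : CF -> CF -> CF). Proof. exact: Cplus_assoc. Qed.
Lemma CF_addC : commutative (Cplus : CF -> CF -> CF). Proof. exact: Cplus_comm. Qed.
Lemma CF_add0 : left_id (RtoC 0 : CF) (Cplus : CF -> CF -> CF). Proof. exact: Cplus_0_l. Qed.
Lemma CF_addN : left_inverse (RtoC 0 : CF) (Copp : CF -> CF) Cplus.
Proof. by move=> x; rewrite CF_addC; apply: Cplus_opp_r. Qed.
HB.instance Definition _ := GRing.isZmodule.Build CF CF_addA CF_addC CF_add0 CF_addN.

Lemma CF_mulA : associative (Cmult : CF -> CF -> CF). Proof. exact: Cmult_assoc. Qed.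
Lemma CF_mulC : commutative (Cmult : CF -> CF -> CF). Proof. exact: Cmult_comm. Qed.
Lemma CF_mul1 : left_id (RtoC 1 : CF) (Cmult : CF -> CF -> CF). Proof. exact: Cmult_1_l. Qed.
Lemma CF_mulD : left_distributive (Cmult : CF -> CF -> CF) Cplus.
Proof. by move=> x y z; apply: Cmult_plus_distr_r. Qed.
Lemma CF_1neq0 : (RtoC 1 : CF) != RtoC 0.
Proof. by apply/eqP => -[]; apply: R1_neq_R0. Qed.
HB.instance Definition _ :=
  GRing.Zmodule_isComNzRing.Build CF CF_mulA CF_mulC CF_mul1 CF_mulD CF_1neq0.

Lemma CF_mulV (x : CF) : x != RtoC 0 -> Cmult (Cinv x) x = RtoC 1.
Proof. by move=> /eqP H; apply: Cinv_l. Qed.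
Lemma CF_inv0 : Cinv (RtoC 0) = RtoC 0 :> CF.
Proof. by rewrite /Cinv /RtoC /= /Rdiv Ropp_0 !Rmult_0_l. Qed.
HB.instance Definition _ := GRing.ComNzRing_isField.Build CF CF_mulV CF_inv0.

Local Open Scope ring_scope.

Lemma CpownE (z : CF) n : Cpown z n = z ^+ n.
Proof. by elim: n => [|n IH] //=; rewrite exprS -IH. Qed.

Lemma CinvE (z : CF) : Cinv z = z^-1. Proof. by []. Qed.

(** Inversion commutes with products even when a factor vanishes, because the inverse of 0 is 0. *)
Lemma Cpow_sign_prod (I : finType) sigma (f : I -> CF) :
  Cpow_sign sigma (\big[Cmult/RtoC 1]_i f i) = \prod_i (Cpow_sign sigma (f i) : CF).
Proof. by case: sigma => //; symmetry; apply: (@prodfV CF I _ xpredT f). Qed.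

Lemma Shat_pow N sigma Gx (v w : 'I_N -> C) :
  Cpow_sign sigma (Shat Gx v w) =
  \prod_j \prod_l (Cpow_sign sigma (Gx (Cminus (v j) (w l))) : CF).
Proof. by rewrite /Shat Cpow_sign_prod; apply: eq_bigr => j _; rewrite Cpow_sign_prod. Qed.

Lemma Ahat_sum ap am N sgn k d (f : ('I_N -> C) -> C) (u : 'I_N -> C) (X : 'I_N -> CF) (g : {set 'I_N} -> CF) :
  (forall m n, Cmult (RtoC 2) (sdelta ap am d (Cminus (u m) (u n))) = X m / X n - X n / X m) ->
  (forall I : {set 'I_N}, f (fun m => if m \in I then
     (if sgn then Cminus (u m) (Cmult Ci (RtoC (adelta ap am (negb d))))
      else Cplus (u m) (Cmult Ci (RtoC (adelta ap am (negb d)))))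
     else u m) = g I) ->
  Ahat ap am sgn k d f u =
  (if sgn then - (Ci : CF) else Ci) ^+ (k * (N - k)) *
  \sum_(I : {set 'I_N} | #|I| == k) KernelDuality.pair_weight X I * g I.
Proof.
move=> uX fg; rewrite /Ahat CpownE; apply: (congr2 (@GRing.mul CF)); first by case: sgn fg.
apply: eq_bigr => I _; rewrite fg; apply: (congr2 (@GRing.mul CF)) => //.
by apply: eq_bigr => m _; apply: eq_bigr => n _; rewrite uX CinvE.
Qed.

Section Kernel.
Variables (ap am : R) (hap : (0 < ap)%R) (ham : (0 < am)%R) (Gx : C -> C) (P : C -> Prop).
Hypothesis hG : hyperbolic_gamma_ext ap am Gx P.
Variables (N : nat) (sgn : bool) (k : nat) (d sigma : bool) (v w : 'I_N -> C).
Hypothesis hk : (k <= N)%N.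
Hypothesis hv : forall m n : 'I_N, m <> n -> sdelta ap am d (Cminus (v m) (v n)) <> RtoC 0.
Hypothesis hw : forall m n : 'I_N, m <> n -> sdelta ap am d (Cminus (w m) (w n)) <> RtoC 0.
Hypothesis hP : forall j l : 'I_N,
  ~ P (Cminus (v j) (w l)) /\
  ~ P (Cminus (Cminus (v j) (w l)) (diff_shift ap am sgn d)).
Hypothesis hnz : sigma = false -> forall j l : 'I_N,
  Gx (Cminus (v j) (w l)) <> RtoC 0 /\
  Gx (Cminus (Cminus (v j) (w l)) (diff_shift ap am sgn d)) <> RtoC 0.

Let c := adelta ap am d.
Let e := adelta ap am (negb d).
Let X (j : 'I_N) : CF := expo c (v j).
Let Y (l : 'I_N) : CF := expo c (Cplus (w l) (half_shift e sgn)).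
Let a (j l : 'I_N) : CF := Cpow_sign sigma (Gx (Cminus (v j) (w l))).
Let b (j l : 'I_N) : CF :=
  Cpow_sign sigma (Gx (Cminus (Cminus (v j) (w l)) (diff_shift ap am sgn d))).

Let c_gt0 : (0 < c)%R. Proof. by rewrite /c /adelta; case: d. Qed.

Let vX m n : Cmult (RtoC 2) (sdelta ap am d (Cminus (v m) (v n))) = X m / X n - X n / X m.
Proof. by rewrite (@two_sdelta ap am d (v m) (v n) (RtoC 0) c_gt0) !Cplus_0_r. Qed.

Let wY m n : Cmult (RtoC 2) (sdelta ap am d (Cminus (w m) (w n))) = Y m / Y n - Y n / Y m.
Proof. exact: (@two_sdelta ap am d (w m) (w n) (half_shift e sgn) c_gt0). Qed.

Let two_neq0 : RtoC 2 <> RtoC 0.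
Proof. move=> E; injection E => E'; lra. Qed.

(** Inverting the kernel reverses the relation just as changing [sgn] does, so only the agreement of
    [sgn] and [sigma] matters. *)
Let ab j l : if sgn == sigma then a j l = (X j / Y l + Y l / X j) * b j l
             else b j l = (X j / Y l + Y l / X j) * a j l.
Proof.
have [P1 P2] := hP j l.
have : if sgn then Gx (Cminus (v j) (w l)) =
    (X j / Y l + Y l / X j) * Gx (Cminus (Cminus (v j) (w l)) (diff_shift ap am sgn d)) :> CF
  else Gx (Cminus (Cminus (v j) (w l)) (diff_shift ap am sgn d)) =
    (X j / Y l + Y l / X j) * Gx (Cminus (v j) (w l)) :> CF.
  exact: (gamma_shift_expo ap am hap ham Gx P hG sgn d (v j) (w l) P1 P2).
move: (X j / Y l + Y l / X j) (hnz) => q; rewrite /a /b; case: sigma => hnz'.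
  by case: (sgn).
have [N1 N2] := hnz' erefl j l.
move: N1 N2; set A : CF := Gx (Cminus (v j) (w l)); set B : CF := Gx (Cminus (Cminus _ _) _).
move=> /(@eqP CF) N1 /(@eqP CF) N2.
have inv_eq (x y z : CF) : x != 0 -> x = z * y -> y^-1 = z * x^-1.
  move=> x0 xE; have z0 : z != 0 by apply: contraNneq x0 => z0; rewrite xE z0 mul0r.
  by rewrite xE invfM mulrA mulfV ?mul1r.
by case: (sgn) => /= E; apply: inv_eq.
Qed.

Let exp_diff_neq0 (Z : 'I_N -> CF) (u : 'I_N -> C) :
  (forall m n, Cmult (RtoC 2) (sdelta ap am d (Cminus (u m) (u n))) = Z m / Z n - Z n / Z m) ->
  (forall m n : 'I_N, m <> n -> sdelta ap am d (Cminus (u m) (u n)) <> RtoC 0) ->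
  forall m n, m != n -> Z m / Z n - Z n / Z m != 0.
Proof.
by move=> uZ hu m n /eqP mn; rewrite -uZ; apply/eqP/Cmult_neq_0; [exact: two_neq0|exact: hu].
Qed.

Theorem kernel_identity :
  Ahat ap am sgn k d (fun v' => Cpow_sign sigma (Shat Gx v' w)) v =
  Ahat ap am (negb sgn) k d (fun w' => Cpow_sign sigma (Shat Gx v w')) w.
Proof.
(* The entries depend on [v j - w l] only, so the shift of [v j] and the opposite shift of [w l]
   yield the same [b j l]. *)
have fv (I : {set 'I_N}) :
    Cpow_sign sigma (Shat Gx (fun m => if m \in I then
       (if sgn then Cminus (v m) (Cmult Ci (RtoC e)) else Cplus (v m) (Cmult Ci (RtoC e))) else v
         m) w) =
    \prod_j \prod_l (if j \in I then b j l else a j l).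
  rewrite Shat_pow; apply: eq_bigr => j _; apply: eq_bigr => l _.
  case: (j \in I) => //; rewrite /b /diff_shift -/e; congr (Cpow_sign _ (Gx _)).
  by case: (sgn); rewrite ?Rmult_1_l ?Ci_neg /=; ring.
have fw (J : {set 'I_N}) :
    Cpow_sign sigma (Shat Gx v (fun m => if m \in J then
       (if negb sgn then Cminus (w m) (Cmult Ci (RtoC e)) else Cplus (w m) (Cmult Ci (RtoC e)))
         else w m)) =
    \prod_j \prod_l (if l \in J then b j l else a j l).
  rewrite Shat_pow; apply: eq_bigr => j _; apply: eq_bigr => l _.
  case: (l \in J) => //; rewrite /b /diff_shift -/e; congr (Cpow_sign _ (Gx _)).
  by case: (sgn); rewrite ?Rmult_1_l ?Ci_neg /=; ring.
rewrite (Ahat_sum ap am N sgn k d (fun v' => Cpow_sign sigma (Shat Gx v' w)) v X _ vX fv).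
rewrite (Ahat_sum ap am N (negb sgn) k d (fun w' => Cpow_sign sigma (Shat Gx v w')) w Y _ wY fw).
have X0 j : X j != 0 by apply/eqP/Cexp_neq0.
have Y0 j : Y j != 0 by apply/eqP/Cexp_neq0.
rewrite (KernelDuality.kernel_duality X0 Y0 (exp_diff_neq0 X v vX hv) (exp_diff_neq0 Y w wY hw) _ _ ab) ?card_ord //.
rewrite [LHS]mulrA; apply: (congr2 (@GRing.mul CF)) => //.
(* The sign [(-1)^(k (N - k))] of the duality exchanges the phases with base [- Ci] and [Ci]. *)
by move: (Ci : CF) => z; case: (sgn) => /=; rewrite -exprMn mulrN1 ?opprK.
Qed.
End Kernel.
End ComplexField.

Theorem theorem2p10 (ap am : R) (hap : 0 < ap) (ham : 0 < am)
  (Gx : C -> C) (P : C -> Prop) (hG : hyperbolic_gamma_ext ap am Gx P)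
  (N : nat) (sgn : bool) (k : nat) (hk : (1 <= k <= N)%nat)
  (d : bool) (sigma : bool) (v w : 'I_N -> C)
  (hv : forall m n : 'I_N, m <> n -> sdelta ap am d (Cminus (v m) (v n)) <> RtoC 0)
  (hw : forall m n : 'I_N, m <> n -> sdelta ap am d (Cminus (w m) (w n)) <> RtoC 0)
  (hP : forall j l : 'I_N,
      ~ P (Cminus (v j) (w l)) /\
      ~ P (Cminus (Cminus (v j) (w l)) (diff_shift ap am sgn d)))
  (hnz : sigma = false -> forall j l : 'I_N,
      Gx (Cminus (v j) (w l)) <> RtoC 0 /\
      Gx (Cminus (Cminus (v j) (w l)) (diff_shift ap am sgn d)) <> RtoC 0) :
  Cminus (Ahat ap am sgn k d (fun v' => Cpow_sign sigma (Shat Gx v' w)) v)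
         (Ahat ap am (negb sgn) k d (fun w' => Cpow_sign sigma (Shat Gx v w')) w)
  = RtoC 0.
Proof.
rewrite (ComplexField.kernel_identity ap am hap ham Gx P hG N sgn k d sigma v w) //.
  exact: Cplus_opp_r.
by case/andP: hk.
Qed.
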